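(* Let $\Omega\subseteq\mathbb{C}$ be a domain, let $\mathcal{F}$ be a family of meromorphic functions on $\Omega$, and let $\psi_1,\psi_2,\psi_3$ be pairwise distinct (i.e. pairwise not identically equal) meromorphic functions on $\Omega$. Suppose that (i) every pair $f,g\in\mathcal{F}$ shares the set $S=\{\psi_1(z),\psi_2(z),\psi_3(z)\}$ in $\Omega$; (ii) for every $f\in\mathcal{F}$ and every $z_0\in\Omega$: if $\psi_i(z_0)=\psi_j(z_0)$ for some $i\neq j$ in $\{1,2,3\}$, then $f(z_0)\neq\psi_i(z_0)$. Then $\mathcal{F}$ is normal in $\Omega$.
   Context: Values are taken in the extended complex plane $\overline{\mathbb{C}}=\mathbb{C}\cup\{\infty\}$, so $f(z_0)=\psi_i(z_0)$ includes the case where both equal $\infty$. Two meromorphic functions $f,g$ on $\Omega$ share the set $S=\{\psi_1(z),\psi_2(z),\psi_3(z)\}$ (ignoring multiplicities) in $\Omega$ if $\{z\in\Omega: f(z)\in\{\psi_1(z),\psi_2(z),\psi_3(z)\}\}=\{z\in\Omega: g(z)\in\{\psi_1(z),\psi_2(z),\psi_3(z)\}\}$. A family of meromorphic functions on $\Omega$ is normal in $\Omega$ if every sequence in it has a subsequence converging locally uniformly on $\Omega$ with respect to the spherical metric to a meromorphic function or to the constant $\infty$. *)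

(* Defs.v *)
From Stdlib Require Import Reals.
Open Scope R_scope.

Definition Cx : Type := (R * R)%type.
Definition Cadd (a b : Cx) : Cx := (fst a + fst b, snd a + snd b).
Definition Csub (a b : Cx) : Cx := (fst a - fst b, snd a - snd b).
Definition Cmul (a b : Cx) : Cx :=
  (fst a * fst b - snd a * snd b, fst a * snd b + snd a * fst b).
Definition Cinv (a : Cx) : Cx :=
  (fst a / (fst a ^ 2 + snd a ^ 2), - snd a / (fst a ^ 2 + snd a ^ 2)).
Definition Cdiv (a b : Cx) : Cx := Cmul a (Cinv b).
Definition Cnorm (a : Cx) : R := sqrt (fst a ^ 2 + snd a ^ 2).

(* extended complex plane: None denotes infinity *)
Definition Cext : Type := option Cx.

(* finite part (junk value 0 at infinity) *)
Definition fin (f : Cx -> Cext) (z : Cx) : Cx :=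
  match f z with Some w => w | None => (0, 0) end.

Definition Cdifferentiable (g : Cx -> Cx) (z0 : Cx) : Prop :=
  exists l : Cx, forall eps, 0 < eps -> exists delta, 0 < delta /\
    forall z, 0 < Cnorm (Csub z z0) < delta ->
      Cnorm (Csub (Cdiv (Csub (g z) (g z0)) (Csub z z0)) l) < eps.

Definition open_set (U : Cx -> Prop) : Prop :=
  forall z, U z -> exists r, 0 < r /\ forall w, Cnorm (Csub w z) < r -> U w.

Definition domain (Om : Cx -> Prop) : Prop :=
  open_set Om /\ (exists z, Om z) /\
  forall U V : Cx -> Prop, open_set U -> open_set V ->
    (forall z, Om z -> U z \/ V z) ->
    (forall z, Om z -> U z -> V z -> False) ->
    (forall z, Om z -> ~ U z) \/ (forall z, Om z -> ~ V z).

Definition meromorphic_on (Om : Cx -> Prop) (f : Cx -> Cext) : Prop :=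
  forall z0, Om z0 -> exists r, 0 < r /\
    (forall z, Cnorm (Csub z z0) < r -> Om z) /\
    (forall z, 0 < Cnorm (Csub z z0) < r ->
        f z <> None /\ Cdifferentiable (fin f) z) /\
    ((f z0 <> None /\ Cdifferentiable (fin f) z0) \/
     (f z0 = None /\ forall M, exists d, 0 < d /\
        forall z, 0 < Cnorm (Csub z z0) < d -> M < Cnorm (fin f z))).

Definition chordal (a b : Cext) : R :=
  match a, b with
  | Some x, Some y =>
      2 * Cnorm (Csub x y) / sqrt ((1 + Cnorm x ^ 2) * (1 + Cnorm y ^ 2))
  | Some x, None | None, Some x => 2 / sqrt (1 + Cnorm x ^ 2)
  | None, None => 0
  end.

Definition loc_unif_conv (Om : Cx -> Prop) (fs : nat -> Cx -> Cext) (g : Cx -> Cext) : Prop :=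
  forall z0, Om z0 -> exists r, 0 < r /\
    forall eps, 0 < eps -> exists N : nat, forall n, (N <= n)%nat ->
      forall z, Om z -> Cnorm (Csub z z0) < r -> chordal (fs n z) (g z) < eps.

Definition normal_family (Om : Cx -> Prop) (F : (Cx -> Cext) -> Prop) : Prop :=
  forall fs : nat -> Cx -> Cext, (forall n, F (fs n)) ->
    exists phi : nat -> nat, (forall n, (phi n < phi (S n))%nat) /\
    exists g : Cx -> Cext,
      (meromorphic_on Om g \/ (forall z, Om z -> g z = None)) /\
      loc_unif_conv Om (fun n => fs (phi n)) g.

Definition in_set3 (w : Cext) (a b c : Cext) : Prop := w = a \/ w = b \/ w = c.

Definition share_set (Om : Cx -> Prop) (f g p1 p2 p3 : Cx -> Cext) : Prop :=
  forall z, Om z -> (in_set3 (f z) (p1 z) (p2 z) (p3 z) <-> in_set3 (g z) (p1 z) (p2 z) (p3 z)).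

Definition not_ident_eq (Om : Cx -> Prop) (f g : Cx -> Cext) : Prop :=
  ~ (forall z, Om z -> f z = g z).

(* Main.v *)
(** The family is shown to be uniformly Lipschitz, for the chordal distance, near every
    point [z0]; the Arzela-Ascoli theorem on the sphere then gives normality.

    If one member of the family takes values in [S] everywhere, then sharing and the
    identity theorem leave only [p1], [p2], [p3] as members. Otherwise there is a punctured
    disc around [z0] on which the [pi] are distinct and no member takes a value in [S], and by
    hypothesis (ii) each member [f] omits two of the [pi], say [a] and [b], at [z0] as well.
    The cross ratio [H] of [f], [a], [b] and the third function [c] omits 0, 1 and infinity on
    the punctured disc. Robinson's explicit metric of negative curvature on [C \ {0,1}] and
    Ahlfors' lemma, applied to [H (z0 + exp zeta)], bound the spherical length of the image
    of a small circle under [H], uniformly in [f], so that either [H] or [1/H] is bounded on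
    that circle. Hence [f / (f - b)] and [1 / (f - b)], or the same with [a] for [b], are
    bounded on the circle, by the maximum principle on the disc, and Cauchy's estimate makes
    them Lipschitz. In homogeneous coordinates this argument is insensitive to poles and to
    coincidences [a z0 = b z0].

    Cauchy's theory is derived from Goursat's lemma on rectangles, applied to
    [f (z0 + exp zeta)] on rectangles of height [2 pi]. *)

Require Import Defs.
From Stdlib Require Import Reals Lra Lia ClassicalEpsilon.
From Stdlib Require Cantor.
From Coquelicot Require Import Coquelicot.

(** * Complex derivatives and integrals *)

(** A member may still take one of the three values at [z0], and [p1], [p2], [p3] may collide there,
    so Montel's theorem for three omitted values does not apply on a disc around [z0]. The cross
    ratio can have a zero or a pole at the centre. Hence the estimate is made on a circle and
    carried inward by the maximum principle, which calls for functions holomorphic at [z0] too. The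
    two coordinates normalized by [b] qualify since [f] omits [b] on the whole disc. As [f] omits
    [a] as well, [a] and [b] may be exchanged when it is [1/H] that is bounded.

    No value of [H] is prescribed, so a bound of Schottky type is out of reach. In the logarithmic
    coordinate, however, every circle has length [2 pi], while its distance to the edge of the half
    plane grows as the radius shrinks. Negative curvature then makes the image short, wherever it
    lies on the sphere. Robinson's density is elementary: its curvature bound and its comparison
    with the spherical density become polynomial inequalities in [|w|^(1/3)] and [|w - 1|^(1/3)]. *)

Definition Ccont (f : C -> C) (z : C) : Prop :=
  forall eps, 0 < eps -> exists d, 0 < d /\
    forall w, Cmod (w - z) < d -> Cmod (f w - f z) < eps.

(** The quotient is cleared, so that [w = z] needs no exception; [Cdifferentiable_Hol] links this
    form with the difference quotient of the statement. *)
Definition cder (f : C -> C) (z l : C) : Prop :=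
  forall eps, 0 < eps -> exists d, 0 < d /\
    forall w, Cmod (w - z) < d -> Cmod (f w - f z - l * (w - z)) <= eps * Cmod (w - z).

Definition Hol (f : C -> C) (z : C) : Prop := exists l, cder f z l.

Lemma Cmod_minus_sym (x y : C) : Cmod (x - y) = Cmod (y - x).
Proof. rewrite <- Cmod_opp. f_equal. ring. Qed.

Lemma Cmod_sub_le (x y : C) : Cmod (x - y) <= Cmod x + Cmod y.
Proof. unfold Cminus. rewrite <- (Cmod_opp y). apply Cmod_triangle. Qed.

Lemma Cmod_triangle_sub (x y z : C) : Cmod (x - z) <= Cmod (x - y) + Cmod (y - z).
Proof. replace (x - z)%C with ((x - y) + (y - z))%C by ring. apply Cmod_triangle. Qed.

Lemma Cmod_le_add_sub (x y : C) : Cmod x <= Cmod y + Cmod (x - y).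
Proof. replace x with (y + (x - y))%C at 1 by ring. apply Cmod_triangle. Qed.

Lemma Cmod_refl (z : C) : Cmod (z - z) = 0.
Proof. replace (z - z)%C with (RtoC 0) by ring. apply Cmod_0. Qed.

Lemma Cmod_sub_pos (x y : C) : x <> y -> 0 < Cmod (x - y).
Proof.
  intros H. apply Cmod_gt_0. intros E. apply H.
  replace x with ((x - y) + y)%C by ring. rewrite E. ring.
Qed.

Lemma Cmod_sub_neq0 (x y : C) : 0 < Cmod (x - y) -> (x - y)%C <> 0%C.
Proof. apply Cmod_gt_0. Qed.

Lemma im_le_Cmod (c : C) : Rabs (Im c) <= Cmod c.
Proof. eapply Rle_trans; [apply Rmax_r | apply Rmax_Cmod]. Qed.

Lemma Cmod_le_Re_Im (c : C) : Cmod c <= Rabs (Re c) + Rabs (Im c).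
Proof.
  destruct c as [x y]; simpl.
  replace (x, y) with (RtoC x + Ci * RtoC y)%C by (unfold Cplus, Cmult, Ci, RtoC; simpl; f_equal; ring).
  eapply Rle_trans; [apply Cmod_triangle|].
  rewrite Cmod_mult, Cmod_Ci, !Cmod_R. lra.
Qed.

Lemma C_eq_dec (x y : C) : {x = y} + {x <> y}.
Proof. apply excluded_middle_informative. Qed.

Lemma Ccont_ext_loc (f g : C -> C) (z : C) :
  (exists d, 0 < d /\ forall w, Cmod (w - z) < d -> f w = g w) -> Ccont f z -> Ccont g z.
Proof.
  intros (d & Hd & E) H eps He. destruct (H eps He) as (d1 & Hd1 & H1).
  exists (Rmin d d1). split; [apply Rmin_glb_lt; auto|]. intros w Hw.
  rewrite <- !E; [apply H1| |].
  - eapply Rlt_le_trans; [exact Hw|apply Rmin_r].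
  - rewrite Cmod_refl; auto.
  - eapply Rlt_le_trans; [exact Hw|apply Rmin_l].
Qed.

Lemma Ccont_const (c z : C) : Ccont (fun _ => c) z.
Proof. intros eps He. exists 1. split; [lra|]. intros. rewrite Cmod_refl; auto. Qed.

Lemma Ccont_id (z : C) : Ccont (fun w => w) z.
Proof. intros eps He. exists eps. auto. Qed.

Lemma Ccont_plus (f g : C -> C) (z : C) :
  Ccont f z -> Ccont g z -> Ccont (fun w => f w + g w)%C z.
Proof.
  intros Hf Hg eps He.
  destruct (Hf (eps / 2) ltac:(lra)) as (d1 & Hd1 & H1).
  destruct (Hg (eps / 2) ltac:(lra)) as (d2 & Hd2 & H2).
  exists (Rmin d1 d2). split; [apply Rmin_glb_lt; auto|]. intros w Hw.
  specialize (H1 w (Rlt_le_trans _ _ _ Hw (Rmin_l _ _))).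
  specialize (H2 w (Rlt_le_trans _ _ _ Hw (Rmin_r _ _))).
  replace (f w + g w - (f z + g z))%C with ((f w - f z) + (g w - g z))%C by ring.
  eapply Rle_lt_trans; [apply Cmod_triangle|]. lra.
Qed.

Lemma Ccont_bound (f : C -> C) (z : C) :
  Ccont f z -> exists d, 0 < d /\ forall w, Cmod (w - z) < d -> Cmod (f w) <= Cmod (f z) + 1.
Proof.
  intros H. destruct (H 1 ltac:(lra)) as (d & Hd & H1). exists d. split; auto.
  intros w Hw. specialize (H1 w Hw). pose proof (Cmod_le_add_sub (f w) (f z)). lra.
Qed.

Lemma Ccont_mult (f g : C -> C) (z : C) :
  Ccont f z -> Ccont g z -> Ccont (fun w => f w * g w)%C z.
Proof.
  intros Hf Hg eps He.
  destruct (Ccont_bound g z Hg) as (d0 & Hd0 & H0).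
  set (A := Cmod (f z)). set (B := Cmod (g z)).
  assert (HA : 0 <= A) by apply Cmod_ge_0.
  assert (HB : 0 <= B) by apply Cmod_ge_0.
  assert (He' : 0 < eps / (2 * (A + B + 1))) by (apply Rdiv_lt_0_compat; lra).
  destruct (Hf _ He') as (d1 & Hd1 & H1). destruct (Hg _ He') as (d2 & Hd2 & H2).
  exists (Rmin d0 (Rmin d1 d2)). split; [repeat apply Rmin_glb_lt; auto|]. intros w Hw.
  apply Rmin_Rgt_l in Hw as [Hw0 Hw]. apply Rmin_Rgt_l in Hw as [Hw1 Hw2].
  specialize (H0 w Hw0). specialize (H1 w Hw1). specialize (H2 w Hw2).
  replace (f w * g w - f z * g z)%C with ((f w - f z) * g w + f z * (g w - g z))%C by ring.
  eapply Rle_lt_trans; [apply Cmod_triangle|]. rewrite !Cmod_mult. fold A.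
  set (e := eps / (2 * (A + B + 1))) in *.
  assert (Hee : e * (2 * (A + B + 1)) = eps) by (unfold e; field; lra).
  pose proof (Cmod_ge_0 (f w - f z)). pose proof (Cmod_ge_0 (g w)).
  pose proof (Cmod_ge_0 (g w - g z)). fold B in H0.
  assert (Cmod (f w - f z) * Cmod (g w) <= e * (B + 1)) by (apply Rmult_le_compat; lra).
  assert (A * Cmod (g w - g z) <= A * e) by (apply Rmult_le_compat_l; lra).
  nra.
Qed.

Lemma Ccont_away (f : C -> C) (z : C) :
  Ccont f z -> f z <> 0%C ->
  exists d, 0 < d /\ forall w, Cmod (w - z) < d -> Cmod (f z) / 2 <= Cmod (f w).
Proof.
  intros H H0. apply Cmod_gt_0 in H0.
  destruct (H (Cmod (f z) / 2) ltac:(lra)) as (d & Hd & H1). exists d. split; auto.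
  intros w Hw. specialize (H1 w Hw). pose proof (Cmod_le_add_sub (f z) (f w)).
  rewrite Cmod_minus_sym in H2. lra.
Qed.

Lemma Ccont_inv (f : C -> C) (z : C) :
  Ccont f z -> f z <> 0%C -> Ccont (fun w => / f w)%C z.
Proof.
  intros Hf Hz eps He. destruct (Ccont_away f z Hf Hz) as (d0 & Hd0 & H0).
  pose proof Hz as HA. apply Cmod_gt_0 in HA. set (A := Cmod (f z)) in *.
  assert (He' : 0 < eps * (A * A / 2)) by (apply Rmult_lt_0_compat; nra).
  destruct (Hf _ He') as (d1 & Hd1 & H1).
  exists (Rmin d0 d1). split; [apply Rmin_glb_lt; auto|]. intros w Hw.
  apply Rmin_Rgt_l in Hw as [Hw0 Hw1]. specialize (H0 w Hw0). specialize (H1 w Hw1).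
  assert (Hw : f w <> 0%C) by (apply Cmod_gt_0; lra).
  replace (/ f w - / f z)%C with ((f z - f w) / (f w * f z))%C by (field; auto).
  rewrite Cmod_div by (apply Cmult_neq_0; auto).
  rewrite Cmod_mult, Cmod_minus_sym. fold A.
  apply Rlt_div_l; [nra|]. eapply Rlt_le_trans; [exact H1|].
  apply Rmult_le_compat_l; nra.
Qed.

Lemma Ccont_comp (f g : C -> C) (z : C) :
  Ccont g z -> Ccont f (g z) -> Ccont (fun w => f (g w)) z.
Proof.
  intros Hg Hf eps He. destruct (Hf eps He) as (d & Hd & H1).
  destruct (Hg d Hd) as (d2 & Hd2 & H2). exists d2. auto.
Qed.

Lemma Ccont_opp (f : C -> C) (z : C) : Ccont f z -> Ccont (fun w => - f w)%C z.
Proof.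
  intros H. apply Ccont_ext_loc with (fun w => (-(1)) * f w)%C.
  - exists 1. split; [lra|]. intros; ring.
  - apply Ccont_mult; auto. apply Ccont_const.
Qed.

Lemma Ccont_minus (f g : C -> C) (z : C) :
  Ccont f z -> Ccont g z -> Ccont (fun w => f w - g w)%C z.
Proof. intros. apply Ccont_plus; auto. apply Ccont_opp; auto. Qed.

Lemma Ccont_div (f g : C -> C) (z : C) :
  Ccont f z -> Ccont g z -> g z <> 0%C -> Ccont (fun w => f w / g w)%C z.
Proof. intros. apply Ccont_mult; auto. apply Ccont_inv; auto. Qed.

Lemma Ccont_pow (f : C -> C) (n : nat) (z : C) : Ccont f z -> Ccont (fun w => f w ^ n)%C z.
Proof.
  intros H. induction n; simpl; [apply Ccont_const|]. apply Ccont_mult; auto.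
Qed.

Lemma cder_cont (f : C -> C) (z l : C) : cder f z l -> Ccont f z.
Proof.
  intros H eps He. destruct (H 1 ltac:(lra)) as (d & Hd & H1).
  set (A := Cmod l). assert (0 <= A) by apply Cmod_ge_0.
  exists (Rmin d (eps / (A + 2))). split; [apply Rmin_glb_lt; auto; apply Rdiv_lt_0_compat; lra|].
  intros w Hw. apply Rmin_Rgt_l in Hw as [Hw1 Hw2]. specialize (H1 w Hw1).
  apply Rlt_div_r in Hw2; [|lra].
  replace (f w - f z)%C with ((f w - f z - l * (w - z)) + l * (w - z))%C by ring.
  eapply Rle_lt_trans; [apply Cmod_triangle|]. rewrite Cmod_mult. fold A.
  pose proof (Cmod_ge_0 (w - z)). nra.
Qed.

Lemma Hol_cont (f : C -> C) (z : C) : Hol f z -> Ccont f z.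
Proof. intros [l H]. eapply cder_cont; eauto. Qed.

(* Caratheodory's characterization of differentiability; it reduces the
   differentiation rules to the continuity rules. *)
Lemma cder_slope (f : C -> C) (z l : C) :
  cder f z l <-> exists phi, Ccont phi z /\ phi z = l /\
    exists d, 0 < d /\ forall w, Cmod (w - z) < d -> (f w = f z + phi w * (w - z))%C.
Proof.
  split.
  - intros H. exists (fun w => if C_eq_dec w z then l else (f w - f z) / (w - z))%C.
    split; [|split].
    + intros eps He. destruct (H (eps / 2) ltac:(lra)) as (d & Hd & H1).
      exists d. split; auto. intros w Hw. specialize (H1 w Hw).
      destruct (C_eq_dec z z) as [_|n]; [|congruence].
      destruct (C_eq_dec w z) as [->|n]; [rewrite Cmod_refl; auto|].
      apply Cmod_sub_pos in n.
      replace ((f w - f z) / (w - z) - l)%C with ((f w - f z - l * (w - z)) / (w - z))%C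
        by (field; apply Cmod_sub_neq0; auto).
      rewrite Cmod_div by (apply Cmod_sub_neq0; auto).
      apply Rlt_div_l; auto. nra.
    + destruct (C_eq_dec z z) as [_|n]; congruence.
    + exists 1. split; [lra|]. intros w _. destruct (C_eq_dec w z) as [->|n]; [ring|].
      field. apply Cmod_sub_neq0, Cmod_sub_pos; auto.
  - intros (phi & Hc & E & d & Hd & H) eps He.
    destruct (Hc eps He) as (d1 & Hd1 & H1). exists (Rmin d d1).
    split; [apply Rmin_glb_lt; auto|]. intros w Hw. apply Rmin_Rgt_l in Hw as [Hw1 Hw2].
    rewrite (H w) by auto. rewrite <- E.
    replace (f z + phi w * (w - z) - f z - phi z * (w - z))%C with ((phi w - phi z) * (w - z))%C by ring.
    rewrite Cmod_mult. apply Rmult_le_compat_r; [apply Cmod_ge_0|]. left; auto.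
Qed.

Lemma cder_unique (f : C -> C) (z l m : C) : cder f z l -> cder f z m -> l = m.
Proof.
  intros Hl Hm. destruct (C_eq_dec l m) as [|n]; auto. exfalso. apply Cmod_sub_pos in n.
  set (e := Cmod (l - m)) in *.
  destruct (Hl (e / 4) ltac:(lra)) as (d1 & Hd1 & H1).
  destruct (Hm (e / 4) ltac:(lra)) as (d2 & Hd2 & H2).
  set (h := Rmin d1 d2 / 2).
  assert (Hh : 0 < h) by (unfold h; pose proof (Rmin_glb_lt _ _ _ Hd1 Hd2); lra).
  pose proof (Rmin_l d1 d2). pose proof (Rmin_r d1 d2).
  assert (E : (z + RtoC h - z)%C = RtoC h) by ring.
  specialize (H1 (z + RtoC h)%C). specialize (H2 (z + RtoC h)%C).
  rewrite E, Cmod_R, Rabs_pos_eq in H1, H2 by lra.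
  specialize (H1 ltac:(unfold h in *; lra)). specialize (H2 ltac:(unfold h in *; lra)).
  assert (He : Cmod ((l - m) * RtoC h) = e * h).
  { rewrite Cmod_mult, Cmod_R, Rabs_pos_eq by lra. reflexivity. }
  set (v := f (z + RtoC h)%C) in *.
  replace ((l - m) * RtoC h)%C with ((v - f z - m * RtoC h) - (v - f z - l * RtoC h))%C in He by ring.
  pose proof (Cmod_sub_le (v - f z - m * RtoC h) (v - f z - l * RtoC h)).
  nra.
Qed.

Lemma cder_ext_loc (f g : C -> C) (z l : C) :
  (exists d, 0 < d /\ forall w, Cmod (w - z) < d -> f w = g w) -> cder f z l -> cder g z l.
Proof.
  intros (d & Hd & E) H eps He. destruct (H eps He) as (d1 & Hd1 & H1).
  exists (Rmin d d1). split; [apply Rmin_glb_lt; auto|]. intros w Hw.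
  apply Rmin_Rgt_l in Hw as [Hw1 Hw2].
  rewrite <- !E; auto. rewrite Cmod_refl; auto.
Qed.

Lemma Hol_ext_loc (f g : C -> C) (z : C) :
  (exists d, 0 < d /\ forall w, Cmod (w - z) < d -> f w = g w) -> Hol f z -> Hol g z.
Proof. intros E [l H]. exists l. eapply cder_ext_loc; eauto. Qed.

Lemma Hol_ext (f g : C -> C) (z : C) : (forall w, f w = g w) -> Hol f z -> Hol g z.
Proof. intros E. apply Hol_ext_loc. exists 1. split; [lra|auto]. Qed.

Lemma cder_eq (f : C -> C) (z l m : C) : cder f z l -> l = m -> cder f z m.
Proof. intros H <-. exact H. Qed.

Lemma cder_const (c z : C) : cder (fun _ => c) z 0.
Proof.
  apply cder_slope. exists (fun _ => 0%C). split; [apply Ccont_const|]. split; auto.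
  exists 1. split; [lra|]. intros; ring.
Qed.

Lemma cder_id (z : C) : cder (fun w => w) z 1.
Proof.
  apply cder_slope. exists (fun _ => 1%C). split; [apply Ccont_const|]. split; auto.
  exists 1. split; [lra|]. intros; ring.
Qed.

Lemma cder_plus (f g : C -> C) (z l m : C) :
  cder f z l -> cder g z m -> cder (fun w => f w + g w)%C z (l + m).
Proof.
  rewrite !cder_slope. intros (p & Hp & Ep & d1 & Hd1 & H1) (q & Hq & Eq & d2 & Hd2 & H2).
  exists (fun w => p w + q w)%C. split; [apply Ccont_plus; auto|]. split; [congruence|].
  exists (Rmin d1 d2). split; [apply Rmin_glb_lt; auto|]. intros w Hw.
  apply Rmin_Rgt_l in Hw as [Hw1 Hw2]. rewrite (H1 w), (H2 w) by auto. ring.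
Qed.

Lemma cder_mult (f g : C -> C) (z l m : C) :
  cder f z l -> cder g z m -> cder (fun w => f w * g w)%C z (l * g z + f z * m).
Proof.
  intros Hf Hg. pose proof (cder_cont _ _ _ Hg) as Cg. revert Hf Hg.
  rewrite !cder_slope. intros (p & Hp & Ep & d1 & Hd1 & H1) (q & Hq & Eq & d2 & Hd2 & H2).
  exists (fun w => p w * g w + f z * q w)%C. split.
  { apply Ccont_plus; apply Ccont_mult; auto. apply Ccont_const. }
  split; [congruence|].
  exists (Rmin d1 d2). split; [apply Rmin_glb_lt; auto|]. intros w Hw.
  apply Rmin_Rgt_l in Hw as [Hw1 Hw2]. rewrite (H1 w), (H2 w) by auto. ring.
Qed.

Lemma cder_inv (f : C -> C) (z l : C) :
  cder f z l -> f z <> 0%C -> cder (fun w => / f w)%C z (- l / (f z * f z)).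
Proof.
  intros Hf H0. pose proof (cder_cont _ _ _ Hf) as Cf.
  destruct (Ccont_away f z Cf H0) as (d0 & Hd0 & Haw). revert Hf.
  rewrite !cder_slope. intros (p & Hp & Ep & d1 & Hd1 & H1).
  exists (fun w => - p w / (f w * f z))%C. split.
  { apply Ccont_div; [apply Ccont_opp; auto|apply Ccont_mult; auto; apply Ccont_const|].
    apply Cmult_neq_0; auto. }
  split; [congruence|].
  exists (Rmin d0 d1). split; [apply Rmin_glb_lt; auto|]. intros w Hw.
  apply Rmin_Rgt_l in Hw as [Hw1 Hw2]. specialize (Haw w Hw1).
  assert (f w <> 0%C). { apply Cmod_gt_0 in H0. apply Cmod_gt_0. lra. }
  assert (E : (p w * (w - z))%C = (f w - f z)%C) by (rewrite (H1 w) by auto; ring).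
  replace (- p w / (f w * f z) * (w - z))%C with (- (p w * (w - z)) / (f w * f z))%C by (field; auto).
  rewrite E. field; auto.
Qed.

Lemma cder_comp (f g : C -> C) (z l m : C) :
  cder g z m -> cder f (g z) l -> cder (fun w => f (g w)) z (l * m).
Proof.
  intros Hg Hf. pose proof (cder_cont _ _ _ Hg) as Cg. revert Hf Hg.
  rewrite !cder_slope. intros (p & Hp & Ep & d1 & Hd1 & H1) (q & Hq & Eq & d2 & Hd2 & H2).
  exists (fun w => p (g w) * q w)%C. split.
  { apply Ccont_mult; auto. apply Ccont_comp; auto. }
  split; [congruence|].
  destruct (Cg d1 Hd1) as (d3 & Hd3 & H3).
  exists (Rmin d2 d3). split; [apply Rmin_glb_lt; auto|]. intros w Hw.
  apply Rmin_Rgt_l in Hw as [Hw1 Hw2]. rewrite (H1 (g w)) by auto.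
  replace (g w - g z)%C with (q w * (w - z))%C by (rewrite (H2 w) by auto; ring). ring.
Qed.

Lemma Hol_const (c z : C) : Hol (fun _ => c) z.
Proof. eexists; apply cder_const. Qed.

Lemma Hol_id (z : C) : Hol (fun w => w) z.
Proof. eexists; apply cder_id. Qed.

Lemma Hol_plus (f g : C -> C) (z : C) : Hol f z -> Hol g z -> Hol (fun w => f w + g w)%C z.
Proof. intros [l Hl] [m Hm]. eexists. apply cder_plus; eauto. Qed.

Lemma Hol_mult (f g : C -> C) (z : C) : Hol f z -> Hol g z -> Hol (fun w => f w * g w)%C z.
Proof. intros [l Hl] [m Hm]. eexists. apply cder_mult; eauto. Qed.

Lemma Hol_inv (f : C -> C) (z : C) : Hol f z -> f z <> 0%C -> Hol (fun w => / f w)%C z.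
Proof. intros [l Hl] H. eexists. apply cder_inv; eauto. Qed.

Lemma Hol_comp (f g : C -> C) (z : C) : Hol g z -> Hol f (g z) -> Hol (fun w => f (g w)) z.
Proof. intros [l Hl] [m Hm]. eexists. apply cder_comp; eauto. Qed.

Lemma Hol_opp (f : C -> C) (z : C) : Hol f z -> Hol (fun w => - f w)%C z.
Proof.
  intros H. apply Hol_ext with (fun w => (-(1)) * f w)%C; [intros; ring|].
  apply Hol_mult; auto. apply Hol_const.
Qed.

Lemma Hol_minus (f g : C -> C) (z : C) : Hol f z -> Hol g z -> Hol (fun w => f w - g w)%C z.
Proof. intros. apply Hol_plus; auto. apply Hol_opp; auto. Qed.

Lemma Hol_div (f g : C -> C) (z : C) :
  Hol f z -> Hol g z -> g z <> 0%C -> Hol (fun w => f w / g w)%C z.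
Proof. intros. apply Hol_mult; auto. apply Hol_inv; auto. Qed.

Lemma Hol_pow (f : C -> C) (n : nat) (z : C) : Hol f z -> Hol (fun w => f w ^ n)%C z.
Proof.
  intros H. induction n; simpl; [apply Hol_const|]. apply Hol_mult; auto.
Qed.

Lemma Cdifferentiable_Hol (f : C -> C) (z : C) : Cdifferentiable f z <-> Hol f z.
Proof.
  split.
  - intros (l & H). exists l. intros eps He. destruct (H eps He) as (d & Hd & H1).
    exists d. split; auto. intros w Hw.
    destruct (C_eq_dec w z) as [->|n].
    { replace (f z - f z - l * (z - z))%C with (RtoC 0) by ring. rewrite Cmod_0, Cmod_refl. lra. }
    apply Cmod_sub_pos in n. specialize (H1 w (conj n Hw)).
    change (Cmod ((f w - f z) / (w - z) - l) < eps) in H1.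
    replace (f w - f z - l * (w - z))%C with (((f w - f z) / (w - z) - l) * (w - z))%C
      by (field; apply Cmod_sub_neq0; auto).
    rewrite Cmod_mult. apply Rmult_le_compat_r; lra.
  - intros (l & H). exists l. intros eps He. destruct (H (eps / 2) ltac:(lra)) as (d & Hd & H1).
    exists d. split; auto. intros w [Hn Hw].
    change (0 < Cmod (w - z)) in Hn. change (Cmod (w - z) < d) in Hw.
    change (Cmod ((f w - f z) / (w - z) - l) < eps). specialize (H1 w Hw).
    replace ((f w - f z) / (w - z) - l)%C with ((f w - f z - l * (w - z)) / (w - z))%C
      by (field; apply Cmod_sub_neq0; auto).
    rewrite Cmod_div by (apply Cmod_sub_neq0; auto).
    apply Rlt_div_l; auto. nra.
Qed.

(** Continuity on the line is expressed through a function on [C], so that every rule proved for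
    [Ccont] applies as it stands. *)
Definition rcont (f : R -> C) (t : R) : Prop := Ccont (fun z => f (Re z)) (RtoC t).

Lemma rcontP (f : R -> C) (t : R) :
  rcont f t <-> forall eps, 0 < eps -> exists d, 0 < d /\
    forall s, Rabs (s - t) < d -> Cmod (f s - f t) < eps.
Proof.
  split; intros H eps He; destruct (H eps He) as (d & Hd & H1); exists d; split; auto.
  - intros s Hs. apply (H1 (RtoC s)). rewrite <- RtoC_minus, Cmod_R. auto.
  - intros w Hw. apply H1. eapply Rle_lt_trans; [|exact Hw].
    pose proof (re_le_Cmod (w - RtoC t)) as Hr. destruct w; simpl in *. exact Hr.
Qed.

Lemma rcont_comp (f : C -> C) (g : R -> C) (t : R) :
  rcont g t -> Ccont f (g t) -> rcont (fun s => f (g s)) t.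
Proof. intros Hg Hf. exact (Ccont_comp f (fun z => g (Re z)) (RtoC t) Hg Hf). Qed.

Lemma rcont_pair (x y : R -> R) (t : R) :
  continuous x t -> continuous y t -> rcont (fun s => (x s, y s)) t.
Proof.
  intros Hx Hy. apply rcontP. intros eps He.
  apply continuity_pt_filterlim in Hx, Hy.
  destruct (Hx (eps / 2) ltac:(lra)) as (d1 & Hd1 & H1).
  destruct (Hy (eps / 2) ltac:(lra)) as (d2 & Hd2 & H2).
  exists (Rmin d1 d2). split; [apply Rmin_glb_lt; auto|]. intros s Hs.
  apply Rmin_Rgt_l in Hs as [Hs1 Hs2].
  destruct (Req_dec s t) as [->|n]; [rewrite Cmod_refl; auto|].
  assert (D : D_x no_cond t s) by (split; [exact I|auto]).
  specialize (H1 s (conj D Hs1)). specialize (H2 s (conj D Hs2)).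
  unfold dist in H1, H2; simpl in H1, H2; unfold R_dist in H1, H2.
  eapply Rle_lt_trans; [apply Cmod_le_Re_Im|]. simpl. unfold Rminus in *. lra.
Qed.

Lemma rcont_Re (f : R -> C) (t : R) : rcont f t -> continuous (fun s => Re (f s)) t.
Proof.
  rewrite rcontP. intros H. apply continuity_pt_filterlim. intros eps He.
  destruct (H eps He) as (d & Hd & H1). exists d. split; auto. intros s [_ Hs].
  eapply Rle_lt_trans; [|apply (H1 s Hs)]. exact (re_le_Cmod (f s - f t)).
Qed.

Lemma rcont_Im (f : R -> C) (t : R) : rcont f t -> continuous (fun s => Im (f s)) t.
Proof.
  rewrite rcontP. intros H. apply continuity_pt_filterlim. intros eps He.
  destruct (H eps He) as (d & Hd & H1). exists d. split; auto. intros s [_ Hs].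
  eapply Rle_lt_trans; [|apply (H1 s Hs)]. exact (im_le_Cmod (f s - f t)).
Qed.

Definition CInt (f : R -> C) (a b : R) : C :=
  (RInt (fun t => Re (f t)) a b, RInt (fun t => Im (f t)) a b).

Definition rcont_on (f : R -> C) (a b : R) : Prop := forall t, a <= t <= b -> rcont f t.

Lemma rcont_on_ex_RInt (f : R -> C) (a b : R) : a <= b -> rcont_on f a b ->
  ex_RInt (fun t => Re (f t)) a b /\ ex_RInt (fun t => Im (f t)) a b.
Proof.
  intros Hab H. split; apply (@ex_RInt_continuous R_CompleteNormedModule); intros z Hz;
    rewrite Rmin_left, Rmax_right in Hz by lra; [apply rcont_Re|apply rcont_Im]; auto.
Qed.

Lemma CInt_ext (f g : R -> C) (a b : R) :
  a <= b -> (forall t, a <= t <= b -> f t = g t) -> CInt f a b = CInt g a b.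
Proof.
  intros Hab H. unfold CInt. f_equal; apply RInt_ext; intros x Hx;
    rewrite Rmin_left, Rmax_right in Hx by lra; rewrite H; auto; lra.
Qed.

Lemma CInt_plus (f g : R -> C) (a b : R) : a <= b -> rcont_on f a b -> rcont_on g a b ->
  (CInt (fun t => f t + g t) a b = CInt f a b + CInt g a b)%C.
Proof.
  intros Hab Hf Hg. destruct (rcont_on_ex_RInt f a b Hab Hf). destruct (rcont_on_ex_RInt g a b Hab Hg).
  unfold CInt, Cplus; simpl. f_equal; apply (@RInt_plus R_CompleteNormedModule); auto.
Qed.

Lemma CInt_scal (c : C) (f : R -> C) (a b : R) : a <= b -> rcont_on f a b ->
  (CInt (fun t => c * f t) a b = c * CInt f a b)%C.
Proof.
  intros Hab Hf. destruct (rcont_on_ex_RInt f a b Hab Hf) as [Hr Hi].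
  destruct c as [x y]. unfold CInt, Cmult; simpl.
  assert (S : forall k g, ex_RInt g a b -> ex_RInt (fun t => k * g t) a b /\
            RInt (fun t => k * g t) a b = k * RInt g a b).
  { intros k g Hg. split.
    - exact (@ex_RInt_scal R_NormedModule g a b k Hg).
    - exact (@RInt_scal R_CompleteNormedModule g a b k Hg). }
  f_equal.
  - etransitivity; [apply (@RInt_minus R_CompleteNormedModule (fun t => x * Re (f t)) (fun t => y * Im (f t)))|];
      try (apply S; auto). rewrite (proj2 (S x _ Hr)), (proj2 (S y _ Hi)). reflexivity.
  - etransitivity; [apply (@RInt_plus R_CompleteNormedModule (fun t => x * Im (f t)) (fun t => y * Re (f t)))|];
      try (apply S; auto). rewrite (proj2 (S x _ Hi)), (proj2 (S y _ Hr)). reflexivity.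
Qed.

Lemma rcont_const (c : C) (t : R) : rcont (fun _ => c) t.
Proof. apply Ccont_const. Qed.

Lemma rcont_plus (f g : R -> C) (t : R) : rcont f t -> rcont g t -> rcont (fun s => f s + g s)%C t.
Proof. apply (Ccont_plus (fun z => f (Re z)) (fun z => g (Re z))). Qed.

Lemma rcont_minus (f g : R -> C) (t : R) : rcont f t -> rcont g t -> rcont (fun s => f s - g s)%C t.
Proof. apply (Ccont_minus (fun z => f (Re z)) (fun z => g (Re z))). Qed.

Lemma rcont_mult (f g : R -> C) (t : R) : rcont f t -> rcont g t -> rcont (fun s => f s * g s)%C t.
Proof. apply (Ccont_mult (fun z => f (Re z)) (fun z => g (Re z))). Qed.

Lemma rcont_div (f g : R -> C) (t : R) :
  rcont f t -> rcont g t -> g t <> 0%C -> rcont (fun s => f s / g s)%C t.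
Proof. apply (Ccont_div (fun z => f (Re z)) (fun z => g (Re z))). Qed.

Lemma CInt_minus (f g : R -> C) (a b : R) : a <= b -> rcont_on f a b -> rcont_on g a b ->
  (CInt (fun t => f t - g t) a b = CInt f a b - CInt g a b)%C.
Proof.
  intros Hab Hf Hg.
  rewrite (CInt_ext (fun t => f t - g t)%C (fun t => f t + (-(1)) * g t)%C) by (auto; intros; ring).
  rewrite CInt_plus, CInt_scal; auto; [ring|].
  intros t Ht. apply rcont_mult; auto. apply rcont_const.
Qed.

Lemma CInt_const (c : C) (a b : R) : CInt (fun _ => c) a b = (RtoC (b - a) * c)%C.
Proof.
  unfold CInt. rewrite !RInt_const. destruct c as [x y].
  unfold Cmult, RtoC, scal; simpl; unfold mult; simpl. f_equal; ring.
Qed.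

Lemma CInt_Chasles (f : R -> C) (a b c : R) : a <= b <= c -> rcont_on f a c ->
  (CInt f a b + CInt f b c = CInt f a c)%C.
Proof.
  intros H Hf.
  destruct (rcont_on_ex_RInt f a b) as [H1 H2]; [lra|intros t Ht; apply Hf; lra|].
  destruct (rcont_on_ex_RInt f b c) as [H3 H4]; [lra|intros t Ht; apply Hf; lra|].
  unfold CInt, Cplus; simpl. f_equal; apply (@RInt_Chasles R_CompleteNormedModule); auto.
Qed.

(** The factor 2 comes from bounding the real and the imaginary part separately. It only enlarges
    constants, and the maximum principle gets rid of it by taking powers. *)
Lemma CInt_bound (f : R -> C) (a b M : R) : a <= b -> rcont_on f a b ->
  (forall t, a <= t <= b -> Cmod (f t) <= M) -> Cmod (CInt f a b) <= 2 * M * (b - a).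
Proof.
  intros Hab Hf HM. destruct (rcont_on_ex_RInt f a b Hab Hf).
  eapply Rle_trans; [apply Cmod_le_Re_Im|]. unfold CInt; simpl.
  assert (B : forall g, ex_RInt g a b -> (forall t, a <= t <= b -> Rabs (g t) <= M) ->
     Rabs (RInt g a b) <= M * (b - a)).
  { intros g Hg Hb. rewrite Rmult_comm. apply abs_RInt_le_const; auto. }
  pose proof (B _ H) as B1. pose proof (B _ H0) as B2.
  enough (Rabs (RInt (fun t => Re (f t)) a b) <= M * (b - a) /\ Rabs (RInt (fun t => Im (f t)) a b) <= M * (b - a)) by lra.
  split; [apply B1|apply B2]; intros t Ht; (eapply Rle_trans; [|apply HM; exact Ht]);
    [apply re_le_Cmod|apply im_le_Cmod].
Qed.

Lemma CInt_shift (f : R -> C) (a b v : R) : a <= b -> rcont_on f (a + v) (b + v) ->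
  CInt (fun t => f (t + v)) a b = CInt f (a + v) (b + v).
Proof.
  intros Hab Hf. destruct (rcont_on_ex_RInt f (a + v) (b + v)) as [H1 H2]; [lra|auto|].
  assert (S : forall g : R -> R, ex_RInt g (a + v) (b + v) -> RInt (fun t => g (t + v)) a b = RInt g (a + v) (b + v)).
  { intros g Hg. pose proof (@RInt_comp_lin R_CompleteNormedModule g 1 v a b) as E.
    rewrite !Rmult_1_l in E. rewrite <- E by auto. apply RInt_ext. intros x _.
    unfold scal; simpl; unfold mult; simpl. rewrite !Rmult_1_l. reflexivity. }
  unfold CInt. rewrite <- (S _ H1), <- (S _ H2). reflexivity.
Qed.

Lemma CInt_conj (f : R -> C) (a b : R) : a <= b -> rcont_on f a b ->
  CInt (fun t => Cconj (f t)) a b = Cconj (CInt f a b).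
Proof.
  intros Hab Hf. destruct (rcont_on_ex_RInt f a b Hab Hf) as [H1 H2].
  unfold CInt, Cconj; simpl. f_equal.
  exact (@RInt_opp R_CompleteNormedModule (fun t => Im (f t)) a b H2).
Qed.

(** * Goursat's lemma *)

(** The integral of [f(z) dz] along the boundary, counterclockwise: [dz] is [dx] on the horizontal
    sides and [Ci dy] on the vertical ones. *)
Definition Rect (f : C -> C) (a b c d : R) : C :=
  (CInt (fun x => f (x, c)) a b + Ci * CInt (fun y => f (b, y)) c d
   - CInt (fun x => f (x, d)) a b - Ci * CInt (fun y => f (a, y)) c d)%C.

Definition in_rect (a b c d : R) (z : C) : Prop := a <= Re z <= b /\ c <= Im z <= d.

Definition cont_rect (f : C -> C) (a b c d : R) : Prop := forall z, in_rect a b c d z -> Ccont f z.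

Lemma rcont_horizontal (f : C -> C) (x y : R) : Ccont f (x, y) -> rcont (fun t => f (t, y)) x.
Proof.
  intros H. apply (rcont_comp f (fun t => (t, y))); auto.
  apply rcont_pair; [apply continuous_id|apply continuous_const].
Qed.

Lemma rcont_vertical (f : C -> C) (x y : R) : Ccont f (x, y) -> rcont (fun t => f (x, t)) y.
Proof.
  intros H. apply (rcont_comp f (fun t => (x, t))); auto.
  apply rcont_pair; [apply continuous_const|apply continuous_id].
Qed.

Lemma cont_rect_horizontal (f : C -> C) (a b c d y : R) :
  cont_rect f a b c d -> c <= y <= d -> rcont_on (fun x => f (x, y)) a b.
Proof. intros H Hy x Hx. apply rcont_horizontal, H. split; auto. Qed.

Lemma cont_rect_vertical (f : C -> C) (a b c d x : R) :
  cont_rect f a b c d -> a <= x <= b -> rcont_on (fun y => f (x, y)) c d.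
Proof. intros H Hx y Hy. apply rcont_vertical, H. split; auto. Qed.

Lemma Rect_split_x (f : C -> C) (a m b c d : R) :
  a <= m <= b -> c <= d -> cont_rect f a b c d ->
  (Rect f a b c d = Rect f a m c d + Rect f m b c d)%C.
Proof.
  intros H Hcd Hf. unfold Rect.
  rewrite <- (CInt_Chasles (fun x => f (x, c)) a m b), <- (CInt_Chasles (fun x => f (x, d)) a m b); auto;
    [ring| |]; eapply cont_rect_horizontal; eauto; lra.
Qed.

Lemma Rect_split_y (f : C -> C) (a b c m d : R) :
  a <= b -> c <= m <= d -> cont_rect f a b c d ->
  (Rect f a b c d = Rect f a b c m + Rect f a b m d)%C.
Proof.
  intros Hab H Hf. unfold Rect.
  rewrite <- (CInt_Chasles (fun y => f (a, y)) c m d), <- (CInt_Chasles (fun y => f (b, y)) c m d); auto;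
    [ring| |]; eapply cont_rect_vertical; eauto; lra.
Qed.

Lemma Rect_plus (f g : C -> C) (a b c d : R) : a <= b -> c <= d ->
  cont_rect f a b c d -> cont_rect g a b c d ->
  (Rect (fun z => f z + g z) a b c d = Rect f a b c d + Rect g a b c d)%C.
Proof.
  intros Hab Hcd Hf Hg. unfold Rect.
  rewrite !CInt_plus; auto; [ring|..];
    first [eapply cont_rect_horizontal | eapply cont_rect_vertical]; eauto; lra.
Qed.

Lemma Rect_ext (f g : C -> C) (a b c d : R) : a <= b -> c <= d ->
  (forall z, in_rect a b c d z -> f z = g z) -> Rect f a b c d = Rect g a b c d.
Proof.
  intros Hab Hcd H. unfold Rect.
  rewrite (CInt_ext (fun x => f (x, c)) (fun x => g (x, c))), (CInt_ext (fun x => f (x, d)) (fun x => g (x, d))),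
    (CInt_ext (fun y => f (a, y)) (fun y => g (a, y))), (CInt_ext (fun y => f (b, y)) (fun y => g (b, y)));
    auto; intros t Ht; apply H; split; simpl; lra.
Qed.

Lemma RInt_id (a b : R) : RInt (fun x => x) a b = (b ^ 2 - a ^ 2) / 2.
Proof.
  apply is_RInt_unique. replace ((b ^ 2 - a ^ 2) / 2) with (minus (b ^ 2 / 2) (a ^ 2 / 2))
    by (unfold minus, plus, opp; simpl; field).
  apply (is_RInt_derive (fun x => x ^ 2 / 2)).
  - intros. auto_derive; auto. field.
  - intros. apply continuous_id.
Qed.

(** An explicit computation. It shows that the tangent part of a function contributes nothing to
    [Rect_local]. *)
Lemma Rect_affine (A B : C) (a b c d : R) : a <= b -> c <= d ->
  Rect (fun z => A + B * z)%C a b c d = 0%C.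
Proof.
  intros Hab Hcd. unfold Rect.
  assert (H : forall y, rcont_on (fun x : R => (x, y)) a b).
  { intros y t _. apply (rcont_horizontal (fun z => z)). apply Ccont_id. }
  assert (V : forall x, rcont_on (fun y : R => (x, y)) c d).
  { intros x t _. apply (rcont_vertical (fun z => z)). apply Ccont_id. }
  assert (K : forall (g : R -> C) u v, rcont_on g u v -> rcont_on (fun t => B * g t)%C u v).
  { intros g u v Hg t Ht. apply rcont_mult; auto. apply rcont_const. }
  assert (K0 : forall u v, rcont_on (fun _ => A) u v) by (intros u v t _; apply rcont_const).
  rewrite !CInt_plus, !CInt_scal, !CInt_const; auto.
  unfold CInt; simpl. rewrite !RInt_id, !RInt_const.
  destruct A, B. unfold Cminus, Cplus, Cmult, Copp, RtoC, Ci, scal; simpl; unfold mult; simpl.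
  f_equal; field.
Qed.

Lemma Rect_bound (f : C -> C) (a b c d M : R) : a <= b -> c <= d ->
  cont_rect f a b c d -> (forall z, in_rect a b c d z -> Cmod (f z) <= M) ->
  Cmod (Rect f a b c d) <= 4 * M * ((b - a) + (d - c)).
Proof.
  intros Hab Hcd Hf HM. unfold Rect.
  eapply Rle_trans; [apply Cmod_sub_le|].
  eapply Rle_trans; [apply Rplus_le_compat_r, Cmod_sub_le|].
  eapply Rle_trans; [apply Rplus_le_compat_r, Rplus_le_compat_r, Cmod_triangle|].
  rewrite !Cmod_mult, Cmod_Ci, !Rmult_1_l.
  assert (H : forall y, c <= y <= d -> Cmod (CInt (fun x => f (x, y)) a b) <= 2 * M * (b - a)).
  { intros y Hy. apply CInt_bound; auto; [eapply cont_rect_horizontal; eauto|].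
    intros t Ht. apply HM. split; simpl; lra. }
  assert (V : forall x, a <= x <= b -> Cmod (CInt (fun y => f (x, y)) c d) <= 2 * M * (d - c)).
  { intros x Hx. apply CInt_bound; auto; [eapply cont_rect_vertical; eauto|].
    intros t Ht. apply HM. split; simpl; lra. }
  pose proof (H c ltac:(lra)). pose proof (H d ltac:(lra)).
  pose proof (V a ltac:(lra)). pose proof (V b ltac:(lra)). lra.
Qed.

Lemma in_rect_dist (a b c d : R) (z p : C) : in_rect a b c d z -> in_rect a b c d p ->
  Cmod (z - p) <= (b - a) + (d - c).
Proof.
  intros [Hz1 Hz2] [Hp1 Hp2]. eapply Rle_trans; [apply Cmod_le_Re_Im|].
  destruct z, p; simpl in *. apply Rplus_le_compat; apply Rabs_le; lra.
Qed.

(** The affine part at [p] integrates to zero, and the remainder is at most [eps] times the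
    diameter, integrated over a boundary of comparable length. *)
Lemma Rect_local (f : C -> C) (p l : C) (eps a b c d : R) : 0 <= eps -> a <= b -> c <= d ->
  in_rect a b c d p -> cont_rect f a b c d ->
  (forall z, in_rect a b c d z -> Cmod (f z - f p - l * (z - p)) <= eps * Cmod (z - p)) ->
  Cmod (Rect f a b c d) <= 4 * eps * ((b - a) + (d - c)) ^ 2.
Proof.
  intros He Hab Hcd Hp Hf Hl.
  rewrite (Rect_ext f (fun z => ((f p - l * p) + l * z) + (f z - f p - l * (z - p)))%C) by (auto; intros; ring).
  assert (Hc : cont_rect (fun z => f z - f p - l * (z - p))%C a b c d).
  { intros z Hz. apply Ccont_minus; [apply Ccont_minus; [auto|apply Ccont_const]|].
    apply Ccont_mult; [apply Ccont_const|apply Ccont_minus; [apply Ccont_id|apply Ccont_const]]. }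
  rewrite Rect_plus; auto.
  2:{ intros z _. apply Ccont_plus; [apply Ccont_const|apply Ccont_mult; [apply Ccont_const|apply Ccont_id]]. }
  rewrite Rect_affine, Cplus_0_l by auto.
  replace (4 * eps * ((b - a) + (d - c)) ^ 2) with (4 * (eps * ((b - a) + (d - c))) * ((b - a) + (d - c))) by ring.
  apply Rect_bound; auto. intros z Hz. eapply Rle_trans; [apply Hl; auto|].
  apply Rmult_le_compat_l; auto. apply in_rect_dist; auto.
Qed.

(** The integrals over the four quarters add up to the whole one, so they cannot all be smaller than
    [eta]. *)
Lemma Rect_quarter (f : C -> C) (x y u v eta : R) : 0 <= u -> 0 <= v ->
  cont_rect f x (x + 2 * u) y (y + 2 * v) -> 4 * eta <= Cmod (Rect f x (x + 2 * u) y (y + 2 * v)) ->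
  exists x' y', x <= x' <= x + u /\ y <= y' <= y + v /\
    eta <= Cmod (Rect f x' (x' + u) y' (y' + v)).
Proof.
  intros Hu Hv Hf HR.
  assert (Hs : forall a b c d, x <= a -> b <= x + 2 * u -> y <= c -> d <= y + 2 * v -> cont_rect f a b c d).
  { intros a b c d ? ? ? ? z [? ?]. apply Hf. split; lra. }
  rewrite (Rect_split_x f x (x + u)), (Rect_split_y f x _ y (y + v)), (Rect_split_y f (x + u) _ y (y + v)) in HR
    by (first [apply Hs|auto]; lra).
  destruct (Rle_dec eta (Cmod (Rect f x (x + u) y (y + v)))) as [h1|h1].
  { exists x, y. repeat split; auto; lra. }
  destruct (Rle_dec eta (Cmod (Rect f (x + u) (x + u + u) y (y + v)))) as [h2|h2].
  { exists (x + u), y. repeat split; auto; lra. }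
  destruct (Rle_dec eta (Cmod (Rect f x (x + u) (y + v) (y + v + v)))) as [h3|h3].
  { exists x, (y + v). repeat split; auto; lra. }
  exists (x + u), (y + v). repeat split; try lra.
  replace (x + 2 * u) with (x + u + u) in HR by ring.
  replace (y + 2 * v) with (y + v + v) in HR by ring.
  set (A := Rect f x (x + u) y (y + v)) in *.
  set (B := Rect f x (x + u) (y + v) (y + v + v)) in *.
  set (D := Rect f (x + u) (x + u + u) y (y + v)) in *.
  set (E := Rect f (x + u) (x + u + u) (y + v) (y + v + v)) in *.
  pose proof (Cmod_triangle (A + B) (D + E)). pose proof (Cmod_triangle A B). pose proof (Cmod_triangle D E). lra.
Qed.

(** [P] is an invariant of the stage and [Q] a link between consecutive stages. It produces nested
    rectangles, convergent subsequences and the diagonal sequence. *)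
Lemma dependent_choice (A : Type) (P : nat -> A -> Prop) (Q : nat -> A -> A -> Prop) (a0 : A) :
  P 0%nat a0 -> (forall n a, P n a -> exists b, P (S n) b /\ Q n a b) ->
  exists s : nat -> A, s 0%nat = a0 /\ forall n, P n (s n) /\ Q n (s n) (s (S n)).
Proof.
  intros H0 HS.
  pose (step := fun (n : nat) (a : A) => epsilon (inhabits a0) (fun b => P (S n) b /\ Q n a b)).
  pose (s := fix s n := match n with O => a0 | S k => step k (s k) end).
  assert (Hstep : forall n a, P n a -> P (S n) (step n a) /\ Q n a (step n a)).
  { intros n a Ha. apply epsilon_spec. auto. }
  assert (HP : forall n, P n (s n)).
  { induction n; simpl; auto. apply Hstep; auto. }
  exists s. split; auto. intros n. split; auto. apply Hstep; auto.
Qed.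

(** Every right endpoint bounds all left endpoints, so the supremum of the latter lies in each
    interval. *)
Lemma shrinking_intervals_point (x : nat -> R) (u : R) : 0 <= u ->
  (forall n, x n <= x (S n) <= x n + u / 2 ^ S n) ->
  exists X, forall n, x n <= X <= x n + u / 2 ^ n.
Proof.
  intros Hu H.
  assert (P : forall n, 0 < 2 ^ n) by (intros; apply pow_lt; lra).
  assert (Hk : forall n k, x n <= x (n + k)%nat /\ x (n + k)%nat + u / 2 ^ (n + k) <= x n + u / 2 ^ n).
  { intros n k. induction k.
    - rewrite Nat.add_0_r. lra.
    - rewrite Nat.add_succ_r. specialize (H (n + k)%nat).
      assert (u / 2 ^ (n + k) = 2 * (u / 2 ^ S (n + k))) by (simpl; field; apply Rgt_not_eq, P). lra. }
  assert (Hnm : forall n m, x n <= x m + u / 2 ^ m).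
  { intros n m. destruct (Nat.le_ge_cases n m) as [L|L].
    - replace m with (n + (m - n))%nat by lia. destruct (Hk n (m - n)%nat).
      assert (0 <= u / 2 ^ (n + (m - n))) by (apply Rdiv_le_0_compat; auto). lra.
    - replace n with (m + (n - m))%nat by lia. destruct (Hk m (n - m)%nat).
      assert (0 <= u / 2 ^ (m + (n - m))) by (apply Rdiv_le_0_compat; auto). lra. }
  destruct (completeness (fun r => exists n, r = x n)) as [X [HX1 HX2]].
  - exists (x 0%nat + u / 2 ^ 0). intros r [n ->]. auto.
  - exists (x 0%nat). eauto.
  - exists X. intros n. split; [apply HX1; eauto|]. apply HX2. intros r [m ->]. auto.
Qed.

(* Goursat: repeated quartering of a rectangle with nonzero integral gives rectangles
   shrinking to a point at which differentiability is contradicted. *)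
Lemma Rect_Hol (f : C -> C) (a b c d : R) : a <= b -> c <= d ->
  (forall z, in_rect a b c d z -> Hol f z) -> Rect f a b c d = 0%C.
Proof.
  intros Hab Hcd Hf. destruct (C_eq_dec (Rect f a b c d) 0%C) as [|n]; auto. exfalso.
  apply Cmod_gt_0 in n. set (eta := Cmod (Rect f a b c d)) in *.
  set (u := b - a). set (v := d - c).
  assert (P2 : forall n, 0 < 2 ^ n) by (intros; apply pow_lt; lra).
  assert (P4 : forall n, 0 < 4 ^ n) by (intros; apply pow_lt; lra).
  assert (Du : forall n, 0 <= u / 2 ^ n <= u).
  { intros n0. pose proof (pow_R1_Rle 2 n0 ltac:(lra)). split.
    - apply Rdiv_le_0_compat; auto. unfold u; lra.
    - apply Rle_div_l; [apply P2|]. unfold u. nra. }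
  assert (Dv : forall n, 0 <= v / 2 ^ n <= v).
  { intros n0. pose proof (pow_R1_Rle 2 n0 ltac:(lra)). split.
    - apply Rdiv_le_0_compat; auto. unfold v; lra.
    - apply Rle_div_l; [apply P2|]. unfold v. nra. }
  assert (Hu : forall n, u / 2 ^ n = 2 * (u / 2 ^ S n)) by (intros k; simpl; field; apply Rgt_not_eq, P2).
  assert (Hv : forall n, v / 2 ^ n = 2 * (v / 2 ^ S n)) by (intros k; simpl; field; apply Rgt_not_eq, P2).
  destruct (dependent_choice (R * R)
     (fun n p => (a <= fst p /\ fst p + u / 2 ^ n <= b) /\ (c <= snd p /\ snd p + v / 2 ^ n <= d) /\
        eta / 4 ^ n <= Cmod (Rect f (fst p) (fst p + u / 2 ^ n) (snd p) (snd p + v / 2 ^ n)))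
     (fun n p q => fst p <= fst q <= fst p + u / 2 ^ S n /\ snd p <= snd q <= snd p + v / 2 ^ S n)
     (a, c)) as (s & Hs0 & Hs).
  - simpl. unfold u, v. rewrite !Rdiv_1_r. replace (a + (b - a)) with b by ring. replace (c + (d - c)) with d by ring.
    repeat split; try lra. unfold eta; lra.
  - intros k [x y] ((Hx1 & Hx2) & (Hy1 & Hy2) & HR). simpl fst in *. simpl snd in *.
    rewrite (Hu k) in Hx2, HR. rewrite (Hv k) in Hy2, HR.
    replace (eta / 4 ^ k) with (4 * (eta / 4 ^ S k)) in HR by (simpl; field; apply Rgt_not_eq, P4).
    destruct (Rect_quarter f x y (u / 2 ^ S k) (v / 2 ^ S k) (eta / 4 ^ S k)) as (x' & y' & Hx' & Hy' & HR'); auto.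
    + apply Du.
    + apply Dv.
    + intros z [? ?]. apply Hol_cont, Hf. split; lra.
    + exists (x', y'). simpl fst. simpl snd. repeat split; lra.
  - destruct (shrinking_intervals_point (fun k => fst (s k)) u) as [X HX].
    { unfold u; lra. }
    { intros k. apply Hs. }
    destruct (shrinking_intervals_point (fun k => snd (s k)) v) as [Y HY].
    { unfold v; lra. }
    { intros k. apply Hs. }
    assert (Hin : in_rect a b c d (X, Y)).
    { specialize (HX 0%nat). specialize (HY 0%nat). rewrite Hs0 in HX, HY. simpl in HX, HY.
      unfold u, v in HX, HY. split; simpl; lra. }
    destruct (Hf _ Hin) as [l Hl].
    set (S := u + v).
    assert (HS : 0 <= S) by (unfold S, u, v; lra).
    (* In the [k]-th rectangle the integral is at least [eta / 4^k], while the local estimate gives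
       [4 e S^2 / 4^k]. This [e] makes [4 e S^2 < eta]; the [+ 1] covers the degenerate case
       [S = 0]. *)
    set (e := eta / (4 * S ^ 2 + 1) / 2).
    assert (HSe : 0 < 4 * S ^ 2 + 1) by nra.
    assert (He : 0 < e) by (unfold e; apply Rdiv_lt_0_compat; [apply Rdiv_lt_0_compat|]; lra).
    destruct (Hl e He) as (dl & Hdl & H1).
    assert (exists n, S / 2 ^ n < dl) as [k Hk].
    { destruct (pow_lt_1_zero (/2) ltac:(rewrite Rabs_pos_eq; lra) (dl / (S + 1))) as [N HN].
      - apply Rdiv_lt_0_compat; lra.
      - exists N. specialize (HN N (Nat.le_refl _)).
        rewrite pow_inv, Rabs_pos_eq in HN by (left; apply Rinv_0_lt_compat, P2).
        apply Rlt_div_r in HN; [|lra].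
        unfold Rdiv. rewrite Rmult_comm. assert (0 < / 2 ^ N) by (apply Rinv_0_lt_compat, P2). nra. }
    destruct (Hs k) as [((Hx1 & Hx2) & (Hy1 & Hy2) & HR) _].
    specialize (HX k). specialize (HY k). simpl in HX, HY.
    set (x := fst (s k)) in *. set (y := snd (s k)) in *.
    specialize (Du k). specialize (Dv k).
    set (r := in_rect x (x + u / 2 ^ k) y (y + v / 2 ^ k)).
    assert (Hp : r (X, Y)) by (split; simpl; lra).
    assert (Hsub : forall z, r z -> in_rect a b c d z).
    { intros z [? ?]. split; lra. }
    pose proof (Rect_local f (X, Y) l e x (x + u / 2 ^ k) y (y + v / 2 ^ k)) as HL.
    specialize (HL ltac:(lra) ltac:(lra) ltac:(lra) Hp).
    assert (ES : x + u / 2 ^ k - x + (y + v / 2 ^ k - y) = S / 2 ^ k) by (unfold S; field; apply Rgt_not_eq, P2).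
    rewrite ES in HL.
    assert (HL' : Cmod (Rect f x (x + u / 2 ^ k) y (y + v / 2 ^ k)) <= 4 * e * (S / 2 ^ k) ^ 2).
    { apply HL.
      - intros z Hz. apply Hol_cont, Hf, Hsub. exact Hz.
      - intros z Hz. apply H1. eapply Rle_lt_trans; [apply (in_rect_dist _ _ _ _ _ _ Hz Hp)|]. lra. }
    assert (E4 : 4 ^ k = 2 ^ k * 2 ^ k) by (rewrite <- Rpow_mult_distr; f_equal; lra).
    assert (Hfin : eta / 4 ^ k <= 4 * e * (S / 2 ^ k) ^ 2) by lra.
    replace (4 * e * (S / 2 ^ k) ^ 2) with ((4 * e * S ^ 2) / 4 ^ k) in Hfin
      by (rewrite E4; field; apply Rgt_not_eq, P2).
    apply Rmult_le_reg_r in Hfin; [|apply Rinv_0_lt_compat, P4].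
    assert (e * (4 * S ^ 2 + 1) = eta / 2) by (unfold e; field; lra). nra.
Qed.

(** Goursat's lemma removes everything but a small square around [p]; there [f] is bounded, so the
    integral is at most a multiple of the side. *)
Lemma Rect_Hol_except (f : C -> C) (p : C) (a b c d : R) : a < Re p < b -> c < Im p < d ->
  (forall z, in_rect a b c d z -> z <> p -> Hol f z) -> Ccont f p -> Rect f a b c d = 0%C.
Proof.
  intros Hp1 Hp2 Hf Hc.
  assert (Hcr : cont_rect f a b c d).
  { intros z Hz. destruct (C_eq_dec z p) as [->|n]; auto. apply Hol_cont; auto. }
  destruct (C_eq_dec (Rect f a b c d) 0%C) as [|n]; auto. exfalso.
  apply Cmod_gt_0 in n. set (eta := Cmod (Rect f a b c d)) in *.
  destruct (Ccont_bound f p Hc) as (d0 & Hd0 & HM). set (M := Cmod (f p) + 1) in *.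
  assert (0 < M) by (unfold M; pose proof (Cmod_ge_0 (f p)); lra).
  set (e0 := Rmin (Rmin (Re p - a) (b - Re p)) (Rmin (Im p - c) (d - Im p))).
  (* The square has side [2 e]: its points are within [4 e < d0] of [p], and its integral is at most
     [16 M e < eta]. *)
  set (e1 := Rmin (d0 / 5) (eta / (17 * M))).
  set (e := Rmin (e0 / 2) e1).
  assert (He0 : 0 < e0) by (unfold e0; repeat apply Rmin_glb_lt; lra).
  assert (He1 : 0 < e1) by (unfold e1; apply Rmin_glb_lt; [lra|apply Rdiv_lt_0_compat; lra]).
  assert (He : 0 < e) by (unfold e; apply Rmin_glb_lt; lra).
  assert (L1 : e < Re p - a /\ e < b - Re p /\ e < Im p - c /\ e < d - Im p).
  { unfold e. pose proof (Rmin_l (e0 / 2) e1).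
    pose proof (Rmin_l (Rmin (Re p - a) (b - Re p)) (Rmin (Im p - c) (d - Im p))) as h1.
    pose proof (Rmin_r (Rmin (Re p - a) (b - Re p)) (Rmin (Im p - c) (d - Im p))) as h2. fold e0 in h1, h2.
    pose proof (Rmin_l (Re p - a) (b - Re p)). pose proof (Rmin_r (Re p - a) (b - Re p)).
    pose proof (Rmin_l (Im p - c) (d - Im p)). pose proof (Rmin_r (Im p - c) (d - Im p)). lra. }
  assert (L2 : e <= d0 / 5 /\ e <= eta / (17 * M)).
  { assert (e <= e1) by apply Rmin_r. pose proof (Rmin_l (d0 / 5) (eta / (17 * M))).
    pose proof (Rmin_r (d0 / 5) (eta / (17 * M))). unfold e1 in *; lra. }
  assert (Hs : forall a' b' c' d', a <= a' -> b' <= b -> c <= c' -> d' <= d -> cont_rect f a' b' c' d').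
  { intros a' b' c' d' ? ? ? ? z [? ?]. apply Hcr. split; lra. }
  assert (Hz : forall a' b' c' d', a <= a' -> b' <= b -> c <= c' -> d' <= d -> a' <= b' -> c' <= d' ->
     (b' < Re p \/ Re p < a' \/ d' < Im p \/ Im p < c') -> Rect f a' b' c' d' = 0%C).
  { intros a' b' c' d' ? ? ? ? ? ? Ho. apply Rect_Hol; auto. intros z [? ?]. apply Hf; [split; lra|].
    intros ->. lra. }
  set (x1 := Re p - e). set (x2 := Re p + e). set (y1 := Im p - e). set (y2 := Im p + e).
  assert (E : Rect f a b c d = Rect f x1 x2 y1 y2).
  { rewrite (Rect_split_x f a x1 b) by (first [apply Hs|unfold x1]; lra).
    rewrite (Hz a x1) by (unfold x1 in *; lra).
    rewrite (Rect_split_x f x1 x2 b) by (first [apply Hs|idtac]; unfold x1, x2; lra).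
    rewrite (Hz x2 b) by (unfold x2 in *; lra).
    rewrite (Rect_split_y f x1 x2 c y1 d) by (first [apply Hs|idtac]; unfold x1, x2, y1; lra).
    rewrite (Hz x1 x2 c y1) by (unfold x1, x2, y1 in *; lra).
    rewrite (Rect_split_y f x1 x2 y1 y2 d) by (first [apply Hs|idtac]; unfold x1, x2, y1, y2; lra).
    rewrite (Hz x1 x2 y2 d) by (unfold x1, x2, y2 in *; lra). ring. }
  assert (B : Cmod (Rect f x1 x2 y1 y2) <= 4 * M * ((x2 - x1) + (y2 - y1))).
  { apply Rect_bound; try (unfold x1, x2, y1, y2; lra).
    - apply Hs; unfold x1, x2, y1, y2; lra.
    - intros z Hin. apply HM. eapply Rle_lt_trans.
      + apply (in_rect_dist x1 x2 y1 y2 z p Hin). unfold x1, x2, y1, y2; split; simpl; lra.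
      + unfold x1, x2, y1, y2; lra. }
  rewrite <- E in B. fold eta in B. unfold x1, x2, y1, y2 in B.
  destruct L2 as [_ L2]. apply Rle_div_r in L2; [|lra]. nra.
Qed.

(** * Circular means and Cauchy's formula *)

Definition eit (t : R) : C := (cos t, sin t).

Definition cexp (z : C) : C := (RtoC (exp (Re z)) * eit (Im z))%C.

Definition cir (z0 : C) (r t : R) : C := (z0 + RtoC r * eit t)%C.

Lemma Cmod_eit (t : R) : Cmod (eit t) = 1.
Proof.
  unfold Cmod, eit; simpl. rewrite !Rmult_1_r. pose proof (sin2_cos2 t) as H.
  unfold Rsqr in H. rewrite Rplus_comm, H. apply sqrt_1.
Qed.

Lemma eit_plus (s t : R) : eit (s + t) = (eit s * eit t)%C.
Proof. unfold eit, Cmult; simpl. rewrite cos_plus, sin_plus. f_equal. ring. Qed.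

Lemma eit_2PI (t : R) : eit (t + 2 * PI) = eit t.
Proof. unfold eit. rewrite cos_plus, sin_plus, cos_2PI, sin_2PI. f_equal; ring. Qed.

(** [cos (s - t) = 1], and [cos] is strictly decreasing on [[0, PI]]. In a strip of height [2 PI]
    centred at the argument [a], a point thus has a single logarithm of argument [a]. *)
Lemma eit_inj (s t : R) : eit s = eit t -> Rabs (s - t) <= PI -> s = t.
Proof.
  intros E H. injection E as E1 E2.
  assert (Hc : cos (s - t) = 1).
  { rewrite cos_minus, E1, E2. pose proof (sin2_cos2 t) as H2. unfold Rsqr in H2. lra. }
  assert (P := PI_RGT_0).
  destruct (Rtotal_order s t) as [L|[L|L]]; auto; exfalso.
  - rewrite Rabs_left in H by lra.
    rewrite <- cos_neg in Hc. pose proof (cos_decreasing_1 0 (- (s - t)) ltac:(lra) ltac:(lra) ltac:(lra) ltac:(lra) ltac:(lra)).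
    rewrite cos_0 in H0. lra.
  - rewrite Rabs_right in H by lra.
    pose proof (cos_decreasing_1 0 (s - t) ltac:(lra) ltac:(lra) ltac:(lra) ltac:(lra) ltac:(lra)).
    rewrite cos_0 in H0. lra.
Qed.

Lemma polar_form (w : C) : exists a, - PI <= a <= PI /\ w = (RtoC (Cmod w) * eit a)%C.
Proof.
  destruct (C_eq_dec w 0%C) as [->|n].
  { exists 0. pose proof PI_RGT_0. split; [lra|]. rewrite Cmod_0. ring. }
  apply Cmod_gt_0 in n. destruct w as [x y]. set (m := Cmod (x, y)) in *.
  assert (Em : x * x + y * y = m * m).
  { unfold m, Cmod; simpl. rewrite sqrt_sqrt by nra. ring. }
  assert (Hu : (x / m) * (x / m) + (y / m) * (y / m) = 1).
  { replace ((x / m) * (x / m) + (y / m) * (y / m)) with ((x * x + y * y) / (m * m)) by (field; lra).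
    rewrite Em. field. lra. }
  set (p := x / m) in *. set (q := y / m) in *.
  assert (Ex : x = m * p) by (unfold p; field; lra).
  assert (Ey : y = m * q) by (unfold q; field; lra).
  assert (Hp : -1 <= p <= 1) by nra.
  pose proof (acos_bound p) as Hb. pose proof PI_RGT_0.
  assert (Hs : sin (acos p) = Rabs q).
  { rewrite sin_acos by auto. rewrite <- sqrt_Rsqr_abs. f_equal. unfold Rsqr. lra. }
  destruct (Rle_dec 0 q) as [hq|hq].
  - exists (acos p). split; [lra|]. unfold eit. rewrite cos_acos, Hs, Rabs_pos_eq by auto.
    unfold Cmult, RtoC; simpl. f_equal; lra.
  - exists (- acos p). split; [lra|]. unfold eit. rewrite cos_neg, sin_neg, cos_acos, Hs, Rabs_left by (auto; lra).
    unfold Cmult, RtoC; simpl. f_equal; lra.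
Qed.

Lemma Cmod_cexp (z : C) : Cmod (cexp z) = exp (Re z).
Proof.
  unfold cexp. rewrite Cmod_mult, Cmod_eit, Cmod_R, Rabs_pos_eq by (left; apply exp_pos). ring.
Qed.

Lemma cexp_plus (z w : C) : cexp (z + w) = (cexp z * cexp w)%C.
Proof.
  unfold cexp. destruct z as [x y], w as [x' y']; simpl. rewrite eit_plus, exp_plus, RtoC_mult. ring.
Qed.

Lemma derivable_0_estimate (g : R -> R) (l e : R) : derivable_pt_lim g 0 l -> 0 < e ->
  exists d, 0 < d /\ forall x, Rabs x < d -> Rabs (g x - g 0 - l * x) <= e * Rabs x.
Proof.
  intros Hg He. destruct (Hg e He) as (d & Hd). exists d. split; [apply cond_pos|].
  intros x Hx. destruct (Req_dec x 0) as [->|n].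
  { replace (g 0 - g 0 - l * 0) with 0 by ring. rewrite Rabs_R0. lra. }
  specialize (Hd x n Hx). rewrite Rplus_0_l in Hd.
  replace (g x - g 0 - l * x) with (((g x - g 0) / x - l) * x) by (field; auto).
  rewrite Rabs_mult. apply Rmult_le_compat_r; [apply Rabs_pos|lra].
Qed.

Lemma cder_cexp_0 : cder cexp 0 1.
Proof.
  (* With [m] the modulus of the increment, the four error terms below are at most [3 e m], [e m],
     [4 e m] and [e m]. The number [e] also serves as a radius, which gives
     [Rabs (exp x - 1) <= 2 e]. *)
  intros eps He. set (e := Rmin 1 (eps / 16)).
  assert (He0 : 0 < e) by (apply Rmin_glb_lt; lra).
  destruct (derivable_0_estimate exp 1 e derivable_pt_lim_exp_0 He0) as (d1 & Hd1 & H1).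
  destruct (derivable_0_estimate sin 1 e derivable_pt_lim_sin_0 He0) as (d2 & Hd2 & H2).
  destruct (derivable_0_estimate cos 0 e derivable_pt_lim_cos_0 He0) as (d3 & Hd3 & H3).
  exists (Rmin e (Rmin d1 (Rmin d2 d3))). split; [repeat apply Rmin_glb_lt; first [exact He0|auto]; lra|].
  intros [x y] Hw. replace ((x, y) - 0)%C with (x, y) in * by (unfold Cminus, Cplus, Copp, RtoC; simpl; f_equal; ring).
  repeat (apply Rmin_Rgt_l in Hw as [? Hw]).
  set (m := Cmod (x, y)) in *.
  pose proof (re_le_Cmod (x, y)) as Lx. pose proof (im_le_Cmod (x, y)) as Ly. simpl in Lx, Ly. fold m in Lx, Ly.
  specialize (H1 x ltac:(lra)). specialize (H2 y ltac:(lra)). specialize (H3 y ltac:(lra)).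
  rewrite exp_0, Rmult_1_l in H1. rewrite sin_0, Rminus_0_r, Rmult_1_l in H2.
  rewrite cos_0, Rmult_0_l, Rminus_0_r in H3. pose proof (Rabs_pos x). pose proof (Rabs_pos y).
  assert (He1 : e <= 1) by apply Rmin_l. assert (He2 : e <= eps / 16) by apply Rmin_r.
  assert (Hx : Rabs (exp x - 1) <= 2 * m).
  { replace (exp x - 1) with ((exp x - 1 - x) + x) by ring. eapply Rle_trans; [apply Rabs_triang|]. nra. }
  assert (Ex : Rabs (exp x) <= 3).
  { replace (exp x) with ((exp x - 1) + 1) by ring. eapply Rle_trans; [apply Rabs_triang|].
    rewrite Rabs_R1. lra. }
  eapply Rle_trans; [apply Cmod_le_Re_Im|]. unfold cexp, eit; simpl.
  rewrite exp_0, cos_0, sin_0.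
  match goal with |- Rabs ?a + Rabs ?b <= _ =>
    replace a with (exp x * (cos y - 1) + (exp x - 1 - x)) by ring;
    replace b with ((exp x - 1) * sin y + (sin y - y)) by ring end.
  assert (A1 : Rabs (exp x * (cos y - 1)) <= 3 * (e * m)).
  { rewrite Rabs_mult. apply Rmult_le_compat; try apply Rabs_pos; auto. nra. }
  assert (A2 : Rabs (sin y) <= 2 * m).
  { replace (sin y) with ((sin y - y) + y) by ring. eapply Rle_trans; [apply Rabs_triang|]. nra. }
  assert (A3 : Rabs ((exp x - 1) * sin y) <= 2 * e * (2 * m)).
  { rewrite Rabs_mult. apply Rmult_le_compat; try apply Rabs_pos; auto. lra. }
  pose proof (Rabs_triang (exp x * (cos y - 1)) (exp x - 1 - x)).
  pose proof (Rabs_triang ((exp x - 1) * sin y) (sin y - y)).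
  assert (0 <= m) by lra. assert (e * m <= eps / 16 * m) by (apply Rmult_le_compat_r; lra).
  assert (e * Rabs x <= e * m) by (apply Rmult_le_compat_l; lra). assert (e * Rabs y <= e * m) by (apply Rmult_le_compat_l; lra).
  assert (0 <= eps * m) by (apply Rmult_le_pos; lra). lra.
Qed.

Lemma cder_cexp (z : C) : cder cexp z (cexp z).
Proof.
  assert (H : cder (fun w => cexp z * cexp (w - z))%C z (cexp z)).
  { eapply cder_eq.
    - apply (cder_mult (fun _ => cexp z) (fun w => cexp (w - z)%C)); [apply cder_const|].
      apply (cder_comp cexp (fun w => w - z)%C).
      + apply (cder_plus (fun w => w) (fun _ => (- z)%C)); [apply cder_id|apply cder_const].
      + replace (z - z)%C with (RtoC 0) by ring. apply cder_cexp_0.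
    - simpl. ring. }
  eapply cder_ext_loc; [|exact H]. exists 1. split; [lra|]. intros w _. simpl.
  rewrite <- cexp_plus. f_equal. ring.
Qed.

Lemma Hol_cexp (z : C) : Hol cexp z.
Proof. eexists; apply cder_cexp. Qed.

Lemma rcont_eit (t : R) : rcont eit t.
Proof.
  apply rcont_pair; apply continuity_pt_filterlim; [apply continuity_cos|apply continuity_sin].
Qed.

Lemma rcont_cir (z0 : C) (r t : R) : rcont (cir z0 r) t.
Proof.
  unfold cir. apply rcont_plus; [apply rcont_const|]. apply rcont_mult; [apply rcont_const|apply rcont_eit].
Qed.

Lemma Cmod_cir (z0 : C) (r t : R) : 0 <= r -> Cmod (cir z0 r t - z0) = r.
Proof.
  intros Hr. unfold cir. replace (z0 + RtoC r * eit t - z0)%C with (RtoC r * eit t)%C by ring.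
  rewrite Cmod_mult, Cmod_eit, Cmod_R, Rabs_pos_eq by auto. ring.
Qed.

Lemma CInt_period (g : R -> C) (th : R) : - (2 * PI) <= th <= 0 ->
  (forall t, rcont g t) -> (forall t, g (t + 2 * PI) = g t) ->
  CInt g th (th + 2 * PI) = CInt g 0 (2 * PI).
Proof.
  intros Hth Hg Hp.
  rewrite <- (CInt_Chasles g th 0 (th + 2 * PI)), <- (CInt_Chasles g 0 (th + 2 * PI) (2 * PI)) by (try lra; intros t _; auto).
  assert (E : CInt g (th + 2 * PI) (0 + 2 * PI) = CInt g th 0).
  { rewrite <- CInt_shift by (try lra; intros t _; auto). apply CInt_ext; [lra|]. auto. }
  rewrite Rplus_0_l in E. rewrite E. ring.
Qed.

Lemma Cmult_Ci_inj (x : C) : (Ci * x = 0)%C -> x = 0%C.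
Proof.
  intros H. replace x with ((- Ci) * (Ci * x))%C; [rewrite H; ring|].
  destruct x. unfold Ci, Cmult, Copp; simpl. f_equal; ring.
Qed.

(* The function [f (z0 + cexp zeta)] has equal values on the two horizontal sides of a
   rectangle of height [2 pi], so its two vertical integrals, which are circular means, agree. *)
Lemma circle_mean_radii (f : C -> C) (z0 w : C) (R0 s r a : R) :
  0 < s < r -> r < R0 -> (w = z0 \/ s < Cmod (w - z0)) -> Cmod (w - z0) < r ->
  (w - z0 = RtoC (Cmod (w - z0)) * eit a)%C ->
  (forall z, 0 < Cmod (z - z0) < R0 -> z <> w -> Hol f z) -> Ccont f w ->
  CInt (fun t => f (cir z0 r t)) (a - PI) (a + PI) = CInt (fun t => f (cir z0 s t)) (a - PI) (a + PI).
Proof.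
  intros Hs Hr Hw Hwr Hpol Hf Hc. pose proof PI_RGT_0 as HPI.
  set (h := fun z => f (z0 + cexp z)%C).
  assert (Hlog : ln s < ln r) by (apply ln_increasing; lra).
  assert (Hrange : forall z, in_rect (ln s) (ln r) (a - PI) (a + PI) z -> 0 < Cmod (z0 + cexp z - z0) < R0).
  { intros z [[Hz1 Hz2] _]. replace (z0 + cexp z - z0)%C with (cexp z) by ring. rewrite Cmod_cexp.
    split; [apply exp_pos|]. assert (exp (Re z) <= exp (ln r)).
    { destruct Hz2 as [L| ->]; [left; apply exp_increasing; auto|right; auto]. }
    rewrite exp_ln in H by lra. lra. }
  assert (HH : forall z, in_rect (ln s) (ln r) (a - PI) (a + PI) z -> (z0 + cexp z <> w)%C -> Hol h z).
  { intros z Hz Hn. apply (Hol_comp f (fun z => z0 + cexp z)%C).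
    - apply Hol_plus; [apply Hol_const|apply Hol_cexp].
    - apply Hf; auto. }
  assert (E : Rect h (ln s) (ln r) (a - PI) (a + PI) = 0%C).
  { destruct Hw as [->|Hw].
    - apply Rect_Hol; try lra. intros z Hz. apply HH; auto. intros E. apply Hrange in Hz.
      rewrite E, Cmod_refl in Hz. lra.
    (* Centring the strip at the argument of [w - z0] puts the only preimage [p] of [w] in the
       interior of the rectangle, as [Rect_Hol_except] requires. *)
    - set (p := (ln (Cmod (w - z0)), a) : C).
      assert (Hp : (z0 + cexp p = w)%C).
      { unfold cexp, p; simpl. rewrite exp_ln by lra. rewrite <- Hpol. ring. }
      apply (Rect_Hol_except h p); simpl.
      + split; apply ln_increasing; lra.
      + lra.
      + intros z Hz Hn. apply HH; auto. intros E. apply Hn.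
        assert (E2 : (cexp z = w - z0)%C) by (rewrite <- E; ring).
        assert (Er : Re z = ln (Cmod (w - z0))) by (rewrite <- E2, Cmod_cexp, ln_exp; auto).
        rewrite Hpol in E2. unfold cexp in E2. rewrite Er, exp_ln in E2 by lra.
        assert (Ei : eit (Im z) = eit a).
        { assert (Hnz : RtoC (Cmod (w - z0)) <> 0%C) by (intros K; injection K; lra).
          replace (eit (Im z)) with (RtoC (Cmod (w - z0)) * eit (Im z) / RtoC (Cmod (w - z0)))%C by (field; auto).
          rewrite E2. field; auto. }
        apply eit_inj in Ei; [|apply Rabs_le; destruct Hz; lra].
        unfold p. destruct z; simpl in *. congruence.
      + apply (Ccont_comp f (fun z => z0 + cexp z)%C).
        * apply Ccont_plus; [apply Ccont_const|apply Hol_cont, Hol_cexp].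
        * rewrite Hp; auto. }
  unfold Rect in E.
  assert (Eh : CInt (fun x => h (x, a + PI)) (ln s) (ln r) = CInt (fun x => h (x, a - PI)) (ln s) (ln r)).
  { apply CInt_ext; [lra|]. intros t _. unfold h, cexp; simpl.
    replace (a + PI) with (a - PI + 2 * PI) by ring. rewrite eit_2PI. reflexivity. }
  rewrite Eh in E.
  assert (Ev : forall q, 0 < q -> CInt (fun y => h (ln q, y)) (a - PI) (a + PI) = CInt (fun t => f (cir z0 q t)) (a - PI) (a + PI)).
  { intros q Hq. apply CInt_ext; [lra|]. intros t _. unfold h, cexp, cir; simpl. rewrite exp_ln by auto. reflexivity. }
  rewrite !Ev in E by lra.
  set (A := CInt (fun t => f (cir z0 r t)) (a - PI) (a + PI)) in *.
  set (B := CInt (fun t => f (cir z0 s t)) (a - PI) (a + PI)) in *.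
  assert (E3 : (A - B = 0)%C) by (apply Cmult_Ci_inj; rewrite <- E; ring).
  replace A with (A - B + B)%C by ring. rewrite E3. ring.
Qed.

(** The mean agrees with those over arbitrarily small circles, which tend to the value at the centre
    by continuity. The exceptional point [w] makes room for a difference quotient at [w], the
    function that yields Cauchy's formula. *)
Lemma circle_mean_except (f : C -> C) (z0 w : C) (R0 r : R) :
  0 < r < R0 -> Cmod (w - z0) < r ->
  (forall z, 0 < Cmod (z - z0) < R0 -> z <> w -> Hol f z) -> Ccont f z0 -> Ccont f w ->
  CInt (fun t => f (cir z0 r t)) 0 (2 * PI) = (RtoC (2 * PI) * f z0)%C.
Proof.
  intros Hr Hw Hf Hc0 Hcw. pose proof PI_RGT_0 as HPI.
  destruct (polar_form (w - z0)) as (a & Ha & Hpol).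
  assert (Hcont : forall s, 0 < s < R0 -> (s <> Cmod (w - z0)) -> forall t, rcont (fun t => f (cir z0 s t)) t).
  { intros s Hs Hn t. apply (rcont_comp f (cir z0 s)); [apply rcont_cir|].
    apply Hol_cont, Hf; [rewrite Cmod_cir; lra|]. intros E. apply Hn. rewrite <- E, Cmod_cir; lra. }
  assert (Hper : CInt (fun t => f (cir z0 r t)) (a - PI) (a + PI) = CInt (fun t => f (cir z0 r t)) 0 (2 * PI)).
  { replace (a + PI) with (a - PI + 2 * PI) by ring. apply CInt_period; [lra|apply Hcont; lra|].
    intros t. unfold cir. rewrite eit_2PI. reflexivity. }
  rewrite <- Hper.
  set (I := CInt (fun t => f (cir z0 r t)) (a - PI) (a + PI)).
  destruct (C_eq_dec I (RtoC (2 * PI) * f z0)%C) as [|n]; auto. exfalso.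
  apply Cmod_sub_pos in n. set (eta := Cmod (I - RtoC (2 * PI) * f z0)) in *.
  (* Over an interval of length [2 PI], with the factor 2 of [CInt_bound], this tolerance gives
     [eta / 2]. *)
  destruct (Hc0 (eta / (8 * PI)) ltac:(apply Rdiv_lt_0_compat; lra)) as (d & Hd & H1).
  assert (exists s, 0 < s < r /\ s < d /\ (w = z0 \/ s < Cmod (w - z0))) as (s & Hs & Hsd & Hsw).
  { destruct (C_eq_dec w z0) as [e|n0].
    - exists (Rmin r d / 2). pose proof (Rmin_glb_lt _ _ 0 (proj1 Hr) Hd).
      pose proof (Rmin_l r d). pose proof (Rmin_r r d). repeat split; auto; lra.
    - apply Cmod_sub_pos in n0. exists (Rmin (Cmod (w - z0)) d / 2).
      pose proof (Rmin_glb_lt _ _ 0 n0 Hd).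
      pose proof (Rmin_l (Cmod (w - z0)) d). pose proof (Rmin_r (Cmod (w - z0)) d). repeat split; try lra. }
  assert (E : I = CInt (fun t => f (cir z0 s t)) (a - PI) (a + PI)).
  { apply circle_mean_radii with w R0; auto; lra. }
  assert (Ek : (RtoC (2 * PI) * f z0)%C = CInt (fun _ => f z0) (a - PI) (a + PI)).
  { rewrite CInt_const. f_equal. f_equal. ring. }
  assert (Hsn : s <> Cmod (w - z0)).
  { destruct Hsw as [->|]; [rewrite Cmod_refl|]; lra. }
  unfold eta in *. rewrite E, Ek in n.
  rewrite <- CInt_minus in n; [|lra|intros t _; apply Hcont; lra|intros t _; apply rcont_const].
  assert (B : Cmod (CInt (fun t => f (cir z0 s t) - f z0)%C (a - PI) (a + PI)) <= 2 * (eta / (8 * PI)) * (a + PI - (a - PI))).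
  { apply CInt_bound; [lra| |].
    - intros t _. apply rcont_minus; [apply Hcont; lra|apply rcont_const].
    - intros t _. left. apply H1. rewrite Cmod_cir; lra. }
  rewrite CInt_minus in B; [|lra|intros t _; apply Hcont; lra|intros t _; apply rcont_const].
  rewrite CInt_minus in n; [|lra|intros t _; apply Hcont; lra|intros t _; apply rcont_const].
  rewrite <- E, <- Ek in B, n. fold eta in B, n.
  replace (2 * (eta / (8 * PI)) * (a + PI - (a - PI))) with (eta / 2) in B by (field; lra). lra.
Qed.

(* On the circle the kernel is the conjugate of the function [1 / (1 - conj u z / r^2)], which is
   holomorphic on a larger disc. *)
Lemma cauchy_kernel_int (u : C) (r : R) : 0 < r -> Cmod u < r ->
  CInt (fun t => RtoC r * eit t / (RtoC r * eit t - u))%C 0 (2 * PI) = RtoC (2 * PI).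
Proof.
  intros Hr Hu. pose proof (Cmod_ge_0 u) as Hu0. pose proof PI_RGT_0 as HPI.
  set (q := (Cconj u / RtoC (r * r))%C). set (k := fun z : C => (/ (1 - q * z))%C).
  assert (Hrr : RtoC (r * r) <> 0%C) by (intros K; injection K; nra).
  assert (Hq : Cmod q = Cmod u / (r * r)).
  { unfold q. rewrite Cmod_div by auto. rewrite Cmod_conj, Cmod_R, Rabs_pos_eq by nra. reflexivity. }
  (* A radius strictly between [r] and [r^2 / |u|], the modulus of the pole of [k]; the formula also
     makes sense for [u = 0]. *)
  set (R0 := 2 * (r * r) / (r + Cmod u)).
  assert (HR0 : r < R0).
  { unfold R0. apply Rlt_div_r; nra. }
  assert (Hne : forall z, Cmod z < R0 -> (1 - q * z)%C <> 0%C).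
  { intros z Hz. apply Cmod_gt_0. pose proof (Cmod_le_add_sub 1 (q * z)) as H.
    rewrite Cmod_1, Cmod_mult, Hq in H.
    assert (Cmod u / (r * r) * Cmod z <= Cmod u / (r * r) * R0).
    { apply Rmult_le_compat_l; [apply Rdiv_le_0_compat; nra|lra]. }
    assert (E : Cmod u / (r * r) * R0 = 2 * Cmod u / (r + Cmod u)) by (unfold R0; field; split; nra).
    assert (2 * Cmod u / (r + Cmod u) < 1) by (apply Rlt_div_l; lra). lra. }
  assert (Hk : forall z, Cmod z < R0 -> Hol k z).
  { intros z Hz. apply Hol_inv; [|apply Hne; auto].
    apply Hol_minus; [apply Hol_const|apply Hol_mult; [apply Hol_const|apply Hol_id]]. }
  assert (E0 : forall z, Cmod (z - 0) = Cmod z) by (intros z; f_equal; ring).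
  assert (Em : CInt (fun t => k (cir (RtoC 0) r t)) 0 (2 * PI) = (RtoC (2 * PI) * k (RtoC 0))%C).
  { apply circle_mean_except with (RtoC 0) R0; try lra.
    - rewrite Cmod_refl; lra.
    - intros z [_ Hz] _. apply Hk. rewrite <- E0; auto.
    - apply Hol_cont, Hk. rewrite Cmod_0. lra.
    - apply Hol_cont, Hk. rewrite Cmod_0. lra. }
  assert (Ek0 : k 0%C = 1%C) by (unfold k; field; replace (1 - q * 0)%C with (RtoC 1) by ring; apply C1_nz).
  rewrite Ek0, Cmult_1_r in Em.
  transitivity (Cconj (CInt (fun t => k (cir (RtoC 0) r t)) 0 (2 * PI))).
  2:{ rewrite Em. unfold Cconj, RtoC; simpl. f_equal. ring. }
  rewrite <- CInt_conj; [|lra|].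
  2:{ intros t _. apply (rcont_comp k (cir (RtoC 0) r)); [apply rcont_cir|]. apply Hol_cont, Hk.
      rewrite <- E0, Cmod_cir; lra. }
  apply CInt_ext; [lra|]. intros t _. unfold k, cir.
  assert (Hrt : forall v, Cmod v < r -> (RtoC r * eit t - v)%C <> 0%C).
  { intros v Hv. apply Cmod_gt_0. pose proof (Cmod_le_add_sub (RtoC r * eit t) v) as H.
    rewrite Cmod_mult, Cmod_eit, Cmod_R, Rabs_pos_eq in H by lra. lra. }
  assert (Hn1 : (1 - q * (0 + RtoC r * eit t))%C <> 0%C).
  { apply Hne. rewrite Cplus_0_l, Cmod_mult, Cmod_eit, Cmod_R, Rabs_pos_eq by lra. lra. }
  set (c := (1 - q * (0 + RtoC r * eit t))%C) in *.
  assert (Ec : (Cconj c * (RtoC r * eit t) = RtoC r * eit t - u)%C).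
  { unfold c, q. unfold Cconj, eit, Cmult, Cdiv, Cinv, Cminus, Cplus, Copp, RtoC; simpl.
    destruct u as [u1 u2]; simpl. pose proof (sin2_cos2 t) as H. unfold Rsqr in H.
    assert (Hd : r * r * (r * r * 1) + 0 * (0 * 1) <> 0) by (assert (0 < r * r) by nra; nra).
    f_equal.
    - transitivity (r * cos t - u1 * (sin t * sin t + cos t * cos t)); [field; auto with real|rewrite H; ring].
    - transitivity (r * sin t - u2 * (sin t * sin t + cos t * cos t)); [field; auto with real|rewrite H; ring]. }
  assert (Hcc : Cconj c <> 0%C).
  { apply Cmod_gt_0. rewrite Cmod_conj. apply Cmod_gt_0; auto. }
  rewrite <- Ec.
  assert (Hre : (RtoC r * eit t)%C <> 0%C).
  { replace (RtoC r * eit t)%C with (RtoC r * eit t - 0)%C by ring. apply Hrt. rewrite Cmod_0; lra. }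
  transitivity (/ Cconj c)%C.
  - field. split; auto. split; intros K; apply Hre; rewrite K; ring.
  - clear -Hn1 Hcc. 
    assert (E : (Cconj (/ c) * Cconj c = 1)%C).
    { rewrite <- Cmult_conj, Cinv_l by auto. unfold Cconj, RtoC; simpl. f_equal. ring. }
    replace (/ Cconj c)%C with (Cconj (/ c) * Cconj c * / Cconj c)%C by (rewrite E; ring). field; auto.
Qed.

Definition HolD (f : C -> C) (z0 : C) (r : R) : Prop := forall z, Cmod (z - z0) < r -> Hol f z.

(* [f] need only be continuous at the centre; removability of singularities follows. *)
Lemma cauchy_formula_punctured (f : C -> C) (z0 w : C) (R0 r : R) :
  0 < r < R0 -> Cmod (w - z0) < r ->
  (forall z, 0 < Cmod (z - z0) < R0 -> Hol f z) -> Ccont f z0 ->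
  CInt (fun t => f (cir z0 r t) * (RtoC r * eit t) / (cir z0 r t - w))%C 0 (2 * PI) = (RtoC (2 * PI) * f w)%C.
Proof.
  intros Hr Hw Hf Hc. pose proof PI_RGT_0 as HPI.
  assert (Hne : forall t, (cir z0 r t - w)%C <> 0%C).
  { intros t. apply Cmod_gt_0. pose proof (Cmod_triangle_sub (cir z0 r t) w z0) as H.
    rewrite Cmod_cir in H by lra. lra. }
  destruct (C_eq_dec w z0) as [->|n].
  - rewrite (CInt_ext _ (fun t => f (cir z0 r t))); [|lra|].
    + apply circle_mean_except with z0 R0; auto.
    + intros t _. specialize (Hne t). unfold cir in *.
      replace (z0 + RtoC r * eit t - z0)%C with (RtoC r * eit t)%C in * by ring. field.
      split; intros K; apply Hne; rewrite K; ring.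
  - pose proof (Cmod_sub_pos _ _ n) as n'.
    destruct (Hf w ltac:(lra)) as [l Hl].
    apply cder_slope in Hl as (phi & Hphi & El & d & Hd & Hs).
    (* The factor [z - z0] turns the mean into the contour integral of the difference quotient, and
       makes the value at the centre zero. So the mean of [F] vanishes; what remains is [f w] times
       the integral of the Cauchy kernel. *)
    set (F := fun z => ((z - z0) * (if C_eq_dec z w then l else (f z - f w) / (z - w)))%C).
    (* Stated for an arbitrary local property [P], to serve for both [Hol] and [Ccont]. *)
    assert (HF : forall z, z <> w -> forall (P : (C -> C) -> C -> Prop),
      (forall u v, (exists d, 0 < d /\ forall x, Cmod (x - z) < d -> u x = v x) -> P u z -> P v z) ->
      P (fun z => (z - z0) * ((f z - f w) / (z - w)))%C z -> P F z).
    { intros z Hz P HP. apply HP. exists (Cmod (z - w)). split; [apply Cmod_sub_pos; auto|].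
      intros x Hx. unfold F. destruct (C_eq_dec x w) as [->|]; auto. exfalso.
      rewrite Cmod_minus_sym in Hx. lra. }
    assert (Hzw : forall z, z <> w -> (z - w)%C <> 0%C).
    { intros z Hz. apply Cmod_sub_neq0, Cmod_sub_pos; auto. }
    assert (EF : CInt (fun t => F (cir z0 r t)) 0 (2 * PI) = (RtoC (2 * PI) * F z0)%C).
    { apply circle_mean_except with w R0; auto.
      - intros z Hz Hzn. apply HF; auto; [intros u v; apply Hol_ext_loc|].
        apply Hol_mult; [apply Hol_minus; [apply Hol_id|apply Hol_const]|].
        apply Hol_div; auto; apply Hol_minus; auto; try apply Hol_const; apply Hol_id.
      - apply HF; auto; [intros u v; apply Ccont_ext_loc|].
        apply Ccont_mult; [apply Ccont_minus; [apply Ccont_id|apply Ccont_const]|].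
        apply Ccont_div; auto; apply Ccont_minus; auto; try apply Ccont_const; apply Ccont_id.
      - apply Ccont_ext_loc with (fun z => (z - z0) * phi z)%C.
        + exists d. split; auto. intros x Hx. unfold F. destruct (C_eq_dec x w) as [->|nx]; [rewrite El; auto|].
          rewrite (Hs x Hx). field. auto.
        + apply Ccont_mult; auto. apply Ccont_minus; [apply Ccont_id|apply Ccont_const]. }
    assert (EF0 : F z0 = 0%C) by (unfold F; ring).
    rewrite EF0, Cmult_0_r in EF.
    rewrite (CInt_ext (fun t => F (cir z0 r t))
      (fun t => f (cir z0 r t) * (RtoC r * eit t) / (cir z0 r t - w) - f w * (RtoC r * eit t / (RtoC r * eit t - (w - z0))))%C) in EF; [|lra|].
    2:{ intros t _. unfold F. specialize (Hne t). destruct (C_eq_dec (cir z0 r t) w) as [e|_].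
        - exfalso. apply Hne. rewrite e. ring.
        - unfold cir in *. replace (RtoC r * eit t - (w - z0))%C with (z0 + RtoC r * eit t - w)%C by ring. field. auto. }
    assert (Ce : forall t, rcont (fun t => RtoC r * eit t)%C t).
    { intros t. apply rcont_mult; [apply rcont_const|apply rcont_eit]. }
    assert (C2 : rcont_on (fun t => RtoC r * eit t / (RtoC r * eit t - (w - z0)))%C 0 (2 * PI)).
    { intros t _. apply rcont_div; auto.
      - apply rcont_minus; auto. apply rcont_const.
      - specialize (Hne t). unfold cir in Hne.
        replace (RtoC r * eit t - (w - z0))%C with (z0 + RtoC r * eit t - w)%C by ring. auto. }
    rewrite CInt_minus, CInt_scal, cauchy_kernel_int in EF; auto; try lra.
    + match type of EF with (?A - _ = _)%C => replace A with (A - f w * RtoC (2 * PI) + f w * RtoC (2 * PI))%C by ring end.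
      rewrite EF. ring.
    + intros t _. apply rcont_div; auto.
      * apply rcont_mult; auto. apply (rcont_comp f (cir z0 r)); [apply rcont_cir|].
        apply Hol_cont, Hf. rewrite Cmod_cir; lra.
      * apply rcont_minus; [apply rcont_cir|apply rcont_const].
    + intros t Ht. apply rcont_mult; [apply rcont_const|auto].
Qed.

(** * Consequences of Cauchy's formula *)

Lemma rcont_Cmod (f : R -> C) (t : R) : rcont f t -> continuity_pt (fun s => Cmod (f s)) t.
Proof.
  rewrite rcontP. intros H eps He. destruct (H eps He) as (d & Hd & H1). exists d. split; auto.
  intros s [_ Hs]. eapply Rle_lt_trans; [|apply (H1 s Hs)]. unfold dist; simpl; unfold R_dist.
  pose proof (Cmod_le_add_sub (f s) (f t)). pose proof (Cmod_le_add_sub (f t) (f s)) as H2.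
  rewrite Cmod_minus_sym in H2. apply Rabs_le; lra.
Qed.

Lemma rcont_on_bounded (f : R -> C) (a b : R) : a <= b -> rcont_on f a b ->
  exists M, 0 <= M /\ forall t, a <= t <= b -> Cmod (f t) <= M.
Proof.
  intros Hab Hf. destruct (continuity_ab_maj (fun s => Cmod (f s)) a b Hab) as (x & Hx & _).
  - intros c Hc. apply rcont_Cmod; auto.
  - exists (Cmod (f x)). split; [apply Cmod_ge_0|auto].
Qed.

Lemma rcont_on_away (f : R -> C) (a b : R) : a <= b -> rcont_on f a b ->
  (forall t, a <= t <= b -> f t <> 0%C) ->
  exists m, 0 < m /\ forall t, a <= t <= b -> m <= Cmod (f t).
Proof.
  intros Hab Hf Hn. destruct (continuity_ab_min (fun s => Cmod (f s)) a b Hab) as (x & Hx & Hx2).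
  - intros c Hc. apply rcont_Cmod; auto.
  - exists (Cmod (f x)). split; [apply Cmod_gt_0; auto|auto].
Qed.

(** Differentiation under the integral sign: a remainder that is quadratic uniformly in [t] stays
    quadratic after integration. *)
Lemma CInt_cder (g g1 : R -> C -> C) (a b K d : R) (w : C) : a <= b -> 0 < d -> 0 <= K ->
  (forall w', Cmod (w' - w) < d -> rcont_on (fun t => g t w') a b) ->
  rcont_on (fun t => g1 t w) a b ->
  (forall w' t, Cmod (w' - w) < d -> a <= t <= b ->
     Cmod (g t w' - g t w - g1 t w * (w' - w)) <= K * Cmod (w' - w) ^ 2) ->
  cder (fun z => CInt (fun t => g t z) a b) w (CInt (fun t => g1 t w) a b).
Proof.
  intros Hab Hd HK Hg Hg1 HE eps He.
  set (L := 2 * K * (b - a)). assert (0 <= L) by (unfold L; apply Rmult_le_pos; lra).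
  exists (Rmin d (eps / (L + 1))). split; [apply Rmin_glb_lt; auto; apply Rdiv_lt_0_compat; lra|].
  intros w' Hw. apply Rmin_Rgt_l in Hw as [Hw1 Hw2]. apply Rlt_div_r in Hw2; [|lra].
  assert (Cw : rcont_on (fun t => g t w) a b) by (apply Hg; rewrite Cmod_refl; auto).
  assert (Cw' : rcont_on (fun t => g t w') a b) by (apply Hg; auto).
  assert (Ck : rcont_on (fun t => (w' - w) * g1 t w)%C a b).
  { intros t Ht. apply rcont_mult; [apply rcont_const|auto]. }
  assert (Cm : rcont_on (fun t => g t w' - g t w)%C a b) by (intros t Ht; apply rcont_minus; auto).
  rewrite (Cmult_comm (CInt _ _ _)), <- CInt_scal, <- !CInt_minus by auto.
  eapply Rle_trans.
  - apply (CInt_bound _ a b (K * Cmod (w' - w) ^ 2)); auto.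
    + intros t Ht. apply rcont_minus; auto.
    + intros t Ht. rewrite (Cmult_comm (w' - w)). apply HE; auto.
  - replace (2 * (K * Cmod (w' - w) ^ 2) * (b - a)) with (L * Cmod (w' - w) * Cmod (w' - w)) by (unfold L; ring).
    pose proof (Cmod_ge_0 (w' - w)). apply Rmult_le_compat_r; auto. nra.
Qed.

Lemma cir_sub_neq0 (z0 w : C) (r t : R) : Cmod (w - z0) < r -> (cir z0 r t - w)%C <> 0%C.
Proof.
  intros H. apply Cmod_gt_0. pose proof (Cmod_triangle_sub (cir z0 r t) w z0) as H1.
  pose proof (Cmod_ge_0 (w - z0)). rewrite Cmod_cir in H1 by lra. lra.
Qed.

Lemma cir_sub_ge (z0 w : C) (r t : R) : Cmod (w - z0) < r -> r - Cmod (w - z0) <= Cmod (cir z0 r t - w).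
Proof.
  intros H. pose proof (Cmod_triangle_sub (cir z0 r t) w z0) as H1.
  pose proof (Cmod_ge_0 (w - z0)). rewrite Cmod_cir in H1 by lra. lra.
Qed.

Lemma rcont_cauchy (phi : R -> C) (z0 w : C) (r a b : R) (n : nat) : Cmod (w - z0) < r ->
  rcont_on phi a b -> rcont_on (fun t => phi t / (cir z0 r t - w) ^ n)%C a b.
Proof.
  intros Hw Hp t Ht. apply rcont_div; auto.
  - apply (rcont_comp (fun z => (z - w) ^ n)%C (cir z0 r)); [apply rcont_cir|].
    apply Ccont_pow, Ccont_minus; [apply Ccont_id|apply Ccont_const].
  - apply Cpow_nz, cir_sub_neq0; auto.
Qed.

Lemma Cmod_div_le (x y : C) (A B : R) : Cmod x <= A -> 0 < B -> B <= Cmod y -> Cmod (x / y) <= A / B.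
Proof.
  intros HA HB Hy. rewrite Cmod_div by (apply Cmod_gt_0; lra).
  apply Rmult_le_compat; auto.
  - apply Cmod_ge_0.
  - left; apply Rinv_0_lt_compat; lra.
  - apply Rinv_le_contravar; auto.
Qed.

Lemma near_disc_half (z0 w w' : C) (r : R) : Cmod (w - z0) < r ->
  Cmod (w' - w) < (r - Cmod (w - z0)) / 2 -> Cmod (w' - z0) < r - (r - Cmod (w - z0)) / 2.
Proof. intros H H1. pose proof (Cmod_triangle_sub w' w z0). lra. Qed.

(** With [A] the difference of the circle point and [w], and [h = w' - w], the remainder of the
    kernel is exactly [h^2 / ((A - h) A^2)]. Here [|A| >= s] and [|A - h| >= s / 2], whence the
    constant [2 M / s^3]. *)
Lemma cauchy_integral_cder1 (phi : R -> C) (z0 w : C) (r a b : R) : a <= b ->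
  Cmod (w - z0) < r -> rcont_on phi a b ->
  cder (fun z => CInt (fun t => phi t / (cir z0 r t - z) ^ 1)%C a b) w (CInt (fun t => phi t / (cir z0 r t - w) ^ 2)%C a b).
Proof.
  intros Hab Hw Hp. destruct (rcont_on_bounded phi a b Hab Hp) as (M & HM0 & HM).
  set (s := r - Cmod (w - z0)). assert (Hs : 0 < s) by (unfold s; lra).
  assert (0 < s ^ 3) by (apply pow_lt; auto).
  apply (CInt_cder (fun t z => phi t / (cir z0 r t - z) ^ 1)%C (fun t z => phi t / (cir z0 r t - z) ^ 2)%C a b (2 * M / s ^ 3) (s / 2)); auto; try lra.
  - apply Rdiv_le_0_compat; lra.
  - intros w' Hw'. apply rcont_cauchy; auto. pose proof (near_disc_half z0 w w' r Hw Hw'). fold s in H0. lra.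
  - apply rcont_cauchy; auto.
  - intros w' t Hw' Ht. pose proof (near_disc_half z0 w w' r Hw Hw') as Hn. fold s in Hn.
    pose proof (cir_sub_ge z0 w r t Hw) as G1. pose proof (cir_sub_ge z0 w' r t ltac:(lra)) as G2.
    pose proof (cir_sub_neq0 z0 w r t Hw) as N1. pose proof (cir_sub_neq0 z0 w' r t ltac:(lra)) as N2.
    fold s in G1. assert (G3 : s / 2 <= Cmod (cir z0 r t - w')) by lra.
    match goal with |- Cmod ?E <= _ =>
      replace E with (phi t * ((w' - w) * (w' - w)) / ((cir z0 r t - w') * ((cir z0 r t - w) * (cir z0 r t - w))))%C by (field; auto) end.
    replace (2 * M / s ^ 3 * Cmod (w' - w) ^ 2) with (M * (Cmod (w' - w) * Cmod (w' - w)) / (s / 2 * (s * s))) by (field; lra).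
    apply Cmod_div_le.
    + rewrite !Cmod_mult. apply Rmult_le_compat_r; auto. pose proof (Cmod_ge_0 (w' - w)); nra.
    + nra.
    + rewrite !Cmod_mult. apply Rmult_le_compat; try lra; try nra.
Qed.

(** Differentiating twice shows that the derivative of a holomorphic function is holomorphic, and
    this can be iterated. The constant [16] is [12 + 4], from the two fractions into which the
    remainder is split. *)
Lemma cauchy_integral_cder2 (phi : R -> C) (z0 w : C) (r a b : R) : a <= b ->
  Cmod (w - z0) < r -> rcont_on phi a b ->
  cder (fun z => CInt (fun t => phi t / (cir z0 r t - z) ^ 2)%C a b) w (CInt (fun t => 2 * phi t / (cir z0 r t - w) ^ 3)%C a b).
Proof.
  intros Hab Hw Hp. destruct (rcont_on_bounded phi a b Hab Hp) as (M & HM0 & HM).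
  set (s := r - Cmod (w - z0)). assert (Hs : 0 < s) by (unfold s; lra).
  assert (0 < s ^ 4) by (apply pow_lt; auto).
  apply (CInt_cder (fun t z => phi t / (cir z0 r t - z) ^ 2)%C (fun t z => 2 * phi t / (cir z0 r t - z) ^ 3)%C a b (16 * M / s ^ 4) (s / 2)); auto; try lra.
  - apply Rdiv_le_0_compat; lra.
  - intros w' Hw'. apply rcont_cauchy; auto. pose proof (near_disc_half z0 w w' r Hw Hw'). fold s in H0. lra.
  - apply (rcont_cauchy (fun t => 2 * phi t)%C); auto. intros t Ht. apply rcont_mult; [apply rcont_const|auto].
  - intros w' t Hw' Ht. pose proof (near_disc_half z0 w w' r Hw Hw') as Hn. fold s in Hn.
    pose proof (cir_sub_ge z0 w r t Hw) as G1. pose proof (cir_sub_ge z0 w' r t ltac:(lra)) as G2.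
    pose proof (cir_sub_neq0 z0 w r t Hw) as N1. pose proof (cir_sub_neq0 z0 w' r t ltac:(lra)) as N2.
    fold s in G1. assert (G3 : s / 2 <= Cmod (cir z0 r t - w')) by lra.
    set (A := (cir z0 r t - w)%C) in *. set (h := (w' - w)%C) in *.
    assert (EA : (cir z0 r t - w' = A - h)%C) by (unfold A, h; ring). rewrite EA in *.
    replace (phi t / (A - h) ^ 2 - phi t / A ^ 2 - 2 * phi t / A ^ 3 * h)%C
      with (phi t * (h * h) * 3 / ((A * A) * ((A - h) * (A - h))) - phi t * (h * h) * (2 * h) / ((A * A * A) * ((A - h) * (A - h))))%C
      by (field; auto).
    eapply Rle_trans; [apply Cmod_sub_le|].
    pose proof (Cmod_ge_0 h) as Hh0.
    assert (B1 : Cmod (phi t * (h * h) * 3 / ((A * A) * ((A - h) * (A - h)))) <= M * (Cmod h * Cmod h) * 3 / ((s * s) * (s / 2 * (s / 2)))).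
    { apply Cmod_div_le.
      - rewrite !Cmod_mult, Cmod_R, Rabs_pos_eq by lra. apply Rmult_le_compat_r; [lra|]. apply Rmult_le_compat_r; auto. nra.
      - assert (0 < s * s) by nra. nra.
      - rewrite !Cmod_mult. apply Rmult_le_compat; nra. }
    assert (B2 : Cmod (phi t * (h * h) * (2 * h) / ((A * A * A) * ((A - h) * (A - h)))) <= M * (Cmod h * Cmod h) * s / ((s * s * s) * (s / 2 * (s / 2)))).
    { apply Cmod_div_le.
      - rewrite !Cmod_mult, Cmod_R, Rabs_pos_eq by lra. apply Rmult_le_compat; try nra.
        + apply Rmult_le_pos; [apply Cmod_ge_0|nra].
        + apply Rmult_le_compat_r; auto. nra.
      - assert (0 < s * s) by nra. assert (0 < s * s * s) by nra. nra.
      - rewrite !Cmod_mult. apply Rmult_le_compat; try nra. apply Rmult_le_compat; nra. }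
    eapply Rle_trans; [apply Rplus_le_compat; [exact B1|exact B2]|].
    right. field. lra.
Qed.

Definition Cd (f : C -> C) (z : C) : C := epsilon (inhabits (RtoC 0)) (fun l => cder f z l).

Lemma Cd_cder (f : C -> C) (z : C) : Hol f z -> cder f z (Cd f z).
Proof. intros H. unfold Cd. apply epsilon_spec. exact H. Qed.

Lemma Cd_eq (f : C -> C) (z l : C) : cder f z l -> Cd f z = l.
Proof. intros H. eapply cder_unique; [apply Cd_cder; exists l; exact H|exact H]. Qed.

(** The hypothesis is a Cauchy representation with a continuous density, which may be known before
    [f] is known to be holomorphic. It therefore serves both for removable singularities and for
    uniform limits. *)
Lemma cauchy_rep_Hol (f : C -> C) (phi : R -> C) (z0 w : C) (r : R) :
  rcont_on phi 0 (2 * PI) ->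
  (forall z, Cmod (z - z0) < r -> (CInt (fun t => phi t / (cir z0 r t - z)) 0 (2 * PI) = RtoC (2 * PI) * f z)%C) ->
  Cmod (w - z0) < r -> Hol f w /\ Hol (Cd f) w.
Proof.
  intros Hp Hrep Hw. pose proof PI_RGT_0 as HPI.
  set (k := (/ RtoC (2 * PI))%C).
  assert (Hk : (k * RtoC (2 * PI) = 1)%C) by (unfold k; apply Cinv_l; intros K; injection K; lra).
  assert (Ef : forall z, Cmod (z - z0) < r -> f z = (k * CInt (fun t => phi t / (cir z0 r t - z) ^ 1)%C 0 (2 * PI))%C).
  { intros z Hz. rewrite (CInt_ext _ (fun t => phi t / (cir z0 r t - z))%C).
    - rewrite (Hrep z Hz), Cmult_assoc, Hk. ring.
    - lra.
    - intros t _. rewrite Cpow_1_r. reflexivity. }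
  assert (Hnear : forall z, Cmod (z - z0) < r -> exists d, 0 < d /\ forall x, Cmod (x - z) < d -> Cmod (x - z0) < r).
  { intros z Hz. exists (r - Cmod (z - z0)). split; [lra|]. intros x Hx. pose proof (Cmod_triangle_sub x z z0). lra. }
  assert (D1 : forall z, Cmod (z - z0) < r -> cder f z (k * CInt (fun t => phi t / (cir z0 r t - z) ^ 2)%C 0 (2 * PI))%C).
  { intros z Hz. apply (cder_ext_loc (fun z => k * CInt (fun t => phi t / (cir z0 r t - z) ^ 1)%C 0 (2 * PI))%C).
    - destruct (Hnear z Hz) as (d & Hd & H). exists d. split; auto. intros x Hx. rewrite (Ef x); auto.
    - eapply cder_eq; [apply (cder_mult (fun _ => k)); [apply cder_const|apply cauchy_integral_cder1; auto; lra]|]. simpl; ring. }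
  split; [eexists; apply D1; auto|].
  eexists. apply (cder_ext_loc (fun z => k * CInt (fun t => phi t / (cir z0 r t - z) ^ 2)%C 0 (2 * PI))%C).
  - destruct (Hnear w Hw) as (d & Hd & H). exists d. split; auto. intros x Hx. symmetry. apply Cd_eq, D1. auto.
  - apply (cder_mult (fun _ => k)); [apply cder_const|apply cauchy_integral_cder2; auto; lra].
Qed.

Lemma rcont_cauchy_density (f : C -> C) (z0 : C) (r : R) : 0 <= r ->
  (forall z, Cmod (z - z0) = r -> Ccont f z) ->
  rcont_on (fun t => f (cir z0 r t) * (RtoC r * eit t))%C 0 (2 * PI).
Proof.
  intros Hr Hf t _. apply rcont_mult.
  - apply (rcont_comp f (cir z0 r)); [apply rcont_cir|apply Hf, Cmod_cir; auto].
  - apply rcont_mult; [apply rcont_const|apply rcont_eit].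
Qed.

Lemma Hol_punctured (f : C -> C) (z0 : C) (R0 : R) :
  (forall z, 0 < Cmod (z - z0) < R0 -> Hol f z) -> Ccont f z0 ->
  forall w, Cmod (w - z0) < R0 -> Hol f w /\ Hol (Cd f) w.
Proof.
  intros Hf Hc w Hw. pose proof (Cmod_ge_0 (w - z0)).
  set (r := (Cmod (w - z0) + R0) / 2).
  apply (cauchy_rep_Hol f (fun t => f (cir z0 r t) * (RtoC r * eit t))%C z0 w r); [| |unfold r; lra].
  - apply rcont_cauchy_density; [unfold r; lra|]. intros z Hz. apply Hol_cont, Hf. unfold r in Hz; lra.
  - intros z Hz. apply cauchy_formula_punctured with R0; auto. unfold r; lra.
Qed.

Lemma removable_singularity (f : C -> C) (z0 : C) (R0 : R) : 0 < R0 ->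
  (forall z, 0 < Cmod (z - z0) < R0 -> Hol f z) -> Ccont f z0 -> Hol f z0.
Proof. intros HR Hf Hc. apply (Hol_punctured f z0 R0); auto. rewrite Cmod_refl; auto. Qed.

Lemma HolD_Cd (f : C -> C) (z0 : C) (r : R) : HolD f z0 r -> HolD (Cd f) z0 r.
Proof.
  intros H w Hw. apply (Hol_punctured f z0 r); auto.
  - intros z [_ Hz]; auto.
  - apply Hol_cont, H. rewrite Cmod_refl. pose proof (Cmod_ge_0 (w - z0)). lra.
Qed.

Lemma cauchy_formula (f : C -> C) (z0 w : C) (R0 r : R) : 0 < r < R0 -> Cmod (w - z0) < r -> HolD f z0 R0 ->
  CInt (fun t => f (cir z0 r t) * (RtoC r * eit t) / (cir z0 r t - w))%C 0 (2 * PI) = (RtoC (2 * PI) * f w)%C.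
Proof.
  intros Hr Hw Hf. apply cauchy_formula_punctured with R0; auto.
  - intros z [_ Hz]; auto.
  - apply Hol_cont, Hf. rewrite Cmod_refl. lra.
Qed.

Lemma le_of_pow_le (a M K : R) : 0 <= a -> 0 <= M -> (forall n, a ^ n <= K * M ^ n) -> a <= M.
Proof.
  intros Ha HM H. destruct (Rle_dec a M) as [|n]; auto. exfalso. apply Rnot_le_lt in n.
  destruct HM as [HM| <-].
  - assert (Hq : Rabs (a / M) > 1).
    { rewrite Rabs_pos_eq by (apply Rdiv_le_0_compat; lra). apply Rlt_gt, Rlt_div_r; lra. }
    destruct (Pow_x_infinity _ Hq (K + 1)) as (N & HN). specialize (HN N (Nat.le_refl _)).
    rewrite Rabs_pos_eq in HN by (apply pow_le, Rdiv_le_0_compat; lra).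
    unfold Rdiv in HN. rewrite Rpow_mult_distr, pow_inv in HN. specialize (H N).
    assert (0 < M ^ N) by (apply pow_lt; auto).
    apply Rge_le in HN. apply (Rmult_le_compat_r (M ^ N)) in HN; [|lra].
    rewrite Rmult_assoc, Rinv_l in HN by lra. nra.
  - specialize (H 1%nat). simpl in H. lra.
Qed.

(* Cauchy's estimate is applied to the powers of [f], whose n-th roots make the constant disappear. *)
Lemma max_principle (f : C -> C) (z0 w : C) (R0 r M : R) : 0 < r < R0 -> HolD f z0 R0 ->
  (forall z, Cmod (z - z0) = r -> Cmod (f z) <= M) -> Cmod (w - z0) < r -> Cmod (f w) <= M.
Proof.
  intros Hr Hf HM Hw. pose proof PI_RGT_0 as HPI.
  assert (HM0 : 0 <= M).
  { eapply Rle_trans; [apply Cmod_ge_0|apply (HM (cir z0 r 0)), Cmod_cir; lra]. }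
  set (s := r - Cmod (w - z0)). assert (Hs : 0 < s) by (unfold s; lra).
  apply le_of_pow_le with (2 * r / s); auto; [apply Cmod_ge_0|]. intros n.
  rewrite <- Cmod_pow.
  assert (HP : HolD (fun z => f z ^ n)%C z0 R0) by (intros z Hz; apply Hol_pow, Hf; auto).
  pose proof (cauchy_formula _ z0 w R0 r Hr Hw HP) as E. simpl in E.
  assert (B : Cmod (RtoC (2 * PI) * f w ^ n) <= 2 * (M ^ n * r / s) * (2 * PI - 0)).
  { rewrite <- E. apply CInt_bound; [lra| |].
    - intros t Ht. apply rcont_div.
      + apply (rcont_cauchy_density (fun z => f z ^ n)%C); auto; [lra|].
        intros z Hz. apply Hol_cont, HP. lra.
      + apply rcont_minus; [apply rcont_cir|apply rcont_const].
      + apply cir_sub_neq0; auto.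
    - intros t Ht. apply Cmod_div_le; auto.
      + rewrite !Cmod_mult, Cmod_eit, Cmod_R, Rabs_pos_eq, Cmod_pow, Rmult_1_r by lra.
        apply Rmult_le_compat_r; [lra|]. apply pow_incr. split; [apply Cmod_ge_0|]. apply HM, Cmod_cir; lra.
      + apply cir_sub_ge; auto. }
  rewrite Cmod_mult, Cmod_R, Rabs_pos_eq in B by lra.
  apply Rmult_le_reg_l with (2 * PI); [lra|]. eapply Rle_trans; [exact B|]. right. field. lra.
Qed.

(** The two Cauchy kernels differ by [w - w'] over a product of two factors of modulus at least
    [r / 2]. With the factor 2 of [CInt_bound] this gives [2 M r / (r / 2)^2 = 8 M / r]. *)
Lemma cauchy_lipschitz (f : C -> C) (z0 w w' : C) (R0 r M : R) : 0 < r < R0 -> HolD f z0 R0 ->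
  (forall z, Cmod (z - z0) = r -> Cmod (f z) <= M) ->
  Cmod (w - z0) < r / 2 -> Cmod (w' - z0) < r / 2 -> Cmod (f w - f w') <= 8 * M / r * Cmod (w - w').
Proof.
  intros Hr Hf HM Hw Hw'. pose proof PI_RGT_0 as HPI.
  pose proof (cauchy_formula _ z0 w R0 r Hr ltac:(lra) Hf) as E.
  pose proof (cauchy_formula _ z0 w' R0 r Hr ltac:(lra) Hf) as E'.
  set (phi := fun t => (f (cir z0 r t) * (RtoC r * eit t))%C) in *.
  assert (Hphi : rcont_on phi 0 (2 * PI)).
  { apply rcont_cauchy_density; [lra|]. intros z Hz. apply Hol_cont, Hf. lra. }
  assert (Hc : forall x, Cmod (x - z0) < r -> rcont_on (fun t => phi t / (cir z0 r t - x))%C 0 (2 * PI)).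
  { intros x Hx t Ht. apply rcont_div; auto.
    - apply rcont_minus; [apply rcont_cir|apply rcont_const].
    - apply cir_sub_neq0; auto. }
  assert (B : Cmod (RtoC (2 * PI) * f w - RtoC (2 * PI) * f w') <= 2 * (M * r * Cmod (w - w') / (r / 2 * (r / 2))) * (2 * PI - 0)).
  { rewrite <- E, <- E', <- CInt_minus; [|lra|apply Hc; lra|apply Hc; lra].
    apply CInt_bound; [lra| |].
    - intros t Ht. apply rcont_minus; apply Hc; auto; lra.
    - intros t Ht. pose proof (cir_sub_neq0 z0 w r t ltac:(lra)). pose proof (cir_sub_neq0 z0 w' r t ltac:(lra)).
      pose proof (cir_sub_ge z0 w r t ltac:(lra)). pose proof (cir_sub_ge z0 w' r t ltac:(lra)).
      fold (phi t).
      replace (phi t / (cir z0 r t - w) - phi t / (cir z0 r t - w'))%C with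
        (phi t * (w - w') / ((cir z0 r t - w) * (cir z0 r t - w')))%C by (field; auto).
      apply Cmod_div_le; [|nra|].
      + unfold phi. rewrite !Cmod_mult, Cmod_eit, Cmod_R, Rabs_pos_eq, Rmult_1_r by lra.
        apply Rmult_le_compat_r; [apply Cmod_ge_0|]. apply Rmult_le_compat_r; [lra|]. apply HM, Cmod_cir; lra.
      + rewrite Cmod_mult. apply Rmult_le_compat; lra. }
  replace (RtoC (2 * PI) * f w - RtoC (2 * PI) * f w')%C with (RtoC (2 * PI) * (f w - f w'))%C in B by ring.
  rewrite Cmod_mult, Cmod_R, Rabs_pos_eq in B by lra.
  apply Rmult_le_reg_l with (2 * PI); [lra|]. eapply Rle_trans; [exact B|]. right. field. lra.
Qed.

(** * Uniform limits and isolated zeros *)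

Definition uconv (fn : nat -> C -> C) (f : C -> C) (z0 : C) (r : R) : Prop :=
  forall eps, 0 < eps -> exists N : nat, forall n, (N <= n)%nat ->
    forall z, Cmod (z - z0) < r -> Cmod (fn n z - f z) < eps.

Lemma uconv_cont (fn : nat -> C -> C) (f : C -> C) (z0 : C) (r : R) (N0 : nat) :
  (forall n, (N0 <= n)%nat -> HolD (fn n) z0 r) -> uconv fn f z0 r ->
  forall z, Cmod (z - z0) < r -> Ccont f z.
Proof.
  intros Hf Hu z Hz eps He. destruct (Hu (eps / 3) ltac:(lra)) as (N & HN).
  set (n := Nat.max N N0). specialize (HN n ltac:(lia)).
  destruct (Hol_cont _ _ (Hf n ltac:(lia) z Hz) (eps / 3) ltac:(lra)) as (d & Hd & H1).
  exists (Rmin d (r - Cmod (z - z0))). split; [apply Rmin_glb_lt; lra|].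
  intros w Hw. apply Rmin_Rgt_l in Hw as [Hw1 Hw2].
  pose proof (Cmod_triangle_sub w z z0).
  specialize (H1 w Hw1). pose proof (HN z Hz) as Z. pose proof (HN w ltac:(lra)) as W.
  pose proof (Cmod_triangle_sub (f w) (fn n w) (f z)). pose proof (Cmod_triangle_sub (fn n w) (fn n z) (f z)).
  rewrite (Cmod_minus_sym (f w) (fn n w)) in H0. lra.
Qed.

(** Cauchy's formula passes to the limit, and [cauchy_rep_Hol] concludes. The threshold [N0] is
    there because the first members of a spherically convergent sequence may have poles in the
    disc. *)
Lemma uconv_Hol (fn : nat -> C -> C) (f : C -> C) (z0 : C) (R0 : R) (N0 : nat) :
  (forall n, (N0 <= n)%nat -> HolD (fn n) z0 R0) -> uconv fn f z0 R0 -> HolD f z0 R0.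
Proof.
  intros Hf Hu w Hw. pose proof PI_RGT_0 as HPI. pose proof (Cmod_ge_0 (w - z0)) as Hw0.
  pose proof (uconv_cont fn f z0 R0 N0 Hf Hu) as Hc.
  set (r := (Cmod (w - z0) + R0) / 2).
  apply (cauchy_rep_Hol f (fun t => f (cir z0 r t) * (RtoC r * eit t))%C z0 w r); [| |unfold r; lra].
  - apply rcont_cauchy_density; [unfold r; lra|]. intros z Hz. apply Hc. unfold r in Hz; lra.
  - assert (Hr : 0 < r < R0) by (unfold r; lra).
    intros z Hz. set (s := r - Cmod (z - z0)). assert (Hs : 0 < s) by (unfold s; lra).
    set (I := CInt (fun t => f (cir z0 r t) * (RtoC r * eit t) / (cir z0 r t - z))%C 0 (2 * PI)).
    destruct (C_eq_dec I (RtoC (2 * PI) * f z)%C) as [|nn]; auto. exfalso.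
    apply Cmod_sub_pos in nn. set (eta := Cmod (I - RtoC (2 * PI) * f z)) in *.
    set (K := 2 * PI * (2 * r / s + 1)).
    assert (HK : 0 < K) by (unfold K; assert (0 < 2 * r / s) by (apply Rdiv_lt_0_compat; lra); nra).
    assert (He : 0 < eta / (2 * K)) by (apply Rdiv_lt_0_compat; lra).
    destruct (Hu _ He) as (N & HN). set (n := Nat.max N N0). specialize (HN n ltac:(lia)).
    set (e := eta / (2 * K)) in *.
    pose proof (cauchy_formula (fn n) z0 z R0 r Hr Hz (Hf n ltac:(lia))) as E.
    assert (Hc1 : forall g, (forall x, Cmod (x - z0) = r -> Ccont g x) ->
        rcont_on (fun t => g (cir z0 r t) * (RtoC r * eit t) / (cir z0 r t - z))%C 0 (2 * PI)).
    { intros g Hg t Ht. apply rcont_div.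
      - apply (rcont_cauchy_density g z0 r); auto. lra.
      - apply rcont_minus; [apply rcont_cir|apply rcont_const].
      - apply cir_sub_neq0; auto. }
    assert (B : Cmod (I - RtoC (2 * PI) * fn n z) <= 2 * (e * r / s) * (2 * PI - 0)).
    { rewrite <- E. unfold I. rewrite <- CInt_minus; [|lra| |].
      - apply CInt_bound; [lra| |].
        + intros t Ht. apply rcont_minus; apply Hc1; auto; intros x Hx.
          * apply Hc. lra.
          * apply Hol_cont, Hf; [lia|lra].
        + intros t Ht.
          replace (f (cir z0 r t) * (RtoC r * eit t) / (cir z0 r t - z) - fn n (cir z0 r t) * (RtoC r * eit t) / (cir z0 r t - z))%C
            with ((f (cir z0 r t) - fn n (cir z0 r t)) * (RtoC r * eit t) / (cir z0 r t - z))%C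
            by (field; apply cir_sub_neq0; auto).
          apply Cmod_div_le; auto.
          * rewrite !Cmod_mult, Cmod_eit, Cmod_R, Rabs_pos_eq, Rmult_1_r by lra.
            apply Rmult_le_compat_r; [lra|]. rewrite Cmod_minus_sym. left. apply HN. rewrite Cmod_cir; lra.
          * apply cir_sub_ge; auto.
      - apply Hc1. intros x Hx. apply Hc; lra.
      - apply Hc1. intros x Hx. apply Hol_cont, Hf; [lia|lra]. }
    assert (B2 : Cmod (RtoC (2 * PI) * fn n z - RtoC (2 * PI) * f z) <= 2 * PI * e).
    { replace (RtoC (2 * PI) * fn n z - RtoC (2 * PI) * f z)%C with (RtoC (2 * PI) * (fn n z - f z))%C by ring.
      rewrite Cmod_mult, Cmod_R, Rabs_pos_eq by lra. apply Rmult_le_compat_l; [lra|]. left. apply HN. lra. }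
    pose proof (Cmod_triangle_sub I (RtoC (2 * PI) * fn n z) (RtoC (2 * PI) * f z)) as T. fold eta in T.
    assert (E2 : 2 * (e * r / s) * (2 * PI - 0) + 2 * PI * e = K * e) by (unfold K; field; lra).
    assert (K * e = eta / 2) by (unfold e; field; lra). lra.
Qed.

(** The quotient agrees near [z0] with Caratheodory's continuous slope, so its singularity is
    removable. *)
Lemma Hol_factor (f : C -> C) (z0 : C) (r : R) : HolD f z0 r -> f z0 = 0%C ->
  exists g, HolD g z0 r /\ forall z, f z = ((z - z0) * g z)%C.
Proof.
  intros Hf H0.
  exists (fun z => if C_eq_dec z z0 then Cd f z0 else (f z / (z - z0))%C). split.
  2:{ intros z. destruct (C_eq_dec z z0) as [->|n]; [rewrite H0; ring|]. field.
      apply Cmod_sub_neq0, Cmod_sub_pos; auto. }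
  assert (Hp : forall z, 0 < Cmod (z - z0) < r -> Hol (fun z => if C_eq_dec z z0 then Cd f z0 else (f z / (z - z0))%C) z).
  { intros z [Hz1 Hz2]. apply Hol_ext_loc with (fun z => f z / (z - z0))%C.
    - exists (Cmod (z - z0)). split; auto. intros w Hw. destruct (C_eq_dec w z0) as [->|]; auto.
      exfalso. rewrite Cmod_minus_sym in Hw. lra.
    - apply Hol_div; auto; [apply Hol_minus; [apply Hol_id|apply Hol_const]|]. apply Cmod_sub_neq0; auto. }
  intros z Hz. assert (Hr : 0 < r) by (pose proof (Cmod_ge_0 (z - z0)); lra).
  assert (Hol0 : Hol f z0) by (apply Hf; rewrite Cmod_refl; auto).
  destruct (C_eq_dec z z0) as [->|n]; [|apply Hp; split; auto; apply Cmod_sub_pos; auto].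
  apply removable_singularity with r; auto.
  pose proof (Cd_cder f z0 Hol0) as D. apply cder_slope in D as (phi & Hc & E & d & Hd & Hs).
  apply Ccont_ext_loc with phi; auto. exists d. split; auto. intros w Hw.
  destruct (C_eq_dec w z0) as [->|n]; auto. rewrite (Hs w Hw), H0. field.
  apply Cmod_sub_neq0, Cmod_sub_pos; auto.
Qed.

(** A substitute for power series: if the second alternative fails, every power of [z - z0] can be
    split off. The maximum principle for the cofactor then bounds [|f z|] by [M q^n] for all [n],
    with [q < 1], anywhere in the disc. *)
Lemma isolated_zeros (f : C -> C) (z0 : C) (R0 : R) : HolD f z0 R0 ->
  (forall z, Cmod (z - z0) < R0 -> f z = 0%C) \/
  (exists d, 0 < d /\ forall z, 0 < Cmod (z - z0) < d -> f z <> 0%C).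
Proof.
  intros Hf. destruct (classic (exists d, 0 < d /\ forall z, 0 < Cmod (z - z0) < d -> f z <> 0%C)) as [H|H]; auto.
  left. intros z Hz. pose proof (Cmod_ge_0 (z - z0)) as Hz0.
  assert (Hn : forall n, exists g, HolD g z0 R0 /\ forall z, f z = ((z - z0) ^ n * g z)%C).
  { induction n.
    - exists f. split; auto. intros; simpl; ring.
    - destruct IHn as (g & Hg & Eg).
      assert (G0 : g z0 = 0%C).
      { destruct (C_eq_dec (g z0) 0%C) as [|nz]; auto. exfalso. apply H.
        destruct (Ccont_away g z0) as (d & Hd & Hd1); auto.
        - apply Hol_cont, Hg. rewrite Cmod_refl. lra.
        - exists d. split; auto. intros x [Hx1 Hx2]. rewrite Eg. apply Cmult_neq_0.
          + apply Cpow_nz, Cmod_sub_neq0; auto.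
          + apply Cmod_gt_0. apply Cmod_gt_0 in nz. specialize (Hd1 x Hx2). lra. }
      destruct (Hol_factor g z0 R0 Hg G0) as (k & Hk & Ek). exists k. split; auto.
      intros x. rewrite Eg, Ek. simpl. ring. }
  set (r := (Cmod (z - z0) + R0) / 2). assert (Hr : 0 < r < R0) by (unfold r; lra).
  destruct (rcont_on_bounded (fun t => f (cir z0 r t)) 0 (2 * PI)) as (M & HM0 & HM).
  { pose proof PI_RGT_0; lra. }
  { intros t _. apply (rcont_comp f (cir z0 r)); [apply rcont_cir|]. apply Hol_cont, Hf. rewrite Cmod_cir; lra. }
  assert (HMc : forall x, Cmod (x - z0) = r -> Cmod (f x) <= M).
  { intros x Hx. destruct (polar_form (x - z0)) as (a & Ha & Hp). rewrite Hx in Hp.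
    assert (Ex : x = cir z0 r a) by (unfold cir; rewrite <- Hp; ring).
    destruct (Rle_dec 0 a) as [h|h].
    - rewrite Ex. apply HM. pose proof PI_RGT_0; lra.
    - replace (cir z0 r a) with (cir z0 r (a + 2 * PI)) in Ex by (unfold cir; rewrite eit_2PI; reflexivity).
      rewrite Ex. apply HM. pose proof PI_RGT_0; lra. }
  set (q := Cmod (z - z0) / r).
  assert (Hq : 0 <= q < 1).
  { unfold q. split; [apply Rdiv_le_0_compat; lra|]. apply Rlt_div_l; [lra|]. unfold r; lra. }
  assert (Hb : forall n, Cmod (f z) <= M * q ^ n).
  { intros n. destruct (Hn n) as (g & Hg & Eg).
    assert (Hgz : Cmod (g z) <= M / r ^ n).
    { apply (max_principle g z0 z R0 r); auto; [|unfold r; lra]. intros x Hx.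
      specialize (HMc x Hx). rewrite Eg, Cmod_mult, Cmod_pow, Hx in HMc.
      apply Rle_div_r; [apply pow_lt; lra|]. lra. }
    rewrite Eg, Cmod_mult, Cmod_pow. unfold q, Rdiv. rewrite Rpow_mult_distr, pow_inv.
    rewrite Rmult_comm, (Rmult_comm (Cmod (z - z0) ^ n)), <- Rmult_assoc.
    apply Rmult_le_compat_r; auto. apply pow_le; auto. }
  destruct (C_eq_dec (f z) 0%C) as [|nz]; auto. exfalso. apply Cmod_gt_0 in nz.
  destruct (pow_lt_1_zero q ltac:(rewrite Rabs_pos_eq; lra) (Cmod (f z) / (M + 1))) as (N & HN).
  { apply Rdiv_lt_0_compat; lra. }
  specialize (HN N (Nat.le_refl _)). specialize (Hb N).
  rewrite Rabs_pos_eq in HN by (apply pow_le; lra). apply Rlt_div_r in HN; [|lra].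
  assert (0 <= q ^ N) by (apply pow_le; lra). lra.
Qed.

(** * Compactness and maxima *)

Definition strict_incr (phi : nat -> nat) : Prop := forall n, (phi n < phi (S n))%nat.

Lemma strict_incr_ge (phi : nat -> nat) (n : nat) : strict_incr phi -> (n <= phi n)%nat.
Proof. intros H. induction n; [lia|]. specialize (H n). lia. Qed.

Lemma strict_incr_lt (phi : nat -> nat) (m n : nat) : strict_incr phi -> (m < n)%nat -> (phi m < phi n)%nat.
Proof.
  intros H L. induction n; [lia|]. pose proof (H n). destruct (Nat.eq_dec m n) as [->|]; [lia|].
  specialize (IHn ltac:(lia)). lia.
Qed.

Lemma strict_incr_comp (phi psi : nat -> nat) :
  strict_incr phi -> strict_incr psi -> strict_incr (fun n => phi (psi n)).
Proof. intros H1 H2 n. apply strict_incr_lt; auto. Qed.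

Definition rlim (u : nat -> R) (l : R) : Prop :=
  forall eps, 0 < eps -> exists N : nat, forall n, (N <= n)%nat -> Rabs (u n - l) < eps.

Lemma rlim_subseq (u : nat -> R) (l : R) (phi : nat -> nat) :
  strict_incr phi -> rlim u l -> rlim (fun n => u (phi n)) l.
Proof.
  intros Hp H eps He. destruct (H eps He) as (N & HN). exists N. intros n Hn. apply HN.
  pose proof (strict_incr_ge phi n Hp). lia.
Qed.

Lemma inv_INR_small (eps : R) : 0 < eps -> exists N : nat, forall n, (N <= n)%nat -> / (INR n + 1) < eps.
Proof.
  intros He. destruct (archimed_cor1 eps He) as (N & HN & HN0). exists N. intros n Hn.
  apply Rle_lt_trans with (/ INR N); auto. apply Rinv_le_contravar; [apply lt_0_INR; auto|].
  apply le_INR in Hn. lra.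
Qed.

Lemma bounded_subseq_R (u : nat -> R) (M : R) : (forall n, Rabs (u n) <= M) ->
  exists phi l, strict_incr phi /\ rlim (fun n => u (phi n)) l.
Proof.
  intros HM.
  destruct (Bolzano_Weierstrass u (fun x => - M <= x <= M) (compact_P3 (- M) M)) as (l & Hl).
  { intros n. apply Rabs_le_between. auto. }
  assert (Hn : forall (N : nat) eps, 0 < eps -> exists p, (N <= p)%nat /\ Rabs (u p - l) < eps).
  { intros N eps He. apply (Hl (disc l (mkposreal eps He)) N). exists (mkposreal eps He). intros x Hx. exact Hx. }
  destruct (Hn 0%nat 1 ltac:(lra)) as (p0 & _ & Hp0).
  destruct (dependent_choice nat (fun n p => Rabs (u p - l) < / (INR n + 1)) (fun _ p q => (p < q)%nat) p0) as (phi & _ & Hphi).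
  - simpl. rewrite Rplus_0_l, Rinv_1. auto.
  - intros n p _. destruct (Hn (S p) (/ (INR (S n) + 1))) as (q & Hq1 & Hq2).
    + apply Rinv_0_lt_compat. pose proof (pos_INR (S n)). lra.
    + exists q. split; auto.
  - exists phi, l. split; [intros n; apply Hphi|]. intros eps He.
    destruct (inv_INR_small eps He) as (N & HN). exists N. intros n Hn2.
    eapply Rlt_trans; [apply (proj1 (Hphi n))|]. auto.
Qed.

Definition clim (u : nat -> C) (l : C) : Prop :=
  forall eps, 0 < eps -> exists N : nat, forall n, (N <= n)%nat -> Cmod (u n - l) < eps.

Lemma bounded_subseq_C (u : nat -> C) (M : R) : (forall n, Cmod (u n) <= M) ->
  exists phi l, strict_incr phi /\ clim (fun n => u (phi n)) l.
Proof.
  intros HM.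
  destruct (bounded_subseq_R (fun n => Re (u n)) M) as (phi & x & Hphi & Hx).
  { intros n. eapply Rle_trans; [apply re_le_Cmod|auto]. }
  destruct (bounded_subseq_R (fun n => Im (u (phi n))) M) as (psi & y & Hpsi & Hy).
  { intros n. eapply Rle_trans; [apply im_le_Cmod|auto]. }
  exists (fun n => phi (psi n)), (x, y). split; [apply strict_incr_comp; auto|].
  intros eps He. destruct (rlim_subseq _ _ psi Hpsi Hx (eps / 2) ltac:(lra)) as (N1 & H1).
  destruct (Hy (eps / 2) ltac:(lra)) as (N2 & H2). exists (Nat.max N1 N2). intros n Hn.
  specialize (H1 n ltac:(lia)). specialize (H2 n ltac:(lia)).
  eapply Rle_lt_trans; [apply Cmod_le_Re_Im|]. simpl. unfold Rminus in *. unfold Re, Im in *. lra.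
Qed.

(** Embedding the values into [C] makes the rules for [Ccont] available for real functions. *)
Definition rfcont (v : C -> R) (z : C) : Prop := Ccont (fun w => RtoC (v w)) z.

Lemma rfcontP (v : C -> R) (z : C) : rfcont v z <-> forall eps, 0 < eps -> exists d, 0 < d /\
  forall w, Cmod (w - z) < d -> Rabs (v w - v z) < eps.
Proof.
  split; intros H eps He; destruct (H eps He) as (d & Hd & H1); exists d; split; auto; intros w Hw;
    specialize (H1 w Hw); rewrite <- RtoC_minus, Cmod_R in *; auto.
Qed.

Lemma rfcont_comp (v : C -> R) (g : R -> R) (z : C) :
  rfcont v z -> continuity_pt g (v z) -> rfcont (fun w => g (v w)) z.
Proof.
  rewrite !rfcontP. intros Hv Hg eps He. destruct (Hg eps He) as (d & Hd & H1).
  destruct (Hv d Hd) as (d2 & Hd2 & H2). exists d2. split; auto. intros w Hw.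
  destruct (Req_dec (v w) (v z)) as [->|n].
  - replace (g (v z) - g (v z)) with 0 by ring. rewrite Rabs_R0; auto.
  - apply H1. split; [split; [exact I|auto]|]. apply H2; auto.
Qed.

Lemma rfcont_plus (u v : C -> R) (z : C) : rfcont u z -> rfcont v z -> rfcont (fun w => u w + v w) z.
Proof.
  intros Hu Hv. unfold rfcont. eapply Ccont_ext_loc; [|apply (Ccont_plus _ _ z Hu Hv)].
  exists 1. split; [lra|]. intros w _. rewrite RtoC_plus. reflexivity.
Qed.

Lemma rfcont_mult (u v : C -> R) (z : C) : rfcont u z -> rfcont v z -> rfcont (fun w => u w * v w) z.
Proof.
  intros Hu Hv. unfold rfcont. eapply Ccont_ext_loc; [|apply (Ccont_mult _ _ z Hu Hv)].
  exists 1. split; [lra|]. intros w _. rewrite RtoC_mult. reflexivity.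
Qed.

Lemma rfcont_Cmod (f : C -> C) (z : C) : Ccont f z -> rfcont (fun w => Cmod (f w)) z.
Proof.
  intros H. apply rfcontP. intros eps He. destruct (H eps He) as (d & Hd & H1). exists d. split; auto.
  intros w Hw. eapply Rle_lt_trans; [|apply (H1 w Hw)].
  pose proof (Cmod_le_add_sub (f w) (f z)). pose proof (Cmod_le_add_sub (f z) (f w)) as H2.
  rewrite Cmod_minus_sym in H2. apply Rabs_le; lra.
Qed.

Lemma closed_disc_max (v : C -> R) (z0 : C) (r : R) : 0 <= r ->
  (forall z, Cmod (z - z0) <= r -> rfcont v z) ->
  exists z, Cmod (z - z0) <= r /\ forall w, Cmod (w - z0) <= r -> v w <= v z.
Proof.
  intros Hr Hv.
  (* An increasing function of [v] that is bounded above by 0, so that its supremum exists before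
     [v] is known to be bounded. *)
  set (g := fun z => - exp (- v z)).
  assert (Hmono : forall x y, g x <= g y -> v x <= v y).
  { intros x y H. unfold g in H. apply Rnot_lt_le. intros L.
    assert (exp (- v x) < exp (- v y)) by (apply exp_increasing; lra). lra. }
  assert (Hg : forall z, Cmod (z - z0) <= r -> rfcont g z).
  { intros z Hz. apply (rfcont_comp v (fun x => - exp (- x))); auto.
    apply derivable_continuous_pt. apply ex_derive_Reals_0. auto_derive; auto. }
  destruct (completeness (fun y => exists z, Cmod (z - z0) <= r /\ y = g z)) as (S & HS1 & HS2).
  - exists 0. intros y (z & _ & ->). unfold g. pose proof (exp_pos (- v z)). lra.
  - exists (g z0), z0. rewrite Cmod_refl. auto.
  - assert (Hn : forall n : nat, exists z, Cmod (z - z0) <= r /\ S - / (INR n + 1) < g z).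
    { intros n. apply NNPP. intros K.
      assert (0 < / (INR n + 1)) by (apply Rinv_0_lt_compat; pose proof (pos_INR n); lra).
      enough (S <= S - / (INR n + 1)) by lra. apply HS2. intros y (z & Hz & ->).
      apply Rnot_lt_le. intros L. apply K. exists z. auto. }
    apply choice in Hn as (u & Hu).
    destruct (bounded_subseq_C u (Cmod z0 + r)) as (phi & l & Hphi & Hl).
    { intros n. pose proof (Cmod_le_add_sub (u n) z0). destruct (Hu n). lra. }
    assert (Hlr : Cmod (l - z0) <= r).
    { apply Rnot_lt_le. intros L. destruct (Hl (Cmod (l - z0) - r) ltac:(lra)) as (N & HN).
      specialize (HN N (Nat.le_refl _)). destruct (Hu (phi N)) as [B _].
      pose proof (Cmod_triangle_sub l (u (phi N)) z0). rewrite (Cmod_minus_sym l (u (phi N))) in H. lra. }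
    exists l. split; auto. intros w Hw. apply Hmono. apply Rle_trans with S; [apply HS1; eauto|].
    apply Rnot_lt_le. intros L.
    set (e := (S - g l) / 2).
    destruct (proj1 (rfcontP g l) (Hg l Hlr) e ltac:(unfold e; lra)) as (d & Hd & H1).
    destruct (Hl d Hd) as (N1 & HN1). destruct (inv_INR_small e ltac:(unfold e; lra)) as (N2 & HN2).
    set (n := Nat.max N1 N2). specialize (HN1 n ltac:(lia)). specialize (H1 _ HN1).
    destruct (Hu (phi n)) as [_ B]. specialize (HN2 (phi n)).
    pose proof (strict_incr_ge phi n Hphi). specialize (HN2 ltac:(lia)).
    apply Rabs_lt_between in H1. unfold e in *. lra.
Qed.

(** If [m2] were positive, [m1] would be positive just to the right of its zero 0, and [mu] would
    increase there. *)
Lemma second_derivative_at_max (mu m1 : R -> R) (m2 d : R) : 0 < d ->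
  (forall x, Rabs x < d -> is_derive mu x (m1 x)) -> is_derive m1 0 m2 ->
  (forall x, Rabs x < d -> mu x <= mu 0) -> m2 <= 0.
Proof.
  intros Hd H1 H2 Hmax.
  assert (D1 : forall x, Rabs x < d -> derivable_pt_lim mu x (m1 x)) by (intros; apply is_derive_Reals; auto).
  apply is_derive_Reals in H2.
  assert (D0 := D1 0 ltac:(rewrite Rabs_R0; auto)).
  assert (E0 : m1 0 = 0).
  { pose (pr := exist _ (m1 0) D0 : derivable_pt mu 0).
    rewrite <- (derive_pt_eq_0 mu 0 (m1 0) pr D0).
    apply (deriv_maximum mu (- d) d 0 pr); try lra. intros x Hx1 Hx2. apply Hmax. apply Rabs_lt_between; lra. }
  apply Rnot_lt_le. intros L.
  destruct (H2 (m2 / 2) ltac:(lra)) as (e & He).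
  set (h := Rmin d e / 2). pose proof (cond_pos e) as He0.
  pose proof (Rmin_glb_lt _ _ 0 Hd He0). pose proof (Rmin_l d e). pose proof (Rmin_r d e).
  assert (Hh : 0 < h) by (unfold h; lra).
  destruct (MVT_cor2 mu m1 0 h Hh) as (c & Ec & Hc).
  { intros c Hc. apply D1. rewrite Rabs_pos_eq; unfold h in *; lra. }
  specialize (He c ltac:(lra) ltac:(rewrite Rabs_pos_eq; unfold h in *; lra)).
  rewrite Rplus_0_l, E0, Rminus_0_r in He. apply Rabs_lt_between in He.
  assert (0 < m1 c).
  { replace (m1 c) with (m1 c / c * c) by (field; lra). apply Rmult_lt_0_compat; lra. }
  specialize (Hmax h ltac:(rewrite Rabs_pos_eq; unfold h in *; lra)). nra.
Qed.

(** Second-order calculus is done along real lines; the directions [1] and [Ci] together yield the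
    Laplacian. *)
Definition line (z e : C) (x : R) : C := (z + RtoC x * e)%C.

Lemma line_0 (z e : C) : line z e 0 = z.
Proof. unfold line. ring. Qed.

Lemma is_derive_line (f : C -> C) (z e l : C) (x : R) : Cmod e = 1 -> cder f (line z e x) l ->
  is_derive (fun s => Re (f (line z e s))) x (Re (e * l)) /\
  is_derive (fun s => Im (f (line z e s))) x (Im (e * l)).
Proof.
  intros He H.
  assert (K : forall eps, 0 < eps -> exists d : posreal, forall h, h <> 0 -> Rabs h < d ->
     Cmod ((f (line z e (x + h)) - f (line z e x) - l * (RtoC h * e)) / RtoC h) < eps).
  { intros eps Hep. destruct (H (eps / 2) ltac:(lra)) as (d & Hd & H1).
    exists (mkposreal d Hd). intros h Hh Hhd. simpl in Hhd.
    assert (El : (line z e (x + h) - line z e x = RtoC h * e)%C) by (unfold line; rewrite RtoC_plus; ring).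
    specialize (H1 (line z e (x + h))). rewrite El, Cmod_mult, Cmod_R, He, Rmult_1_r in H1.
    specialize (H1 Hhd). assert (0 < Rabs h) by (apply Rabs_pos_lt; auto).
    rewrite Cmod_div by (intros E; injection E; auto). rewrite Cmod_R.
    apply Rlt_div_l; auto. nra. }
  split; apply is_derive_Reals; intros eps Hep; destruct (K eps Hep) as (d & Hd); exists d; intros h Hh Hhd;
    specialize (Hd h Hh Hhd); (eapply Rle_lt_trans; [|exact Hd]).
  - eapply Rle_trans; [|apply re_le_Cmod]. right. f_equal.
    set (A := f (line z e (x + h))). set (B := f (line z e x)). destruct A, B, e, l.
    unfold Cdiv, Cinv, Cmult, Cminus, Cplus, Copp, RtoC; simpl. field. auto.
  - eapply Rle_trans; [|apply im_le_Cmod]. right. f_equal.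
    set (A := f (line z e (x + h))). set (B := f (line z e x)). destruct A, B, e, l.
    unfold Cdiv, Cinv, Cmult, Cminus, Cplus, Copp, RtoC; simpl. field. auto.
Qed.

Lemma is_derive_ln_Cmod2 (f : C -> C) (z e l : C) (x : R) : Cmod e = 1 -> cder f (line z e x) l ->
  f (line z e x) <> 0%C ->
  is_derive (fun s => ln (Cmod (f (line z e s)) ^ 2)) x (2 * Re (e * (l / f (line z e x)))).
Proof.
  intros He H Hn. destruct (is_derive_line f z e l x He H) as [D1 D2].
  apply (is_derive_ext (fun s => ln (Re (f (line z e s)) * Re (f (line z e s)) + Im (f (line z e s)) * Im (f (line z e s))))).
  { intros s. rewrite Cmod2_alt. f_equal. ring. }
  assert (Hp : 0 < Re (f (line z e x)) * Re (f (line z e x)) + Im (f (line z e x)) * Im (f (line z e x))).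
  { apply Cmod_gt_0 in Hn. pose proof (Cmod2_alt (f (line z e x))) as E. nra. }
  set (w := f (line z e x)) in *.
  replace (2 * Re (e * (l / w))) with
    (scal (2 * (Re w * Re (e * l) + Im w * Im (e * l))) (/ (Re w * Re w + Im w * Im w))).
  - apply (is_derive_comp ln).
    + apply is_derive_ln; auto.
    + replace (2 * (Re w * Re (e * l) + Im w * Im (e * l))) with
        (plus (plus (mult (Re (e * l)) (Re w)) (mult (Re w) (Re (e * l)))) (plus (mult (Im (e * l)) (Im w)) (mult (Im w) (Im (e * l)))))
        by (unfold plus, mult; simpl; ring).
      apply (is_derive_plus (fun s => Re (f (line z e s)) * Re (f (line z e s)))).
      * apply (is_derive_mult (fun s => Re (f (line z e s))) (fun s => Re (f (line z e s)))); auto. intros; apply Rmult_comm.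
      * apply (is_derive_mult (fun s => Im (f (line z e s))) (fun s => Im (f (line z e s)))); auto. intros; apply Rmult_comm.
  - clearbody w. destruct w as [w1 w2], e as [e1 e2], l as [l1 l2]. simpl in *.
    unfold scal; simpl; unfold mult; simpl. field. nra.
Qed.

(** * Ahlfors' lemma for Robinson's metric *)

(* Robinson's metric on [C \ {0,1}] has density [exp (rob (ln |w|^2) + rob (ln |w-1|^2))]. *)
Definition rob (h : R) : R := ln (1 + exp (h / 6)) / 2 - 5 / 12 * h.
Definition rob1 (h : R) : R := 1 / 12 * (exp (h / 6) / (1 + exp (h / 6))) - 5 / 12.
Definition rob2 (h : R) : R := 1 / 72 * (exp (h / 6) / (1 + exp (h / 6)) ^ 2).

Lemma is_derive_rob (h : R) : is_derive rob h (rob1 h).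
Proof.
  unfold rob, rob1. pose proof (exp_pos (h / 6)). auto_derive; [unfold Rdiv in *; lra|].
  replace (h * / 6) with (h / 6) by reflexivity. field. lra.
Qed.

Lemma is_derive_rob1 (h : R) : is_derive rob1 h (rob2 h).
Proof.
  unfold rob1, rob2. pose proof (exp_pos (h / 6)). auto_derive; [unfold Rdiv in *; lra|].
  replace (h * / 6) with (h / 6) by reflexivity. field. lra.
Qed.

(** For [h = ln |w|^2], [exp (h / 6)] is [|w|^(1/3)]: squaring the density makes it a rational
    function of the cube roots of [|w|] and [|w - 1|]. *)
Lemma exp_rob_sq (h : R) : exp (rob h) ^ 2 = (1 + exp (h / 6)) / exp (h / 6) ^ 5.
Proof.
  pose proof (exp_pos (h / 6)) as He.
  assert (E : exp (rob h) ^ 2 * exp (5 / 6 * h) = 1 + exp (h / 6)).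
  { simpl. rewrite Rmult_1_r, <- !exp_plus. rewrite <- (exp_ln (1 + exp (h / 6))) at 1 by lra.
    f_equal. unfold rob. lra. }
  assert (E5 : exp (5 / 6 * h) = exp (h / 6) ^ 5).
  { simpl. rewrite Rmult_1_r, <- !exp_plus. f_equal. field. }
  rewrite <- E, E5. field. lra.
Qed.

Definition lnmod2 (f : C -> C) (z : C) : R := ln (Cmod (f z) ^ 2).

Definition logder (f : C -> C) (z : C) : C := (Cd f z / f z)%C.

Lemma lnmod2_line (f : C -> C) (z e : C) (d : R) : Cmod e = 1 -> 0 < d ->
  HolD f z d -> (forall w, Cmod (w - z) < d -> f w <> 0%C) ->
  (forall x, Rabs x < d -> is_derive (fun s => lnmod2 f (line z e s)) x (2 * Re (e * logder f (line z e x)))) /\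
  is_derive (fun x => 2 * Re (e * logder f (line z e x))) 0 (2 * Re (e * (e * Cd (logder f) z))).
Proof.
  intros He Hd Hf Hn.
  assert (Hl : forall x, Rabs x < d -> Cmod (line z e x - z) < d).
  { intros x Hx. unfold line. replace (z + RtoC x * e - z)%C with (RtoC x * e)%C by ring.
    rewrite Cmod_mult, Cmod_R, He. lra. }
  split.
  - intros x Hx. apply is_derive_ln_Cmod2; auto. apply Cd_cder, Hf; auto.
  - assert (Hq : Hol (logder f) z).
    { apply Hol_div; [apply (HolD_Cd f z d Hf)|apply Hf|apply Hn]; rewrite Cmod_refl; auto. }
    assert (D : cder (fun w => e * logder f w)%C (line z e 0) (e * Cd (logder f) z)%C).
    { rewrite line_0. eapply cder_eq; [apply (cder_mult (fun _ => e)); [apply cder_const|apply Cd_cder; exact Hq]|].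
      simpl. ring. }
    apply (is_derive_line _ z e _ 0 He) in D as [D _].
    apply (is_derive_scal (fun x => Re (e * logder f (line z e x))) 0 2). exact D.
Qed.

(** The left-hand side is the second derivative at [z], in the direction [e], of the logarithm [L]
    of the quotient to be maximized; in the application [f1 = H], [f2 = H - 1] and [f3 = Cd H]. The
    terms [D2] carry a factor [e^2], so they cancel when [e = 1] and [e = Ci] are added: the
    logarithm of a modulus is harmonic. *)
Lemma max_direction (f1 f2 f3 : C -> C) (z0 z e : C) (r d : R) : Cmod e = 1 -> 0 < d ->
  HolD f1 z d -> HolD f2 z d -> HolD f3 z d ->
  (forall w, Cmod (w - z) < d -> f1 w <> 0%C /\ f2 w <> 0%C /\ f3 w <> 0%C) ->
  (forall x, Rabs x < d -> 0 < r ^ 2 - Cmod (line z e x - z0) ^ 2) ->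
  (forall x, Rabs x < d ->
     let L := fun w => rob (lnmod2 f1 w) + rob (lnmod2 f2 w) + lnmod2 f3 w / 2 + ln (r ^ 2 - Cmod (w - z0) ^ 2) in
     L (line z e x) <= L z) ->
  let P0 := r ^ 2 - Cmod (z - z0) ^ 2 in
  let D := fun f => 2 * Re (e * logder f z) in
  let D2 := fun f => 2 * Re (e * (e * Cd (logder f) z)) in
  rob2 (lnmod2 f1 z) * D f1 ^ 2 + rob1 (lnmod2 f1 z) * D2 f1 +
  (rob2 (lnmod2 f2 z) * D f2 ^ 2 + rob1 (lnmod2 f2 z) * D2 f2) + D2 f3 / 2
  + (-2 * P0 - 4 * Re (Cconj e * (z - z0)) ^ 2) / P0 ^ 2 <= 0.
Proof.
  intros He Hd H1 H2 H3 Hn HP Hmax P0 D D2.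
  destruct (lnmod2_line f1 z e d He Hd H1) as [A1 B1]; [intros; apply Hn; auto|].
  destruct (lnmod2_line f2 z e d He Hd H2) as [A2 B2]; [intros; apply Hn; auto|].
  destruct (lnmod2_line f3 z e d He Hd H3) as [A3 B3]; [intros; apply Hn; auto|].
  set (b := Re (Cconj e * (z - z0))) in *.
  assert (EP : forall x, r ^ 2 - Cmod (line z e x - z0) ^ 2 = P0 - 2 * x * b - x ^ 2).
  { intros x. unfold P0, b, line. rewrite !Cmod2_alt.
    assert (E1 : Re e ^ 2 + Im e ^ 2 = 1) by (rewrite <- Cmod2_alt, He; ring).
    destruct z as [a1 a2], e as [e1 e2], z0 as [c1 c2]; simpl in *. 
    transitivity (r * (r * 1) - ((a1 - c1) ^ 2 + (a2 - c2) ^ 2) - 2 * x * (e1 * (a1 - c1) + e2 * (a2 - c2)) - x ^ 2 * (e1 * (e1 * 1) + e2 * (e2 * 1))); [ring|].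
    rewrite E1. ring. }
  set (n1 := fun x => 2 * Re (e * logder f1 (line z e x))) in *.
  set (n2 := fun x => 2 * Re (e * logder f2 (line z e x))) in *.
  set (n3 := fun x => 2 * Re (e * logder f3 (line z e x))) in *.
  set (N1 := fun x => lnmod2 f1 (line z e x)) in *.
  set (N2 := fun x => lnmod2 f2 (line z e x)) in *.
  set (N3 := fun x => lnmod2 f3 (line z e x)) in *.
  assert (HP0 : 0 < P0).
  { specialize (HP 0 ltac:(rewrite Rabs_R0; auto)). rewrite EP in HP. lra. }
  apply (second_derivative_at_max
     (fun x => rob (N1 x) + rob (N2 x) + N3 x / 2 + ln (P0 - 2 * x * b - x ^ 2))
     (fun x => n1 x * rob1 (N1 x) + n2 x * rob1 (N2 x) + n3 x / 2 + (- 2 * b - 2 * x) / (P0 - 2 * x * b - x ^ 2)) _ d Hd).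
  - intros x Hx. specialize (HP x Hx). rewrite EP in HP.
    assert (K : forall N n, is_derive N x n -> is_derive (fun x => rob (N x)) x (n * rob1 (N x))).
    { intros N n HN. apply (is_derive_comp rob N x (rob1 (N x)) n); auto. apply is_derive_rob. }
    apply (is_derive_plus (fun x => rob (N1 x) + rob (N2 x) + N3 x / 2)).
    + apply (is_derive_plus (fun x => rob (N1 x) + rob (N2 x))).
      * apply (is_derive_plus (fun x => rob (N1 x))); apply K; [apply A1|apply A2]; auto.
      * apply (is_derive_ext (fun x => / 2 * N3 x)); [intros t; change (/ 2 * N3 t = N3 t / 2); field|].
        replace (n3 x / 2) with (/ 2 * n3 x) by field.
        apply (is_derive_scal N3 x (/ 2)). apply A3; auto.
    + auto_derive; [lra|]. field. lra.
  - assert (K : forall N n n', is_derive N 0 (n 0) -> is_derive n 0 n' ->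
       is_derive (fun x => n x * rob1 (N x)) 0 (rob2 (N 0) * n 0 ^ 2 + rob1 (N 0) * n')).
    { intros N n n' HN Hn'.
      replace (rob2 (N 0) * n 0 ^ 2 + rob1 (N 0) * n') with
        (plus (mult n' (rob1 (N 0))) (mult (n 0) (n 0 * rob2 (N 0)))) by (unfold plus, mult; simpl; ring).
      apply (is_derive_mult n (fun x => rob1 (N x))); auto; [|intros; apply Rmult_comm].
      apply (is_derive_comp rob1 N 0 (rob2 (N 0)) (n 0)); auto. apply is_derive_rob1. }
    assert (R0 : Rabs 0 < d) by (rewrite Rabs_R0; auto).
    replace (rob1 (lnmod2 f1 z)) with (rob1 (N1 0)) by (unfold N1; rewrite line_0; reflexivity).
    replace (rob2 (lnmod2 f1 z)) with (rob2 (N1 0)) by (unfold N1; rewrite line_0; reflexivity).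
    replace (rob1 (lnmod2 f2 z)) with (rob1 (N2 0)) by (unfold N2; rewrite line_0; reflexivity).
    replace (rob2 (lnmod2 f2 z)) with (rob2 (N2 0)) by (unfold N2; rewrite line_0; reflexivity).
    replace (D f1) with (n1 0) by (unfold n1; rewrite line_0; reflexivity).
    replace (D f2) with (n2 0) by (unfold n2; rewrite line_0; reflexivity).
    apply (is_derive_plus (fun x => n1 x * rob1 (N1 x) + n2 x * rob1 (N2 x) + n3 x / 2)).
    + apply (is_derive_plus (fun x => n1 x * rob1 (N1 x) + n2 x * rob1 (N2 x))).
      * apply (is_derive_plus (fun x => n1 x * rob1 (N1 x))); apply K; auto.
      * apply (is_derive_ext (fun x => / 2 * n3 x)); [intros t; change (/ 2 * n3 t = n3 t / 2); field|].
        replace (D2 f3 / 2) with (/ 2 * D2 f3) by field.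
        apply (is_derive_scal n3 0 (/ 2)). auto.
    + auto_derive; [lra|]. field. lra.
  - intros x Hx. specialize (Hmax x Hx). simpl in Hmax. unfold N1, N2, N3.
    rewrite <- !EP, line_0. exact Hmax.
Qed.

(** The curvature bound for Robinson's metric, with [a = |w|^(1/3)] and [b = |w - 1|^(1/3)]. The
    term with the larger variable in the numerator suffices. If that variable is [y], then
    [y >= 1/2], so [1 + y <= 3 y], and [(1 + y)^4 <= 81 y^4 <= 162 y^5]. *)
Lemma pow5_ineq (a b : R) : 0 < a -> 0 < b -> 1 <= a ^ 3 + b ^ 3 ->
  (1 + a) * (1 + b) <= 162 * (b ^ 5 / (1 + a) ^ 2 + a ^ 5 / (1 + b) ^ 2).
Proof.
  assert (W : forall a b, 0 < a -> a <= b -> 1 <= a ^ 3 + b ^ 3 ->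
     (1 + a) * (1 + b) <= 162 * (b ^ 5 / (1 + a) ^ 2)).
  { intros x y Hx Hxy H.
    assert (Hy : 1 / 2 <= y).
    { apply Rnot_lt_le. intros L.
      assert (y ^ 3 <= (1 / 2) ^ 3) by (apply pow_incr; lra).
      assert (x ^ 3 <= (1 / 2) ^ 3) by (apply pow_incr; lra). lra. }
    assert (0 < (1 + x) ^ 2) by (apply pow_lt; lra).
    replace (162 * (y ^ 5 / (1 + x) ^ 2)) with (162 * y ^ 5 / (1 + x) ^ 2) by (field; lra).
    apply (proj1 (Rle_div_r _ _ _ H0)).
    apply Rle_trans with ((1 + y) ^ 4).
    - assert ((1 + x) ^ 3 <= (1 + y) ^ 3) by (apply pow_incr; lra).
      replace ((1 + x) * (1 + y) * (1 + x) ^ 2) with ((1 + x) ^ 3 * (1 + y)) by ring.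
      replace ((1 + y) ^ 4) with ((1 + y) ^ 3 * (1 + y)) by ring. apply Rmult_le_compat_r; lra.
    - apply Rle_trans with ((3 * y) ^ 4); [apply pow_incr; lra|].
      replace ((3 * y) ^ 4) with (81 * y ^ 4) by ring. replace (162 * y ^ 5) with (162 * y * y ^ 4) by ring.
      apply Rmult_le_compat_r; [apply pow_le; lra|lra]. }
  intros Ha Hb H.
  assert (Q1 : 0 < b ^ 5 / (1 + a) ^ 2) by (apply Rdiv_lt_0_compat; apply pow_lt; lra).
  assert (Q2 : 0 < a ^ 5 / (1 + b) ^ 2) by (apply Rdiv_lt_0_compat; apply pow_lt; lra).
  destruct (Rle_dec a b) as [L|L].
  - pose proof (W a b Ha L H). lra.
  - pose proof (W b a Hb ltac:(lra) ltac:(lra)). lra.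
Qed.

Lemma exp_cube_lnmod2 (w : C) : w <> 0%C -> exp (ln (Cmod w ^ 2) / 6) ^ 3 = Cmod w.
Proof.
  intros Hw. apply Cmod_gt_0 in Hw.
  assert (E : ln (Cmod w ^ 2) = 2 * ln (Cmod w)) by (simpl; rewrite Rmult_1_r, ln_mult by lra; ring).
  rewrite E. set (u := 2 * ln (Cmod w) / 6).
  replace (exp u ^ 3) with (exp (u + u + u)) by (rewrite !exp_plus; ring).
  replace (u + u + u) with (ln (Cmod w)) by (unfold u; field). apply exp_ln; auto.
Qed.

Definition robinson (w : C) : R := exp (rob (ln (Cmod w ^ 2)) + rob (ln (Cmod (w - 1) ^ 2))).

Lemma robinson_sq (w : C) :
  let a := exp (ln (Cmod w ^ 2) / 6) in let b := exp (ln (Cmod (w - 1) ^ 2) / 6) in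
  robinson w ^ 2 = (1 + a) * (1 + b) / (a ^ 5 * b ^ 5).
Proof.
  intros a b. unfold robinson. rewrite exp_plus, Rpow_mult_distr, !exp_rob_sq. fold a b.
  assert (0 < a) by apply exp_pos. assert (0 < b) by apply exp_pos. field. lra.
Qed.

(* Ahlfors' lemma for Robinson's metric: at an interior maximum of the quotient by the
   density [1 / (r^2 - |z|^2)], the Laplacian of its logarithm is nonpositive. *)
Lemma ahlfors_robinson (H : C -> C) (z0 : C) (R0 r : R) : 0 < r < R0 -> HolD H z0 R0 ->
  (forall z, Cmod (z - z0) < R0 -> H z <> 0%C /\ H z <> 1%C) ->
  forall z, Cmod (z - z0) <= r ->
    robinson (H z) * Cmod (Cd H z) * (r ^ 2 - Cmod (z - z0) ^ 2) <= 108 * r.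
Proof.
  intros Hr HH Hn.
  set (v := fun z => robinson (H z) * Cmod (Cd H z) * (r ^ 2 - Cmod (z - z0) ^ 2)).
  assert (Hn1 : forall z, Cmod (z - z0) < R0 -> (H z - 1)%C <> 0%C).
  { intros z Hz. apply Cmod_sub_neq0, Cmod_sub_pos, Hn; auto. }
  assert (HD : HolD (Cd H) z0 R0) by (apply HolD_Cd; auto).
  assert (HH1 : HolD (fun z => H z - 1)%C z0 R0).
  { intros z Hz. apply Hol_minus; auto. apply Hol_const. }
  destruct (closed_disc_max v z0 r) as (zs & Hzs & Hmax); [lra| |].
  { intros z Hz. unfold v. apply rfcont_mult; [apply rfcont_mult|].
    - unfold robinson.
      assert (K : forall g, Ccont g z -> g z <> 0%C -> rfcont (fun w => rob (ln (Cmod (g w) ^ 2))) z).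
      { intros g Hg Hgn. apply (rfcont_comp (fun w => Cmod (g w)) (fun x => rob (ln (x ^ 2)))); [apply rfcont_Cmod; auto|].
        apply Cmod_gt_0 in Hgn. apply derivable_continuous_pt, ex_derive_Reals_0.
        apply (ex_derive_comp rob (fun x => ln (x ^ 2))); [eexists; apply is_derive_rob|].
        auto_derive. nra. }
      apply (rfcont_comp (fun w => rob (ln (Cmod (H w) ^ 2)) + rob (ln (Cmod (H w - 1) ^ 2))) exp);
        [|apply derivable_continuous_pt, derivable_pt_exp].
      apply rfcont_plus.
      + apply K; [apply Hol_cont, HH; lra|apply Hn; lra].
      + apply (K (fun w => H w - 1)%C); [apply Hol_cont, HH1; lra|apply Hn1; lra].
    - apply rfcont_Cmod, Hol_cont, HD. lra.
    - apply (rfcont_comp (fun w => Cmod (w - z0)) (fun x => r ^ 2 - x ^ 2)).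
      + apply rfcont_Cmod, Ccont_minus; [apply Ccont_id|apply Ccont_const].
      + apply derivable_continuous_pt, ex_derive_Reals_0. auto_derive; auto. }
  enough (Hvs : v zs <= 108 * r) by (intros z Hz; specialize (Hmax z Hz); unfold v in *; lra).
  (* A positive maximum forces [Cd H] and the weight to be nonzero at [zs]: the point is interior,
     and the logarithm of [v] is defined near it. *)
  destruct (Rle_dec (v zs) 0) as [h|h]; [lra|]. apply Rnot_le_lt in h.
  assert (Hrob : forall w, 0 < robinson w) by (intros; apply exp_pos).
  assert (Hfac : Cd H zs <> 0%C /\ 0 < r ^ 2 - Cmod (zs - z0) ^ 2).
  { unfold v in h. pose proof (Hrob (H zs)). pose proof (Cmod_ge_0 (Cd H zs)) as C0.
    assert (P0 : 0 <= r ^ 2 - Cmod (zs - z0) ^ 2) by (pose proof (Cmod_ge_0 (zs - z0)); nra).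
    split.
    - intros E. rewrite E, Cmod_0, Rmult_0_r, Rmult_0_l in h. lra.
    - destruct P0 as [|P0]; auto. rewrite <- P0, Rmult_0_r in h. lra. }
  destruct Hfac as [Hd0 HP0].
  assert (Hin : Cmod (zs - z0) < r) by (pose proof (Cmod_ge_0 (zs - z0)); nra).
  destruct (Ccont_away (Cd H) zs) as (d1 & Hd1 & Haw); auto; [apply Hol_cont, HD; lra|].
  set (d := Rmin d1 (r - Cmod (zs - z0))).
  assert (Hd : 0 < d) by (apply Rmin_glb_lt; lra).
  assert (Hsub : forall w, Cmod (w - zs) < d -> Cmod (w - z0) < r).
  { intros w Hw. pose proof (Cmod_triangle_sub w zs z0). unfold d in Hw. apply Rmin_Rgt_l in Hw. lra. }
  assert (Hnz : forall w, Cmod (w - zs) < d -> H w <> 0%C /\ (H w - 1)%C <> 0%C /\ Cd H w <> 0%C).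
  { intros w Hw. pose proof (Hsub w Hw). split; [apply Hn; lra|]. split; [apply Hn1; lra|].
    apply Cmod_gt_0 in Hd0. apply Cmod_gt_0. unfold d in Hw. apply Rmin_Rgt_l in Hw as [Hw _].
    specialize (Haw w Hw). lra. }
  set (L := fun w => rob (lnmod2 H w) + rob (lnmod2 (fun z => H z - 1)%C w) + lnmod2 (Cd H) w / 2 + ln (r ^ 2 - Cmod (w - z0) ^ 2)).
  assert (HPw : forall w, Cmod (w - zs) < d -> 0 < r ^ 2 - Cmod (w - z0) ^ 2).
  { intros w Hw. pose proof (Hsub w Hw). pose proof (Cmod_ge_0 (w - z0)). nra. }
  assert (EL : forall w, Cmod (w - zs) < d -> exp (L w) = v w).
  { intros w Hw. unfold L, v, robinson, lnmod2. rewrite !exp_plus, (exp_ln (_ - _)) by auto.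
    f_equal. f_equal. destruct (Hnz w Hw) as (_ & _ & N). apply Cmod_gt_0 in N.
    rewrite <- (exp_ln (Cmod (Cd H w))) at 2 by auto. f_equal. simpl. rewrite Rmult_1_r, ln_mult by auto. field. }
  assert (Hline : forall e x, Cmod e = 1 -> Rabs x < d -> Cmod (line zs e x - zs) < d).
  { intros e x He Hx. unfold line. replace (zs + RtoC x * e - zs)%C with (RtoC x * e)%C by ring.
    rewrite Cmod_mult, Cmod_R, He. lra. }
  assert (HLm : forall e x, Cmod e = 1 -> Rabs x < d -> L (line zs e x) <= L zs).
  { intros e x He Hx. specialize (Hline e x He Hx). apply Rnot_lt_le. intros K. apply exp_increasing in K.
    rewrite !EL in K; auto; [|rewrite Cmod_refl; auto]. specialize (Hmax (line zs e x)).
    pose proof (Hsub _ Hline). lra. }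
  assert (Dir : forall e, Cmod e = 1 -> _) by
    (exact (fun e He => max_direction H (fun z => H z - 1)%C (Cd H) z0 zs e r d He Hd
      (fun w Hw => HH w ltac:(pose proof (Hsub w Hw); lra))
      (fun w Hw => HH1 w ltac:(pose proof (Hsub w Hw); lra))
      (fun w Hw => HD w ltac:(pose proof (Hsub w Hw); lra))
      Hnz (fun x Hx => HPw _ (Hline e x He Hx)) (fun x Hx => HLm e x He Hx))).
  (* The sum of these two is the inequality for the Laplacian. Squared gradients add up to
     [4 |logder|^2] ([Hq]), harmonic parts cancel ([Hq2]), and the weight contributes
     [- 4 r^2 / P0^2] (by [Hb]). *)
  pose proof (Dir 1%C Cmod_1) as D1. pose proof (Dir Ci Cmod_Ci) as D2. clear Dir.
  set (f1 := fun z => (H z - 1)%C) in *.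
  set (P0 := r ^ 2 - Cmod (zs - z0) ^ 2) in *. cbv beta zeta in D1, D2.
  assert (Eld1 : logder f1 zs = (Cd H zs / f1 zs)%C).
  { unfold logder. f_equal. apply Cd_eq. eapply cder_eq.
    - apply (cder_plus H (fun _ => (- (1))%C)); [apply Cd_cder, HH; lra|apply cder_const].
    - ring. }
  assert (Hq : forall f, (2 * Re (1 * logder f zs)) ^ 2 + (2 * Re (Ci * logder f zs)) ^ 2 = 4 * Cmod (logder f zs) ^ 2).
  { intros f. rewrite Cmod2_alt. destruct (logder f zs) as [x y]; simpl. ring. }
  assert (Hq2 : forall f, 2 * Re (1 * (1 * Cd (logder f) zs)) + 2 * Re (Ci * (Ci * Cd (logder f) zs)) = 0).
  { intros f. destruct (Cd (logder f) zs) as [x y]; simpl. ring. }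
  assert (Hb : Re (Cconj 1 * (zs - z0)) ^ 2 + Re (Cconj Ci * (zs - z0)) ^ 2 = Cmod (zs - z0) ^ 2).
  { rewrite Cmod2_alt. destruct zs as [x y], z0 as [x' y']; simpl. ring. }
  set (D := Cmod (Cd H zs) ^ 2).
  set (a := exp (lnmod2 H zs / 6)). set (b := exp (lnmod2 f1 zs / 6)).
  assert (Ha : 0 < a) by apply exp_pos. assert (Hb0 : 0 < b) by apply exp_pos.
  destruct (Hnz zs ltac:(rewrite Cmod_refl; auto)) as (Nz1 & Nz2 & Nz3).
  assert (Ea : a ^ 3 = Cmod (H zs)) by (apply exp_cube_lnmod2; auto).
  assert (Eb : b ^ 3 = Cmod (f1 zs)) by (apply exp_cube_lnmod2; auto).
  (* [1 / 18] is the [1 / 72] of [rob2] times the 4 of the squared gradient; the numerator [a] of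
     [rob2] against [|H|^2 = a^6] leaves [a^5], and likewise for [b]. *)
  assert (Key : 1 / 18 * (D * (b ^ 5 / (1 + a) ^ 2 + a ^ 5 / (1 + b) ^ 2) / (a ^ 5 * b ^ 5)) <= 4 * r ^ 2 / P0 ^ 2).
  { assert (S : rob2 (lnmod2 H zs) * (4 * Cmod (logder H zs) ^ 2) + rob2 (lnmod2 f1 zs) * (4 * Cmod (logder f1 zs) ^ 2)
      <= 4 * r ^ 2 / P0 ^ 2).
    { rewrite <- !Hq.
      replace (4 * r ^ 2 / P0 ^ 2) with ((4 * P0 + 4 * (Re (Cconj 1 * (zs - z0)) ^ 2 + Re (Cconj Ci * (zs - z0)) ^ 2)) / P0 ^ 2)
        by (rewrite Hb; unfold P0 at 1; field; lra).
      pose proof (Hq2 H) as X1. pose proof (Hq2 f1) as X2. pose proof (Hq2 (Cd H)) as X3.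
      set (A1 := rob1 (lnmod2 H zs)) in *. set (A2 := rob1 (lnmod2 f1 zs)) in *.
      set (b1 := Re (Cconj 1 * (zs - z0))) in *. set (b2 := Re (Cconj Ci * (zs - z0))) in *.
      assert (Y1 : A1 * (2 * Re (1 * (1 * Cd (logder H) zs))) + A1 * (2 * Re (Ci * (Ci * Cd (logder H) zs))) = 0)
        by (rewrite <- Rmult_plus_distr_l, X1; ring).
      assert (Y2 : A2 * (2 * Re (1 * (1 * Cd (logder f1) zs))) + A2 * (2 * Re (Ci * (Ci * Cd (logder f1) zs))) = 0)
        by (rewrite <- Rmult_plus_distr_l, X2; ring).
      replace ((4 * P0 + 4 * (b1 ^ 2 + b2 ^ 2)) / P0 ^ 2) with
        (- ((-2 * P0 - 4 * b1 ^ 2) / P0 ^ 2) - ((-2 * P0 - 4 * b2 ^ 2) / P0 ^ 2)) by (field; lra).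
      clear - D1 D2 X3 Y1 Y2.
      generalize dependent ((-2 * P0 - 4 * b1 ^ 2) / P0 ^ 2). generalize dependent ((-2 * P0 - 4 * b2 ^ 2) / P0 ^ 2).
      intros u1 D2 u2 D1. lra. }
    eapply Rle_trans; [|exact S]. right. rewrite Eld1. unfold logder. rewrite !Cmod_div by auto.
    rewrite <- Ea, <- Eb. unfold rob2. fold a b. unfold D. field. repeat split; lra. }
  assert (Hab1 : 1 <= a ^ 3 + b ^ 3).
  { rewrite Ea, Eb. unfold f1. pose proof (Cmod_sub_le (H zs) (H zs - 1)) as T.
    replace (H zs - (H zs - 1))%C with (RtoC 1) in T by ring. rewrite Cmod_1 in T. exact T. }
  pose proof (pow5_ineq a b Ha Hb0 Hab1) as HP5.
  (* The constant: [162 * 18 * 4 = 108^2]. *)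
  assert (Hv2 : v zs ^ 2 <= (108 * r) ^ 2).
  { unfold v. fold P0. rewrite !Rpow_mult_distr, robinson_sq.
    change (exp (ln (Cmod (H zs) ^ 2) / 6)) with a. change (exp (ln (Cmod (H zs - 1) ^ 2) / 6)) with b. fold D.
    assert (HD0 : 0 <= D) by (unfold D; apply pow2_ge_0).
    assert (Hab5 : 0 < a ^ 5 * b ^ 5) by (apply Rmult_lt_0_compat; apply pow_lt; auto).
    assert (HPP : 0 < P0 ^ 2) by (apply pow_lt; auto).
    assert (Step : (1 + a) * (1 + b) / (a ^ 5 * b ^ 5) * D <= 162 * (D * (b ^ 5 / (1 + a) ^ 2 + a ^ 5 / (1 + b) ^ 2) / (a ^ 5 * b ^ 5))).
    { set (Q := b ^ 5 / (1 + a) ^ 2 + a ^ 5 / (1 + b) ^ 2) in *.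
      replace (162 * (D * Q / (a ^ 5 * b ^ 5))) with ((162 * Q) / (a ^ 5 * b ^ 5) * D) by (field; lra).
      apply Rmult_le_compat_r; auto. apply Rmult_le_compat_r; auto. left; apply Rinv_0_lt_compat; auto. }
    assert (Step2 : (1 + a) * (1 + b) / (a ^ 5 * b ^ 5) * D <= 162 * 18 * (4 * r ^ 2 / P0 ^ 2)) by lra.
    apply (Rmult_le_compat_r (P0 ^ 2)) in Step2; [|lra].
    eapply Rle_trans; [exact Step2|]. right. field. lra. }
  apply Rnot_lt_le. intros K. apply (Rlt_irrefl ((108 * r) ^ 2)).
  eapply Rlt_le_trans; [|exact Hv2]. simpl. nra.
Qed.

(** * Functions omitting 0 and 1 in a punctured disc *)

(** Comparison with the spherical density, which turns Ahlfors' estimate into one for the spherical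
    derivative. It follows from [x^5 <= (1 + x^3)^2], applied to the cube roots of [|w|] and
    [|w - 1|]. *)
Lemma robinson_ge (w : C) : w <> 0%C -> w <> 1%C -> / (4 * (1 + Cmod w ^ 2)) <= robinson w.
Proof.
  intros H0 H1. assert (H1' : (w - 1)%C <> 0%C) by (apply Cmod_sub_neq0, Cmod_sub_pos; auto).
  pose proof (robinson_sq w) as E. cbv zeta in E.
  pose proof (exp_cube_lnmod2 w H0) as Ea. pose proof (exp_cube_lnmod2 _ H1') as Eb.
  set (a := exp (ln (Cmod w ^ 2) / 6)) in *. set (b := exp (ln (Cmod (w - 1) ^ 2) / 6)) in *.
  assert (Ha : 0 < a) by apply exp_pos. assert (Hb : 0 < b) by apply exp_pos.
  assert (B : Cmod (w - 1) <= 1 + Cmod w) by (pose proof (Cmod_sub_le w 1); rewrite Cmod_1 in *; lra).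
  set (A := Cmod w) in *. assert (HA : 0 <= A) by apply Cmod_ge_0.
  assert (P5 : forall x, 0 < x -> x ^ 5 <= (1 + x ^ 3) ^ 2).
  { intros x Hx. replace ((1 + x ^ 3) ^ 2) with (1 + 2 * x ^ 3 + x ^ 5 * x) by ring.
    assert (0 < x ^ 3) by (apply pow_lt; auto). destruct (Rle_dec x 1) as [L|L].
    - assert (x ^ 5 <= 1 ^ 5) by (apply pow_incr; lra). rewrite pow1 in H2.
      assert (0 <= x ^ 5 * x) by (apply Rmult_le_pos; [apply pow_le|]; lra). lra.
    - assert (0 < x ^ 5) by (apply pow_lt; auto). nra. }
  pose proof (P5 a Ha) as Pa. pose proof (P5 b Hb) as Pb. rewrite Ea in Pa. rewrite Eb in Pb.
  assert (Pb2 : b ^ 5 <= (2 * (1 + A)) ^ 2).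
  { eapply Rle_trans; [exact Pb|]. apply pow_incr. pose proof (Cmod_ge_0 (w - 1)). lra. }
  set (u := 2 * (1 + A) ^ 2). assert (Hu : 0 < u) by (unfold u; nra).
  assert (Ha5 : 0 < a ^ 5) by (apply pow_lt; auto). assert (Hb5 : 0 < b ^ 5) by (apply pow_lt; auto).
  assert (Hr : 0 < robinson w) by apply exp_pos.
  assert (Hsq : (/ u) ^ 2 <= robinson w ^ 2).
  { rewrite E. rewrite pow_inv. apply Rle_trans with (/ (a ^ 5 * b ^ 5)).
    - apply Rinv_le_contravar; [apply Rmult_lt_0_compat; auto|].
      replace (u ^ 2) with ((1 + A) ^ 2 * (2 * (1 + A)) ^ 2) by (unfold u; ring).
      apply Rmult_le_compat; lra.
    - unfold Rdiv. rewrite <- (Rmult_1_l (/ (a ^ 5 * b ^ 5))) at 1.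
      apply Rmult_le_compat_r; [left; apply Rinv_0_lt_compat, Rmult_lt_0_compat; auto|]. nra. }
  assert (Hui : / u <= robinson w).
  { apply Rnot_lt_le. intros K. assert (0 < / u) by (apply Rinv_0_lt_compat; auto). nra. }
  eapply Rle_trans; [|exact Hui]. apply Rinv_le_contravar; auto. unfold u. pose proof (pow2_ge_0 (A - 1)). lra.
Qed.

(** Half of [1 - sphZ] at the point [H z] of the sphere: a spherical coordinate that tells small
    values of [|H|] from large ones. *)
Definition height (H : C -> C) (z : C) : R := / (1 + Cmod (H z) ^ 2).

(** The exact derivative has modulus at most [2 |w| |l| / (1 + |w|^2)^2], and
    [2 |w| <= 1 + |w|^2]. *)
Lemma height_derivative (H : C -> C) (z e l : C) (x : R) : Cmod e = 1 -> cder H (line z e x) l ->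
  exists m, is_derive (fun s => height H (line z e s)) x m /\ Rabs m <= Cmod l / (1 + Cmod (H (line z e x)) ^ 2).
Proof.
  intros He HD. destruct (is_derive_line H z e l x He HD) as [D1 D2].
  set (w := H (line z e x)) in *.
  assert (E2 : Re w * Re w + Im w * Im w = Cmod w ^ 2) by (rewrite Cmod2_alt; ring).
  pose proof (Cmod_ge_0 w) as Hw0.
  set (n := 2 * (Re w * Re (e * l) + Im w * Im (e * l))).
  exists (- n / (1 + Cmod w ^ 2) ^ 2). split.
  - apply (is_derive_ext (fun s => / (1 + (Re (H (line z e s)) * Re (H (line z e s)) + Im (H (line z e s)) * Im (H (line z e s)))))).
    { intros s. unfold height. rewrite Cmod2_alt. change (/ (1 + (Re (H (line z e s)) * Re (H (line z e s)) + Im (H (line z e s)) * Im (H (line z e s)))) = / (1 + (Re (H (line z e s)) ^ 2 + Im (H (line z e s)) ^ 2))).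
      f_equal. ring. }
    rewrite <- E2.
    apply (is_derive_inv (fun s => 1 + (Re (H (line z e s)) * Re (H (line z e s)) + Im (H (line z e s)) * Im (H (line z e s))))).
    + replace n with (plus 0 (plus (plus (mult (Re (e * l)) (Re w)) (mult (Re w) (Re (e * l)))) (plus (mult (Im (e * l)) (Im w)) (mult (Im w) (Im (e * l))))))
        by (unfold n, plus, mult; simpl; ring).
      apply (is_derive_plus (fun _ => 1)); [apply (is_derive_const 1)|].
      apply (is_derive_plus (fun s => Re (H (line z e s)) * Re (H (line z e s)))).
      * apply (is_derive_mult (fun s => Re (H (line z e s))) (fun s => Re (H (line z e s)))); auto. intros; apply Rmult_comm.
      * apply (is_derive_mult (fun s => Im (H (line z e s))) (fun s => Im (H (line z e s)))); auto. intros; apply Rmult_comm.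
    + fold w. rewrite E2. nra.
  - assert (Hn : Rabs n <= 2 * (Cmod w * Cmod l)).
    { unfold n. rewrite Rabs_mult, (Rabs_pos_eq 2) by lra. apply Rmult_le_compat_l; [lra|].
      replace (Re w * Re (e * l) + Im w * Im (e * l)) with (Re (Cconj w * (e * l)))
        by (destruct w, e, l; simpl; ring).
      eapply Rle_trans; [apply re_le_Cmod|]. rewrite !Cmod_mult, Cmod_conj, He. lra. }
    set (q := 1 + Cmod w ^ 2). assert (Hq : 0 < q) by (unfold q; nra).
    unfold Rdiv. rewrite Rabs_mult, Rabs_Ropp, (Rabs_pos_eq (/ q ^ 2)) by (left; apply Rinv_0_lt_compat, pow_lt; auto).
    replace (Cmod l * / q) with (Cmod l * q * / q ^ 2) by (field; lra).
    apply Rmult_le_compat_r; [left; apply Rinv_0_lt_compat, pow_lt; auto|].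
    eapply Rle_trans; [exact Hn|]. unfold q. pose proof (Cmod_ge_0 l).
    assert (2 * Cmod w <= 1 + Cmod w ^ 2) by (pose proof (pow2_ge_0 (Cmod w - 1)); lra). nra.
Qed.

(** Within [r / 2] of the centre the weight is at least [3 r^2 / 4], and the density at least a
    quarter of the spherical one. Ahlfors' bound [108 r] thus becomes
    [108 * 16 / 3 / r = 576 / r]. *)
Lemma height_oscillation (H : C -> C) (z0 e : C) (R0 r y : R) : Cmod e = 1 -> 0 < r < R0 -> HolD H z0 R0 ->
  (forall z, Cmod (z - z0) < R0 -> H z <> 0%C /\ H z <> 1%C) -> Rabs y <= r / 2 ->
  Rabs (height H (line z0 e y) - height H z0) <= 576 / r * Rabs y.
Proof.
  intros He Hr HH Hn Hy.
  assert (Hl : forall x, Cmod (line z0 e x - z0) = Rabs x).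
  { intros x. unfold line. replace (z0 + RtoC x * e - z0)%C with (RtoC x * e)%C by ring.
    rewrite Cmod_mult, Cmod_R, He. ring. }
  pose proof (bounded_variation (fun x => height H (line z0 e x)) (Derive (fun x => height H (line z0 e x))) (576 / r) 0 y) as BV.
  cbv beta in BV. rewrite line_0, Rminus_0_r in BV. apply BV. clear BV.
  intros t Ht. rewrite !Rminus_0_r in Ht.
  assert (Hin : Cmod (line z0 e t - z0) < R0) by (rewrite Hl; lra).
  destruct (height_derivative H z0 e (Cd H (line z0 e t)) t He (Cd_cder _ _ (HH _ Hin))) as (m & Dm & Bm).
  assert (Em : Derive (fun x => height H (line z0 e x)) t = m) by (apply is_derive_unique; exact Dm).
  rewrite Em. split; [exact Dm|].
  eapply Rle_trans; [exact Bm|].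
  destruct (Hn _ Hin) as [N0 N1].
  pose proof (ahlfors_robinson H z0 R0 r Hr HH Hn (line z0 e t) ltac:(rewrite Hl; lra)) as A.
  rewrite Hl in A.
  set (w := H (line z0 e t)) in *. set (l := Cmod (Cd H (line z0 e t))) in *.
  assert (Hl0 : 0 <= l) by apply Cmod_ge_0.
  pose proof (robinson_ge w N0 N1) as G. set (q := 1 + Cmod w ^ 2) in *.
  assert (Hq : 0 < q) by (unfold q; pose proof (Cmod_ge_0 w); nra).
  assert (Hrt : 3 / 4 * r ^ 2 <= r ^ 2 - Rabs t ^ 2).
  { assert (Rabs t ^ 2 <= (r / 2) ^ 2) by (apply pow_incr; split; [apply Rabs_pos|lra]). lra. }
  assert (L1 : / (4 * q) * l * (3 / 4 * r ^ 2) <= 108 * r).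
  { eapply Rle_trans; [|exact A]. assert (0 < / (4 * q)) by (apply Rinv_0_lt_compat; lra).
    apply Rmult_le_compat; [nra|nra|apply Rmult_le_compat_r; auto|auto]. }
  replace (/ (4 * q) * l * (3 / 4 * r ^ 2)) with ((l / q) * (3 / 16 * r ^ 2)) in L1 by (field; lra).
  apply Rmult_le_reg_r with (3 / 16 * r ^ 2); [nra|].
  eapply Rle_trans; [exact L1|]. right. field. lra.
Qed.

(* Pulled back by the exponential map, a punctured disc becomes a half plane, in which the
   circle of radius [exp (-40000) R0] lies deep inside and is short. *)
Lemma annulus_dichotomy (H : C -> C) (z0 : C) (R0 : R) : 0 < R0 ->
  (forall z, 0 < Cmod (z - z0) < R0 -> Hol H z /\ H z <> 0%C /\ H z <> 1%C) ->
  (forall z, Cmod (z - z0) = exp (-40000) * R0 -> Cmod (H z) <= 2) \/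
  (forall z, Cmod (z - z0) = exp (-40000) * R0 -> 1 <= Cmod (H z)).
Proof.
  intros HR HH. set (s := exp (-40000) * R0).
  assert (Hs : 0 < s) by (apply Rmult_lt_0_compat; auto; apply exp_pos).
  assert (Els : ln s = ln R0 - 40000).
  { unfold s. rewrite ln_mult, ln_exp by (auto; apply exp_pos). ring. }
  set (F := fun z => H (z0 + cexp z)%C). set (c := (ln s, 0) : C).
  assert (Hpt : forall z, Cmod (z - c) < 40000 -> 0 < Cmod (z0 + cexp z - z0) < R0).
  { intros z Hz. replace (z0 + cexp z - z0)%C with (cexp z) by ring. rewrite Cmod_cexp. split; [apply exp_pos|].
    rewrite <- (exp_ln R0) by auto. apply exp_increasing.
    pose proof (re_le_Cmod (z - c)) as Hre. unfold c in Hre at 1. destruct z as [x y]; simpl in Hre |- *.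
    assert (x + - ln s < 40000) by (eapply Rle_lt_trans; [apply Rle_abs|]; lra). lra. }
  assert (HF : HolD F c 40000).
  { intros z Hz. apply (Hol_comp H (fun z => z0 + cexp z)%C).
    - apply Hol_plus; [apply Hol_const|apply Hol_cexp].
    - apply HH. auto. }
  assert (HFn : forall z, Cmod (z - c) < 40000 -> F z <> 0%C /\ F z <> 1%C).
  { intros z Hz. apply HH. auto. }
  (* The circle is the image of the vertical segment of points [c + Ci a] with [|a| <= PI <= 4].
     Radius 20000 gives an oscillation of at most [576 / 20000 * 4 = 0.1152]. *)
  assert (Hosc : forall z, Cmod (z - z0) = s -> Rabs (height H z - height F c) <= 12 / 100).
  { intros z Hz. destruct (polar_form (z - z0)) as (a & Ha & Hp). pose proof PI_4 as HPI.
    rewrite Hz in Hp.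
    assert (Ez : z = (z0 + cexp (line c Ci a))%C).
    { replace z with (z0 + (z - z0))%C by ring. f_equal. rewrite Hp. unfold cexp, line, c. simpl.
      replace (ln s + (a * 0 - 0 * 1)) with (ln s) by ring. replace (0 + (a * 1 + 0 * 0)) with a by ring.
      rewrite exp_ln by auto. reflexivity. }
    assert (Ra : Rabs a <= 4) by (apply Rabs_le; lra).
    pose proof (height_oscillation F c Ci 40000 20000 a Cmod_Ci ltac:(lra) HF HFn ltac:(lra)) as O.
    replace (height H z) with (height F (line c Ci a)) by (rewrite Ez; reflexivity). lra. }
  assert (Hh : forall z, height H z * (1 + Cmod (H z) ^ 2) = 1).
  { intros z. unfold height. field. pose proof (Cmod_ge_0 (H z)). nra. }
  (* The threshold lies between the heights [1/5] of [|H| = 2] and [1/2] of [|H| = 1], at distance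
     more than [0.12] from each. *)
  destruct (Rle_dec (height F c) (35 / 100)) as [L|L].
  - right. intros z Hz. specialize (Hosc z Hz). specialize (Hh z). apply Rabs_le_between in Hosc.
    pose proof (Cmod_ge_0 (H z)). apply Rnot_lt_le. intros K. nra.
  - left. intros z Hz. specialize (Hosc z Hz). specialize (Hh z). apply Rabs_le_between in Hosc.
    pose proof (Cmod_ge_0 (H z)). apply Rnot_lt_le. intros K. nra.
Qed.

(** * Meromorphic functions in homogeneous coordinates *)

(* [(N, D)] are homogeneous coordinates of the point [x] of the extended plane. *)
Definition rep (x : Cext) (N D : C) : Prop :=
  match x with
  | Some w => D <> 0%C /\ N = (w * D)%C
  | None => D = 0%C /\ N <> 0%C
  end.

(** The determinant of the standard coordinates [(w, 1)] or [(1, 0)] of [x] against [(N, D)]. *)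
Definition bracket (x : Cext) (N D : C) : C :=
  match x with Some w => (w * D - N)%C | None => D end.

Lemma Cinv_neq0 (x : C) : x <> 0%C -> (/ x)%C <> 0%C.
Proof. intros H E. apply C1_nz. rewrite <- (Cinv_r x H), E. ring. Qed.

Lemma Csub_eq0 (x y : C) : (x - y)%C = 0%C -> x = y.
Proof. intros H. replace x with (x - y + y)%C by ring. rewrite H. ring. Qed.

Lemma bracket_neq0 (x y : Cext) (N D : C) : rep y N D -> x <> y -> bracket x N D <> 0%C.
Proof.
  intros Hy Hn E. apply Hn. destruct x as [w|], y as [v|]; simpl in *; auto.
  - destruct Hy as [HD ->]. f_equal.
    assert (K : ((w - v) * D)%C = 0%C) by (rewrite <- E; ring).
    destruct (C_eq_dec (w - v)%C 0%C) as [e|n]; [apply Csub_eq0; auto|].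
    exfalso. exact (Cmult_neq_0 _ _ n HD K).
  - destruct Hy as [-> HN]. exfalso. apply HN. replace N with (- (w * 0 - N))%C by ring. rewrite E. ring.
  - tauto.
Qed.

Lemma rep_cross_neq0 (x y : Cext) (P Q N D : C) : rep x P Q -> rep y N D -> x <> y -> (P * D - Q * N)%C <> 0%C.
Proof.
  intros Hx Hy Hn. pose proof (bracket_neq0 x y N D Hy Hn) as B. destruct x as [w|]; simpl in *.
  - destruct Hx as [HQ ->]. replace (w * Q * D - Q * N)%C with (Q * (w * D - N))%C by ring. apply Cmult_neq_0; auto.
  - destruct Hx as [-> HP]. replace (P * D - 0 * N)%C with (P * D)%C by ring. apply Cmult_neq_0; auto.
Qed.

Lemma rep_eq_iff (x y : Cext) (P Q N D : C) : rep x P Q -> rep y N D -> ((P * D - Q * N)%C = 0%C <-> x = y).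
Proof.
  intros Hx Hy. split.
  - intros E. destruct (classic (x = y)) as [|n]; auto. exfalso. exact (rep_cross_neq0 _ _ _ _ _ _ Hx Hy n E).
  - intros <-. destruct x as [w|]; simpl in *.
    + destruct Hx as [_ ->], Hy as [_ ->]. ring.
    + destruct Hx as [-> _], Hy as [-> _]. ring.
Qed.

Definition local_rep (f : C -> Cext) (z0 : C) (r : R) (N D : C -> C) : Prop :=
  0 < r /\ HolD N z0 r /\ HolD D z0 r /\ forall z, Cmod (z - z0) < r -> rep (f z) (N z) (D z).

Lemma fin_Some (f : C -> Cext) (z : C) : f z <> None -> f z = Some (fin f z).
Proof. unfold fin. destruct (f z); congruence. Qed.

(** At a finite value the coordinates are [(f, 1)]. At a pole they are [(1, 1/f)], where [1/f], set
    to 0 at the pole, is continuous and hence holomorphic. Poles thereby cease to be a special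
    case. *)
Lemma meromorphic_local_rep (Om : C -> Prop) (f : C -> Cext) (z0 : C) :
  meromorphic_on Om f -> Om z0 -> exists r N D, local_rep f z0 r N D.
Proof.
  intros Hf Hz0. destruct (Hf z0 Hz0) as (r & Hr & _ & Hp & Hc).
  destruct Hc as [[Hn Hd] | [Hn Hinf]].
  - exists r, (fin f), (fun _ => 1%C).
    assert (HH : HolD (fin f) z0 r).
    { intros z Hz. apply Cdifferentiable_Hol. destruct (C_eq_dec z z0) as [->|n]; auto.
      apply Hp. split; auto. apply Cmod_sub_pos; auto. }
    repeat split; auto.
    + intros z _. apply Hol_const.
    + intros z Hz. assert (f z <> None).
      { destruct (C_eq_dec z z0) as [->|n]; auto. apply Hp. split; auto. apply Cmod_sub_pos; auto. }
      rewrite (fin_Some f z) by auto. simpl. split; [apply C1_nz|]. symmetry. apply Cmult_1_r.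
  - destruct (Hinf 1) as (d & Hd & H1). set (r' := Rmin r d).
    assert (Hr' : 0 < r') by (apply Rmin_glb_lt; auto).
    set (g := fun z => match f z with Some w => (/ w)%C | None => RtoC 0 end).
    assert (Hpn : forall z, 0 < Cmod (z - z0) < r' -> f z = Some (fin f z) /\ fin f z <> RtoC 0 /\ Hol (fin f) z).
    { intros z [Hz1 Hz2]. apply Rmin_Rgt_l in Hz2 as [Hz2 Hz3].
      destruct (Hp z (conj Hz1 Hz2)) as [K1 K2]. split; [apply fin_Some; auto|]. split.
      - apply Cmod_gt_0. specialize (H1 z (conj Hz1 Hz3)). change (1 < Cmod (fin f z)) in H1. lra.
      - apply Cdifferentiable_Hol; auto. }
    assert (Hg : forall z, 0 < Cmod (z - z0) < r' -> Hol g z).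
    { intros z Hz. apply Hol_ext_loc with (fun w => / fin f w)%C.
      - exists (Rmin (Cmod (z - z0)) (r' - Cmod (z - z0))). split; [apply Rmin_glb_lt; lra|].
        intros w Hw. apply Rmin_Rgt_l in Hw as [Hw1 Hw2].
        assert (Hw : 0 < Cmod (w - z0) < r').
        { pose proof (Cmod_triangle_sub w z z0). pose proof (Cmod_triangle_sub z w z0).
          rewrite (Cmod_minus_sym z w) in *. lra. }
        unfold g. rewrite (proj1 (Hpn w Hw)). reflexivity.
      - destruct (Hpn z Hz) as (_ & K1 & K2). apply Hol_inv; auto. }
    assert (Hgc : Ccont g z0).
    { intros eps He. destruct (Hinf (/ eps)) as (d2 & Hd2 & H2). exists (Rmin r' d2).
      split; [apply Rmin_glb_lt; auto|]. intros w Hw. apply Rmin_Rgt_l in Hw as [Hw1 Hw2].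
      destruct (C_eq_dec w z0) as [->|n]; [rewrite Cmod_refl; auto|]. apply Cmod_sub_pos in n.
      destruct (Hpn w (conj n Hw1)) as (E & K & _). specialize (H2 w (conj n Hw2)).
      change (/ eps < Cmod (fin f w)) in H2.
      unfold g. rewrite Hn, E. replace (/ fin f w - 0)%C with (/ fin f w)%C by ring.
      rewrite Cmod_inv by auto. rewrite <- (Rinv_inv eps). apply Rinv_lt_contravar; auto.
      apply Rmult_lt_0_compat; [apply Rinv_0_lt_compat; auto|apply Cmod_gt_0; auto]. }
    exists r', (fun _ => 1%C), g. repeat split; auto.
    + intros z _. apply Hol_const.
    + intros z Hz. destruct (C_eq_dec z z0) as [->|n].
      * apply removable_singularity with r'; auto.
      * apply Hg. split; auto. apply Cmod_sub_pos; auto.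
    + intros z Hz. destruct (C_eq_dec z z0) as [->|n].
      * unfold g. rewrite Hn. simpl. split; auto. apply C1_nz.
      * destruct (Hpn z (conj (Cmod_sub_pos _ _ n) Hz)) as (E & K & _). unfold g. rewrite E. simpl. split.
        -- apply Cinv_neq0; auto.
        -- rewrite Cinv_r; auto.
Qed.

(** Together with [vcoord], the coordinates of [x] scaled to have determinant 1 against [(N, D)].
    For [x = f z] and [(N, D) = (b, 1)] they are [f / (f - b)] and [1 / (f - b)], with the right
    values also where [f] is infinite. *)
Definition ucoord (x : Cext) (N D : C) : C :=
  match x with Some w => (w / (w * D - N))%C | None => (/ D)%C end.

Definition vcoord (x : Cext) (N D : C) : C :=
  match x with Some w => (/ (w * D - N))%C | None => RtoC 0 end.

Lemma rep_uvcoord (x : Cext) (N D : C) : bracket x N D <> 0%C -> rep x (ucoord x N D) (vcoord x N D).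
Proof.
  destruct x as [w|]; simpl; intros H.
  - split; [apply Cinv_neq0; auto|reflexivity].
  - split; [auto|apply Cinv_neq0; auto].
Qed.

Lemma uvcoord_normalized (x : Cext) (N D : C) : bracket x N D <> 0%C ->
  (ucoord x N D * D - vcoord x N D * N)%C = 1%C.
Proof.
  destruct x as [w|]; simpl; intros H; [|rewrite Cmult_0_l; unfold Cminus; rewrite Cinv_l by auto; ring].
  field. auto.
Qed.

Lemma uvcoord_cross (x : Cext) (N D N' D' : C) : bracket x N D <> 0%C ->
  (ucoord x N D * D' - vcoord x N D * N' = bracket x N' D' / bracket x N D)%C.
Proof. destruct x as [w|]; simpl; intros H; field; auto. Qed.

Lemma uvcoord_of_rep (x : Cext) (P Q N D : C) : rep x P Q -> bracket x N D <> 0%C ->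
  (P * D - Q * N)%C <> 0%C /\
  ucoord x N D = (P / (P * D - Q * N))%C /\ vcoord x N D = (Q / (P * D - Q * N))%C.
Proof.
  destruct x as [w|]; simpl; intros [H1 H2] H.
  - subst P. assert (E : (w * Q * D - Q * N)%C = (Q * (w * D - N))%C) by ring.
    rewrite E. split; [apply Cmult_neq_0; auto|]. split; field; auto.
  - subst Q. assert (E : (P * D - 0 * N)%C = (P * D)%C) by ring. rewrite E.
    split; [apply Cmult_neq_0; auto|]. split; field; auto.
Qed.

(** The normalized coordinates are the same for every choice of local coordinates [(P, Q)] of [f];
    these exhibit them as quotients of holomorphic functions near each point. *)
Lemma uvcoord_HolD (f : C -> Cext) (N D : C -> C) (z0 : C) (R0 : R) :
  HolD N z0 R0 -> HolD D z0 R0 ->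
  (forall z, Cmod (z - z0) < R0 -> exists r P Q, local_rep f z r P Q) ->
  (forall z, Cmod (z - z0) < R0 -> bracket (f z) (N z) (D z) <> 0%C) ->
  HolD (fun z => ucoord (f z) (N z) (D z)) z0 R0 /\ HolD (fun z => vcoord (f z) (N z) (D z)) z0 R0.
Proof.
  intros HN HD Hf Hb.
  assert (K : forall z, Cmod (z - z0) < R0 -> exists P Q d, 0 < d /\ Hol P z /\ Hol Q z /\
     forall w, Cmod (w - z) < d -> (P w * D w - Q w * N w)%C <> 0%C /\
       ucoord (f w) (N w) (D w) = (P w / (P w * D w - Q w * N w))%C /\
       vcoord (f w) (N w) (D w) = (Q w / (P w * D w - Q w * N w))%C).
  { intros z Hz. destruct (Hf z Hz) as (r & P & Q & Hr & HP & HQ & Hrep).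
    exists P, Q, (Rmin r (R0 - Cmod (z - z0))). split; [apply Rmin_glb_lt; lra|].
    split; [apply HP; rewrite Cmod_refl; auto|]. split; [apply HQ; rewrite Cmod_refl; auto|].
    intros w Hw. apply Rmin_Rgt_l in Hw as [Hw1 Hw2]. apply uvcoord_of_rep; [apply Hrep; auto|].
    apply Hb. pose proof (Cmod_triangle_sub w z z0). lra. }
  split; intros z Hz; destruct (K z Hz) as (P & Q & d & Hd & HP & HQ & E).
  - apply Hol_ext_loc with (fun w => P w / (P w * D w - Q w * N w))%C.
    + exists d. split; auto. intros w Hw. symmetry. apply E; auto.
    + apply Hol_div; auto; [|apply E; rewrite Cmod_refl; auto].
      apply Hol_minus; apply Hol_mult; auto.
  - apply Hol_ext_loc with (fun w => Q w / (P w * D w - Q w * N w))%C.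
    + exists d. split; auto. intros w Hw. symmetry. apply E; auto.
    + apply Hol_div; auto; [|apply E; rewrite Cmod_refl; auto].
      apply Hol_minus; apply Hol_mult; auto.
Qed.

Lemma sqrt_mult_Cmod (w v : C) : sqrt (1 + Cmod w ^ 2) * Cmod v = sqrt (Cmod (w * v) ^ 2 + Cmod v ^ 2).
Proof.
  rewrite <- (sqrt_pow2 (Cmod v)) at 1 by apply Cmod_ge_0.
  rewrite <- sqrt_mult by (try apply pow2_ge_0; pose proof (pow2_ge_0 (Cmod w)); lra).
  f_equal. rewrite Cmod_mult. ring.
Qed.

Lemma sqrt_pos_of (x : R) : 0 < 1 + x ^ 2.
Proof. pose proof (pow2_ge_0 x). lra. Qed.

(** The right-hand side is unchanged in value when either pair is rescaled, so it can be checked on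
    the standard coordinates. *)
Lemma chordal_rep (x y : Cext) (u v u' v' : C) : rep x u v -> rep y u' v' ->
  chordal x y = 2 * Cmod (u * v' - u' * v) /
    (sqrt (Cmod u ^ 2 + Cmod v ^ 2) * sqrt (Cmod u' ^ 2 + Cmod v' ^ 2)).
Proof.
  assert (Pos : forall w : C, 0 < sqrt (1 + Cmod w ^ 2)) by (intros; apply sqrt_lt_R0, sqrt_pos_of).
  assert (Half : forall (w u v u' : C), v <> 0%C -> u = (w * v)%C -> u' <> 0%C ->
     2 / sqrt (1 + Cmod w ^ 2) = 2 * (Cmod v * Cmod u') / (sqrt (Cmod u ^ 2 + Cmod v ^ 2) * Cmod u')).
  { intros w a b c Hb -> Hc. rewrite <- sqrt_mult_Cmod. apply Cmod_gt_0 in Hb, Hc.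
    specialize (Pos w). field. lra. }
  assert (S0 : forall a : C, sqrt (Cmod a ^ 2 + Cmod 0 ^ 2) = Cmod a).
  { intros a. rewrite Cmod_0. replace (Cmod a ^ 2 + 0 ^ 2) with (Cmod a ^ 2) by ring. apply sqrt_pow2, Cmod_ge_0. }
  destruct x as [w|], y as [w'|]; simpl rep; intros [H1 H2] [H3 H4].
  - subst u u'. rewrite <- !sqrt_mult_Cmod.
    replace (w * v * v' - w' * v' * v)%C with ((w - w') * (v * v'))%C by ring. rewrite !Cmod_mult.
    unfold chordal. change (Cnorm (Csub w w')) with (Cmod (w - w')). change (Cnorm w) with (Cmod w). change (Cnorm w') with (Cmod w').
    rewrite sqrt_mult by (left; apply sqrt_pos_of).
    apply Cmod_gt_0 in H1, H3. pose proof (Pos w). pose proof (Pos w'). field. repeat split; lra.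
  - subst v'. rewrite S0. replace (u * 0 - u' * v)%C with (- (v * u'))%C by ring.
    rewrite Cmod_opp, Cmod_mult. apply (Half w); auto.
  - subst v. rewrite S0. replace (u * v' - u' * 0)%C with (v' * u)%C by ring.
    rewrite Cmod_mult, (Rmult_comm (Cmod u)). apply (Half w'); auto.
  - subst v v'. replace (u * 0 - u' * 0)%C with (RtoC 0) by ring. rewrite Cmod_0, !Rmult_0_r.
    unfold Rdiv. rewrite Rmult_0_l. reflexivity.
Qed.

Lemma chordal_rep_lipschitz (x y : Cext) (u v u' v' : C) (B Lam nu t : R) :
  rep x u v -> rep y u' v' -> 0 < nu ->
  nu <= Cmod u ^ 2 + Cmod v ^ 2 -> nu <= Cmod u' ^ 2 + Cmod v' ^ 2 ->
  Cmod u <= B -> Cmod v <= B -> Cmod (u - u') <= Lam * t -> Cmod (v - v') <= Lam * t ->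
  chordal x y <= 4 * B * Lam / nu * t.
Proof.
  intros Hx Hy Hnu H1 H2 Hu Hv Hdu Hdv. rewrite (chordal_rep _ _ _ _ _ _ Hx Hy).
  assert (S : nu <= sqrt (Cmod u ^ 2 + Cmod v ^ 2) * sqrt (Cmod u' ^ 2 + Cmod v' ^ 2)).
  { rewrite <- (sqrt_sqrt nu) by lra.
    apply Rmult_le_compat; try apply sqrt_pos; apply sqrt_le_1_alt; auto. }
  assert (T : Cmod (u * v' - u' * v) <= 2 * (B * (Lam * t))).
  { replace (u * v' - u' * v)%C with ((u - u') * v - u * (v - v'))%C by ring.
    eapply Rle_trans; [apply Cmod_sub_le|]. rewrite !Cmod_mult.
    pose proof (Rmult_le_compat _ _ _ _ (Cmod_ge_0 (u - u')) (Cmod_ge_0 v) Hdu Hv).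
    pose proof (Rmult_le_compat _ _ _ _ (Cmod_ge_0 u) (Cmod_ge_0 (v - v')) Hu Hdv). lra. }
  replace (4 * B * Lam / nu * t) with (2 * (2 * (B * (Lam * t))) / nu) by (field; lra).
  unfold Rdiv. apply Rmult_le_compat; [pose proof (Cmod_ge_0 (u * v' - u' * v)); lra|left; apply Rinv_0_lt_compat; lra|lra|].
  apply Rinv_le_contravar; auto.
Qed.

Lemma circle_param (z z0 : C) (r : R) : Cmod (z - z0) = r -> exists t, 0 <= t <= 2 * PI /\ z = cir z0 r t.
Proof.
  intros H. destruct (polar_form (z - z0)) as (a & Ha & Hp). rewrite H in Hp.
  assert (E : z = cir z0 r a) by (unfold cir; rewrite <- Hp; ring). pose proof PI_RGT_0.
  destruct (Rle_dec 0 a) as [L|L].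
  - exists a. split; [lra|auto].
  - exists (a + 2 * PI). split; [lra|]. unfold cir. rewrite eit_2PI. exact E.
Qed.

Lemma circle_away (f : C -> C) (z0 : C) (r : R) : 0 <= r ->
  (forall z, Cmod (z - z0) = r -> Ccont f z /\ f z <> 0%C) ->
  exists m, 0 < m /\ forall z, Cmod (z - z0) = r -> m <= Cmod (f z).
Proof.
  intros Hr Hf. destruct (rcont_on_away (fun t => f (cir z0 r t)) 0 (2 * PI)) as (m & Hm & Hb).
  - pose proof PI_RGT_0; lra.
  - intros t _. apply (rcont_comp f (cir z0 r)); [apply rcont_cir|]. apply Hf, Cmod_cir; auto.
  - intros t _. apply Hf, Cmod_cir; auto.
  - exists m. split; auto. intros z Hz. destruct (circle_param z z0 r Hz) as (t & Ht & ->). auto.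
Qed.

(** Here [(u, v)] is normalized against [b], and its determinant against [a] is bounded by [M] on
    the circle. The determinant of [a] and [b] is bounded below on the circle alone, as it may
    vanish at [z0]. The maximum principle for [u] and [v], which are holomorphic on the disc,
    bridges this gap. *)
Lemma lipschitz_from_circle (f : C -> Cext) (u v Na Da Nb Db : C -> C) (z0 : C) (R0 s M K mu : R) :
  0 < s < R0 -> 0 < mu -> 0 < K -> HolD u z0 R0 -> HolD v z0 R0 ->
  (forall z, Cmod (z - z0) < R0 -> rep (f z) (u z) (v z)) ->
  (forall z, Cmod (z - z0) < R0 -> (u z * Db z - v z * Nb z)%C = 1%C) ->
  (forall z, Cmod (z - z0) < R0 -> Cmod (Na z) <= K /\ Cmod (Da z) <= K /\ Cmod (Nb z) <= K /\ Cmod (Db z) <= K) ->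
  (forall z, Cmod (z - z0) = s -> Cmod (u z * Da z - v z * Na z) <= M) ->
  (forall z, Cmod (z - z0) = s -> mu <= Cmod (Na z * Db z - Nb z * Da z)) ->
  let B := (M * K + K) / mu in
  forall z z', Cmod (z - z0) < s / 2 -> Cmod (z' - z0) < s / 2 ->
    chordal (f z) (f z') <= 4 * B * (8 * B / s) / (/ (2 * K ^ 2)) * Cmod (z - z').
Proof.
  intros Hs Hmu HK Hu Hv Hrep Hnorm HKb HM Hdel B.
  assert (Hcirc : forall z, Cmod (z - z0) = s -> Cmod (u z) <= B /\ Cmod (v z) <= B).
  { intros z Hz. specialize (HM z Hz). specialize (Hdel z Hz). specialize (Hnorm z ltac:(lra)).
    destruct (HKb z ltac:(lra)) as (K1 & K2 & K3 & K4).
    set (del := (Na z * Db z - Nb z * Da z)%C) in *. set (h := (u z * Da z - v z * Na z)%C) in *.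
    assert (Hd0 : del <> 0%C) by (apply Cmod_gt_0; lra).
    (* Cramer's rule for the two linear equations satisfied by [u z] and [v z]. *)
    assert (Eu : (u z = (Na z - h * Nb z) / del)%C).
    { replace (Na z - h * Nb z)%C with (Na z * (u z * Db z - v z * Nb z) - h * Nb z)%C by (rewrite Hnorm; ring).
      replace (Na z * (u z * Db z - v z * Nb z) - h * Nb z)%C with (u z * del)%C by (unfold h, del; ring). field; auto. }
    assert (Ev : (v z = (Da z - h * Db z) / del)%C).
    { replace (Da z - h * Db z)%C with (Da z * (u z * Db z - v z * Nb z) - h * Db z)%C by (rewrite Hnorm; ring).
      replace (Da z * (u z * Db z - v z * Nb z) - h * Db z)%C with (v z * del)%C by (unfold h, del; ring). field; auto. }
    rewrite Eu, Ev. unfold B.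
    split; apply Cmod_div_le; auto; (eapply Rle_trans; [apply Cmod_sub_le|]); rewrite Cmod_mult.
    - pose proof (Rmult_le_compat _ _ _ _ (Cmod_ge_0 h) (Cmod_ge_0 (Nb z)) HM K3). lra.
    - pose proof (Rmult_le_compat _ _ _ _ (Cmod_ge_0 h) (Cmod_ge_0 (Db z)) HM K4). lra. }
  assert (HB : forall z, Cmod (z - z0) < s -> Cmod (u z) <= B /\ Cmod (v z) <= B).
  { intros z Hz. split; [apply (max_principle u z0 z R0 s B)|apply (max_principle v z0 z R0 s B)]; auto; apply Hcirc. }
  (* The normalization keeps [(u, v)] away from [(0, 0)]: it gives [1 <= K (|u| + |v|)], and the
     square of a sum of two terms is at most twice the sum of their squares. *)
  assert (Hnu : forall z, Cmod (z - z0) < s -> / (2 * K ^ 2) <= Cmod (u z) ^ 2 + Cmod (v z) ^ 2).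
  { intros z Hz. specialize (Hnorm z ltac:(lra)). destruct (HKb z ltac:(lra)) as (_ & _ & K3 & K4).
    pose proof (Cmod_sub_le (u z * Db z) (v z * Nb z)) as T. rewrite Hnorm, Cmod_1, !Cmod_mult in T.
    pose proof (Cmod_ge_0 (u z)) as U0. pose proof (Cmod_ge_0 (v z)) as V0.
    set (p := Cmod (u z)) in *. set (q := Cmod (v z)) in *.
    assert (T2 : 1 <= K * (p + q)) by nra.
    assert (HK2 : 0 < K ^ 2) by (apply pow_lt; auto).
    assert (T3 : 1 <= K ^ 2 * (p + q) ^ 2).
    { replace (K ^ 2 * (p + q) ^ 2) with ((K * (p + q)) ^ 2) by ring. rewrite <- (pow1 2). apply pow_incr. lra. }
    assert (T4 : (p + q) ^ 2 <= 2 * (p ^ 2 + q ^ 2)) by (pose proof (pow2_ge_0 (p - q)); lra).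
    apply Rmult_le_reg_l with (2 * K ^ 2); [lra|]. rewrite Rinv_r by lra. nra. }
  intros z z' Hz Hz'. destruct (HB z ltac:(lra)) as [Bu Bv].
  apply chordal_rep_lipschitz with (u z) (v z) (u z') (v z'); auto; try (apply Hrep; lra); try (apply Hnu; lra).
  - apply Rinv_0_lt_compat. assert (0 < K ^ 2) by (apply pow_lt; auto). lra.
  - apply cauchy_lipschitz with z0 R0; auto. apply Hcirc.
  - apply cauchy_lipschitz with z0 R0; auto. apply Hcirc.
Qed.

(* [H] below is the cross ratio of [f], [a], [b], [c]. It omits 0, 1 and infinity in the
   punctured disc, so on a small circle either [H] or [1/H] is bounded; accordingly
   [f / [f,b]] and [1 / [f,b]], or the same with [a] for [b], are bounded holomorphic
   homogeneous coordinates of [f] on the whole disc. *)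
Lemma omitting_family_lipschitz (a b c : C -> Cext) (Na Da Nb Db Nc Dc : C -> C) (z0 : C) (R0 K : R) :
  0 < K -> local_rep a z0 R0 Na Da -> local_rep b z0 R0 Nb Db -> local_rep c z0 R0 Nc Dc ->
  (forall z, Cmod (z - z0) < R0 -> Cmod (Na z) <= K /\ Cmod (Da z) <= K /\ Cmod (Nb z) <= K /\ Cmod (Db z) <= K) ->
  (forall z, 0 < Cmod (z - z0) < R0 -> a z <> b z /\ c z <> a z /\ c z <> b z) ->
  exists s L, 0 < s /\ 0 <= L /\ forall f : C -> Cext,
    (forall z, Cmod (z - z0) < R0 -> exists r P Q, local_rep f z r P Q) ->
    (forall z, Cmod (z - z0) < R0 -> f z <> a z /\ f z <> b z) ->
    (forall z, 0 < Cmod (z - z0) < R0 -> f z <> c z) ->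
    forall z z', Cmod (z - z0) < s -> Cmod (z' - z0) < s -> chordal (f z) (f z') <= L * Cmod (z - z').
Proof.
  intros HK (HR & HNa & HDa & Ra) (_ & HNb & HDb & Rb) (_ & HNc & HDc & Rc) HKb Hdis.
  set (s := exp (-40000) * R0).
  assert (Hs : 0 < s < R0).
  { pose proof (exp_pos (-40000)). assert (exp (-40000) < 1) by (rewrite <- exp_0; apply exp_increasing; lra).
    unfold s. split; [apply Rmult_lt_0_compat; auto|]. nra. }
  assert (Hcr : forall (x y : C -> Cext) N D N' D', HolD N z0 R0 -> HolD D z0 R0 -> HolD N' z0 R0 -> HolD D' z0 R0 ->
     (forall z, Cmod (z - z0) < R0 -> rep (x z) (N z) (D z)) -> (forall z, Cmod (z - z0) < R0 -> rep (y z) (N' z) (D' z)) ->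
     (forall z, 0 < Cmod (z - z0) < R0 -> x z <> y z) ->
     exists m, 0 < m /\ forall z, Cmod (z - z0) = s -> m <= Cmod (N z * D' z - N' z * D z)).
  { intros x y N D N' D' h1 h2 h3 h4 h5 h6 h7. apply circle_away; [lra|]. intros z Hz. split.
    - apply Hol_cont, Hol_minus; apply Hol_mult; first [apply h1|apply h2|apply h3|apply h4]; lra.
    - rewrite (Cmult_comm (N' z)). apply rep_cross_neq0 with (x z) (y z); [apply h5|apply h6|apply h7]; lra. }
  destruct (Hcr a b Na Da Nb Db) as (m1 & Hm1 & B1); auto; [apply Hdis|].
  destruct (Hcr c a Nc Dc Na Da) as (m2 & Hm2 & B2); auto; [apply Hdis|].
  destruct (Hcr c b Nc Dc Nb Db) as (m3 & Hm3 & B3); auto; [apply Hdis|].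
  assert (Hup : forall N D, HolD N z0 R0 -> HolD D z0 R0 -> exists T, 0 <= T /\ forall z, Cmod (z - z0) = s -> Cmod (Nc z * D z - N z * Dc z) <= T).
  { intros N D HN HD.
    destruct (rcont_on_bounded (fun t => (fun z => Nc z * D z - N z * Dc z)%C (cir z0 s t)) 0 (2 * PI)) as (T & HT0 & HT).
    - pose proof PI_RGT_0; lra.
    - intros t _. apply (rcont_comp (fun z => Nc z * D z - N z * Dc z)%C (cir z0 s)); [apply rcont_cir|].
      apply Hol_cont, Hol_minus; apply Hol_mult; first [apply HNc|apply HDc|apply HN|apply HD]; rewrite Cmod_cir; lra.
    - exists T. split; auto. intros z Hz. destruct (circle_param z z0 s Hz) as (t & Ht & ->). auto. }
  destruct (Hup Na Da HNa HDa) as (T2 & HT2 & U2). destruct (Hup Nb Db HNb HDb) as (T3 & HT3 & U3).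
  (* One constant for both cases: [h = H ka / kb] with [|H| <= 2], or [1 / h = (1 / H) (kb / ka)]
     with [|1 / H| <= 1]. *)
  set (M := 2 * T2 / m3 + T3 / m2).
  assert (HM1 : 0 <= T2 / m3) by (apply Rdiv_le_0_compat; auto).
  assert (HM2 : 0 <= T3 / m2) by (apply Rdiv_le_0_compat; auto).
  set (B := (M * K + K) / m1).
  set (L := 4 * B * (8 * B / s) / (/ (2 * K ^ 2))).
  assert (HB : 0 <= B) by (unfold B, M; apply Rdiv_le_0_compat; auto; nra).
  exists (s / 2), L. split; [lra|]. split.
  { unfold L. assert (0 < K ^ 2) by (apply pow_lt; auto).
    apply Rdiv_le_0_compat; [|apply Rinv_0_lt_compat; lra].
    apply Rmult_le_pos; [lra|]. apply Rdiv_le_0_compat; lra. }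
  intros f Hf Hab Hc.
  assert (Ba : forall z, Cmod (z - z0) < R0 -> bracket (f z) (Na z) (Da z) <> 0%C).
  { intros z Hz. apply bracket_neq0 with (a z); [apply Ra; auto|apply Hab; auto]. }
  assert (Bb : forall z, Cmod (z - z0) < R0 -> bracket (f z) (Nb z) (Db z) <> 0%C).
  { intros z Hz. apply bracket_neq0 with (b z); [apply Rb; auto|apply Hab; auto]. }
  destruct (uvcoord_HolD f Na Da z0 R0 HNa HDa Hf Ba) as [Hua Hva].
  destruct (uvcoord_HolD f Nb Db z0 R0 HNb HDb Hf Bb) as [Hub Hvb].
  set (u := fun z => ucoord (f z) (Nb z) (Db z)) in *. set (v := fun z => vcoord (f z) (Nb z) (Db z)) in *.
  set (u' := fun z => ucoord (f z) (Na z) (Da z)) in *. set (v' := fun z => vcoord (f z) (Na z) (Da z)) in *.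
  (* [h] is [(f - a) / (f - b)] in homogeneous form. It is holomorphic and free of zeros on the
     whole disc; only the factor [kb / ka] of the cross ratio can degenerate at [z0]. *)
  set (h := fun z => (u z * Da z - v z * Na z)%C).
  set (ka := fun z => (Nc z * Da z - Na z * Dc z)%C). set (kb := fun z => (Nc z * Db z - Nb z * Dc z)%C).
  assert (Hka : forall z, 0 < Cmod (z - z0) < R0 -> ka z <> 0%C).
  { intros z Hz. unfold ka. rewrite (Cmult_comm (Na z)). apply rep_cross_neq0 with (c z) (a z); [apply Rc|apply Ra|apply Hdis]; lra. }
  assert (Hkb : forall z, 0 < Cmod (z - z0) < R0 -> kb z <> 0%C).
  { intros z Hz. unfold kb. rewrite (Cmult_comm (Nb z)). apply rep_cross_neq0 with (c z) (b z); [apply Rc|apply Rb|apply Hdis]; lra. }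
  assert (Hh : forall z, Cmod (z - z0) < R0 -> h z = (bracket (f z) (Na z) (Da z) / bracket (f z) (Nb z) (Db z))%C).
  { intros z Hz. apply uvcoord_cross. auto. }
  assert (Hh0 : forall z, Cmod (z - z0) < R0 -> h z <> 0%C).
  { intros z Hz. rewrite Hh by auto. apply Cmult_neq_0; [auto|apply Cinv_neq0; auto]. }
  assert (Hnb : forall z, Cmod (z - z0) < R0 -> (u z * Db z - v z * Nb z)%C = 1%C) by (intros z Hz; apply uvcoord_normalized; auto).
  destruct (annulus_dichotomy (fun z => h z * kb z / ka z)%C z0 R0 HR) as [Hd|Hd].
  { intros z Hz. split; [|split].
    - apply Hol_div; auto. 2: apply Hol_minus; apply Hol_mult; first [apply HNc|apply HDc|apply HNa|apply HDa]; lra.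
      apply Hol_mult; apply Hol_minus; apply Hol_mult;
        first [apply HNc|apply HDc|apply HNa|apply HDa|apply HNb|apply HDb|apply Hub|apply Hvb]; lra.
    - apply Cmult_neq_0; [apply Cmult_neq_0; auto; apply Hh0; lra|apply Cinv_neq0; auto].
    - intros E. specialize (Hka z Hz).
      assert (E1 : (h z * kb z)%C = ka z).
      { replace (h z * kb z)%C with (h z * kb z / ka z * ka z)%C by (field; auto). rewrite E. ring. }
      specialize (Hnb z ltac:(lra)).
      (* The Pluecker relation among the determinants of [f], [a], [b], [c]: a cross ratio equal to
         1 would force [f = c] or [a = b]. *)
      assert (E2 : ((u z * Dc z - v z * Nc z) * (Na z * Db z - Nb z * Da z) = 0)%C).
      { transitivity (h z * kb z - ka z * (u z * Db z - v z * Nb z))%C; [unfold ka, kb, h; ring|].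
        rewrite Hnb, E1. ring. }
      revert E2. apply Cmult_neq_0.
      + unfold u, v. rewrite uvcoord_cross by (apply Bb; lra).
        apply Cmult_neq_0; [|apply Cinv_neq0, Bb; lra].
        apply bracket_neq0 with (c z); [apply Rc; lra|apply Hc; auto].
      + rewrite (Cmult_comm (Nb z)). apply rep_cross_neq0 with (a z) (b z); [apply Ra|apply Rb|apply Hdis]; lra. }
  - apply (lipschitz_from_circle f u v Na Da Nb Db z0 R0 s M K m1); auto.
    + intros z Hz. apply rep_uvcoord; auto.
    + intros z Hz. specialize (Hd z Hz). cbv beta in Hd. fold (h z).
      assert (Hz' : 0 < Cmod (z - z0) < R0) by lra.
      specialize (Hka z Hz'). specialize (Hkb z Hz').
      replace (h z) with ((h z * kb z / ka z) * (ka z / kb z))%C by (field; auto).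
      rewrite Cmod_mult. apply Rle_trans with (2 * (T2 / m3)); [|unfold M; lra].
      apply Rmult_le_compat; auto; try apply Cmod_ge_0. apply Cmod_div_le; [apply U2; auto|auto|apply B3; auto].
  (* The roles of [a] and [b] are exchanged: normalized against [a], the determinant of [f] against
     [b] is [1 / h]. *)
  - apply (lipschitz_from_circle f u' v' Nb Db Na Da z0 R0 s M K m1); auto.
    + intros z Hz. apply rep_uvcoord; auto.
    + intros z Hz. apply uvcoord_normalized; auto.
    + intros z Hz. destruct (HKb z Hz) as (? & ? & ? & ?). auto.
    + intros z Hz. specialize (Hd z Hz). cbv beta in Hd.
      assert (Hz' : 0 < Cmod (z - z0) < R0) by lra.
      specialize (Hka z Hz'). specialize (Hkb z Hz'). pose proof (Hh0 z ltac:(lra)) as Hhz.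
      replace (u' z * Db z - v' z * Nb z)%C with (/ (h z))%C.
      * replace (/ h z)%C with (/ (h z * kb z / ka z) * (kb z / ka z))%C by (field; auto).
        rewrite Cmod_mult. apply Rle_trans with (1 * (T3 / m2)); [|unfold M; lra].
        apply Rmult_le_compat; auto; try apply Cmod_ge_0.
        -- rewrite Cmod_inv by (apply Cmod_gt_0; lra). rewrite <- Rinv_1. apply Rinv_le_contravar; lra.
        -- apply Cmod_div_le; [apply U3; auto|auto|apply B2; auto].
      * unfold u', v'. rewrite uvcoord_cross by (apply Ba; lra). rewrite Hh by lra. field. split; first [apply Ba; lra|apply Bb; lra].
    + intros z Hz. specialize (B1 z Hz). rewrite Cmod_minus_sym in B1. exact B1.
Qed.

(** For the degenerate case, where the members are among [p1], [p2], [p3] and omit nothing.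
    Coordinates of a single function are locally bounded and do not vanish simultaneously. *)
Lemma meromorphic_lipschitz (f : C -> Cext) (z0 : C) (r : R) (N D : C -> C) : local_rep f z0 r N D ->
  exists s L, 0 < s /\ 0 <= L /\
    forall z z', Cmod (z - z0) < s -> Cmod (z' - z0) < s -> chordal (f z) (f z') <= L * Cmod (z - z').
Proof.
  intros (Hr & HN & HD & Hrep).
  assert (CN : Ccont N z0) by (apply Hol_cont, HN; rewrite Cmod_refl; auto).
  assert (CD : Ccont D z0) by (apply Hol_cont, HD; rewrite Cmod_refl; auto).
  destruct (Ccont_bound N z0 CN) as (d1 & Hd1 & B1). destruct (Ccont_bound D z0 CD) as (d2 & Hd2 & B2).
  set (B := Cmod (N z0) + Cmod (D z0) + 1).
  pose proof (Cmod_ge_0 (N z0)) as N0. pose proof (Cmod_ge_0 (D z0)) as D0.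
  assert (Hlow : exists nu d, 0 < nu /\ 0 < d /\ forall z, Cmod (z - z0) < d -> nu <= Cmod (N z) ^ 2 + Cmod (D z) ^ 2).
  { pose proof (Hrep z0 ltac:(rewrite Cmod_refl; auto)) as H0.
    assert (A : N z0 <> 0%C \/ D z0 <> 0%C) by (destruct (f z0); simpl in H0; tauto).
    destruct A as [A|A].
    - destruct (Ccont_away N z0 CN A) as (d & Hd & Haw). apply Cmod_gt_0 in A.
      exists ((Cmod (N z0) / 2) ^ 2), d. split; [apply pow_lt; lra|]. split; auto. intros z Hz.
      specialize (Haw z Hz). assert ((Cmod (N z0) / 2) ^ 2 <= Cmod (N z) ^ 2) by (apply pow_incr; lra).
      pose proof (pow2_ge_0 (Cmod (D z))). lra.
    - destruct (Ccont_away D z0 CD A) as (d & Hd & Haw). apply Cmod_gt_0 in A.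
      exists ((Cmod (D z0) / 2) ^ 2), d. split; [apply pow_lt; lra|]. split; auto. intros z Hz.
      specialize (Haw z Hz). assert ((Cmod (D z0) / 2) ^ 2 <= Cmod (D z) ^ 2) by (apply pow_incr; lra).
      pose proof (pow2_ge_0 (Cmod (N z))). lra. }
  destruct Hlow as (nu & d3 & Hnu & Hd3 & Hlow).
  set (R1 := Rmin r (Rmin d1 (Rmin d2 d3))).
  assert (HR1 : 0 < R1) by (unfold R1; repeat apply Rmin_glb_lt; auto).
  assert (Hin : forall z, Cmod (z - z0) < R1 -> Cmod (z - z0) < r /\ Cmod (N z) <= B /\ Cmod (D z) <= B /\ nu <= Cmod (N z) ^ 2 + Cmod (D z) ^ 2).
  { intros z Hz. unfold R1 in Hz. apply Rmin_Rgt_l in Hz as [Z1 Hz]. apply Rmin_Rgt_l in Hz as [Z2 Hz].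
    apply Rmin_Rgt_l in Hz as [Z3 Z4]. specialize (B1 z Z2). specialize (B2 z Z3). unfold B. repeat split; auto; lra. }
  set (s := R1 / 2). assert (Hs : 0 < s < R1) by (unfold s; lra).
  assert (HN1 : HolD N z0 R1) by (intros z Hz; apply HN, Hin; auto).
  assert (HD1 : HolD D z0 R1) by (intros z Hz; apply HD, Hin; auto).
  exists (s / 2), (4 * B * (8 * B / s) / nu). assert (0 < B) by (unfold B; lra). split; [lra|]. split.
  { apply Rdiv_le_0_compat; auto. apply Rmult_le_pos; [lra|]. apply Rdiv_le_0_compat; lra. }
  intros z z' Hz Hz'. destruct (Hin z ltac:(lra)) as (K1 & K2 & K3 & K4). destruct (Hin z' ltac:(lra)) as (K1' & K2' & K3' & K4').
  apply chordal_rep_lipschitz with (N z) (D z) (N z') (D z'); auto.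
  - apply cauchy_lipschitz with z0 R1; auto. intros x Hx. apply Hin. lra.
  - apply cauchy_lipschitz with z0 R1; auto. intros x Hx. apply Hin. lra.
Qed.

(** * The Arzela-Ascoli theorem on the sphere *)

(** Stereographic projection to the unit sphere, with infinity as the north pole; [chordal] is the
    Euclidean distance of the images ([chordal_sq]). *)
Definition sphX (x : Cext) : R := match x with Some w => 2 * Re w / (1 + Cmod w ^ 2) | None => 0 end.
Definition sphY (x : Cext) : R := match x with Some w => 2 * Im w / (1 + Cmod w ^ 2) | None => 0 end.
Definition sphZ (x : Cext) : R := match x with Some w => (Cmod w ^ 2 - 1) / (1 + Cmod w ^ 2) | None => 1 end.

(** Equivalent to [chordal] up to a factor 3, with a triangle inequality and a coordinatewise notion
    of limit that come for free. *)
Definition sdist (x y : Cext) : R :=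
  Rabs (sphX x - sphX y) + Rabs (sphY x - sphY y) + Rabs (sphZ x - sphZ y).

Lemma sph_norm (x : Cext) : sphX x ^ 2 + sphY x ^ 2 + sphZ x ^ 2 = 1.
Proof.
  destruct x as [w|]; simpl; [|ring]. pose proof (Cmod2_alt w) as E. pose proof (sqrt_pos_of (Cmod w)).
  set (m := Cmod w) in *. simpl in E. transitivity ((4 * (Re w ^ 2 + Im w ^ 2) + (m ^ 2 - 1) ^ 2) / (1 + m ^ 2) ^ 2).
  - field. lra.
  - replace (Re w ^ 2 + Im w ^ 2) with (m ^ 2) by (simpl; exact E). field. lra.
Qed.

Lemma sph_bound (x : Cext) : Rabs (sphX x) <= 1 /\ Rabs (sphY x) <= 1 /\ Rabs (sphZ x) <= 1.
Proof.
  pose proof (sph_norm x) as E. pose proof (pow2_ge_0 (sphX x)). pose proof (pow2_ge_0 (sphY x)). pose proof (pow2_ge_0 (sphZ x)).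
  repeat split; apply Rabs_le; nra.
Qed.

(** Inverse stereographic projection; it turns a limit of the three coordinates into a point of the
    extended plane. *)
Lemma sph_surj (a b c : R) : a ^ 2 + b ^ 2 + c ^ 2 = 1 -> exists x, sphX x = a /\ sphY x = b /\ sphZ x = c.
Proof.
  intros E. destruct (Req_dec c 1) as [->|n].
  - exists None. assert (a = 0) by nra. assert (b = 0) by nra. subst. auto.
  - exists (Some (a / (1 - c), b / (1 - c))). unfold sphX, sphY, sphZ.
    assert (Ew : Cmod (a / (1 - c), b / (1 - c)) ^ 2 = (1 + c) / (1 - c)).
    { rewrite Cmod2_alt. simpl Re. simpl Im. transitivity ((a ^ 2 + b ^ 2) / (1 - c) ^ 2); [field; lra|].
      replace (a ^ 2 + b ^ 2) with ((1 - c) * (1 + c)) by lra. field. lra. }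
    rewrite Ew. simpl Re. simpl Im. repeat split; field; lra.
Qed.

Lemma chordal_sq (x y : Cext) : chordal x y ^ 2 =
  (sphX x - sphX y) ^ 2 + (sphY x - sphY y) ^ 2 + (sphZ x - sphZ y) ^ 2.
Proof.
  assert (Half : forall w : C, (2 / sqrt (1 + Cmod w ^ 2)) ^ 2 =
     (2 * Re w / (1 + Cmod w ^ 2)) ^ 2 + (2 * Im w / (1 + Cmod w ^ 2)) ^ 2 + ((Cmod w ^ 2 - 1) / (1 + Cmod w ^ 2) - 1) ^ 2).
  { intros w. pose proof (sqrt_pos_of (Cmod w)) as P. unfold Rdiv at 1. rewrite Rpow_mult_distr, pow_inv, pow2_sqrt by lra.
    pose proof (Cmod2_alt w) as E. set (q := Cmod w ^ 2) in *.
    transitivity ((4 * (Re w ^ 2 + Im w ^ 2) + 4) / (1 + q) ^ 2); [rewrite <- E; field; lra|field; lra]. }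
  destruct x as [w|], y as [w'|]; unfold sphX, sphY, sphZ, chordal.
  - change (Cnorm (Csub w w')) with (Cmod (w - w')). change (Cnorm w) with (Cmod w). change (Cnorm w') with (Cmod w').
    pose proof (sqrt_pos_of (Cmod w)) as P. pose proof (sqrt_pos_of (Cmod w')) as P'.
    unfold Rdiv at 1. rewrite !Rpow_mult_distr, pow_inv, pow2_sqrt by (apply Rmult_le_pos; lra).
    pose proof (Cmod2_alt w) as E. pose proof (Cmod2_alt w') as E'. pose proof (Cmod2_alt (w - w')) as E2.
    rewrite E2. set (q := Cmod w ^ 2) in *. set (q' := Cmod w' ^ 2) in *.
    destruct w as [a b], w' as [a' b']. simpl Re in *. simpl Im in *.
    apply Rmult_eq_reg_r with ((1 + q) ^ 2 * (1 + q') ^ 2); [|apply Rmult_integral_contrapositive; split; apply pow_nonzero; lra].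
    transitivity (4 * ((a + - a') ^ 2 + (b + - b') ^ 2) * ((1 + q) * (1 + q'))); [field; lra|].
    transitivity ((2 * a * (1 + q') - 2 * a' * (1 + q)) ^ 2 + (2 * b * (1 + q') - 2 * b' * (1 + q)) ^ 2
       + ((q - 1) * (1 + q') - (q' - 1) * (1 + q)) ^ 2); [|field; lra].
    rewrite E, E'. ring.
  - change (Cnorm w) with (Cmod w). rewrite Half. ring.
  - change (Cnorm w') with (Cmod w'). rewrite Half. ring.
  - ring.
Qed.

Lemma chordal_ge_0 (x y : Cext) : 0 <= chordal x y.
Proof.
  assert (H : forall w : C, 0 <= 2 / sqrt (1 + Cmod w ^ 2)).
  { intros w. apply Rdiv_le_0_compat; [lra|apply sqrt_lt_R0, sqrt_pos_of]. }
  destruct x as [w|], y as [w'|]; simpl; try apply H; [|lra].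
  apply Rdiv_le_0_compat.
  - pose proof (Cmod_ge_0 (w - w')) as K. change (Cmod (w - w')) with (Cnorm (Csub w w')) in K. lra.
  - apply sqrt_lt_R0, Rmult_lt_0_compat; [apply (sqrt_pos_of (Cnorm w))|apply (sqrt_pos_of (Cnorm w'))].
Qed.

Lemma chordal_le_sdist (x y : Cext) : chordal x y <= sdist x y.
Proof.
  pose proof (chordal_sq x y) as E. pose proof (chordal_ge_0 x y). unfold sdist.
  rewrite <- (pow2_abs (sphX x - sphX y)), <- (pow2_abs (sphY x - sphY y)), <- (pow2_abs (sphZ x - sphZ y)) in E.
  set (p := Rabs (sphX x - sphX y)) in *. set (q := Rabs (sphY x - sphY y)) in *. set (r := Rabs (sphZ x - sphZ y)) in *.
  assert (0 <= p) by apply Rabs_pos. assert (0 <= q) by apply Rabs_pos. assert (0 <= r) by apply Rabs_pos.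
  apply Rnot_lt_le. intros L. nra.
Qed.

Lemma sdist_le_chordal (x y : Cext) : sdist x y <= 3 * chordal x y.
Proof.
  pose proof (chordal_sq x y) as E. pose proof (chordal_ge_0 x y) as C0.
  assert (B : forall t, t ^ 2 <= chordal x y ^ 2 -> Rabs t <= chordal x y).
  { intros t Ht. apply Rabs_le. nra. }
  pose proof (pow2_ge_0 (sphX x - sphX y)). pose proof (pow2_ge_0 (sphY x - sphY y)). pose proof (pow2_ge_0 (sphZ x - sphZ y)).
  unfold sdist. pose proof (B (sphX x - sphX y) ltac:(lra)). pose proof (B (sphY x - sphY y) ltac:(lra)).
  pose proof (B (sphZ x - sphZ y) ltac:(lra)). lra.
Qed.

Lemma sdist_sym (x y : Cext) : sdist x y = sdist y x.
Proof.
  unfold sdist. rewrite (Rabs_minus_sym (sphX x)), (Rabs_minus_sym (sphY x)), (Rabs_minus_sym (sphZ x)). reflexivity.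
Qed.

Lemma sdist_triangle (x y z : Cext) : sdist x z <= sdist x y + sdist y z.
Proof.
  assert (T : forall a b c, Rabs (a - c) <= Rabs (a - b) + Rabs (b - c)).
  { intros a b c. replace (a - c) with ((a - b) + (b - c)) by ring. apply Rabs_triang. }
  unfold sdist. pose proof (T (sphX x) (sphX y) (sphX z)). pose proof (T (sphY x) (sphY y) (sphY z)).
  pose proof (T (sphZ x) (sphZ y) (sphZ z)). lra.
Qed.

Definition slim (p : nat -> Cext) (q : Cext) : Prop :=
  forall eps, 0 < eps -> exists N : nat, forall n, (N <= n)%nat -> sdist (p n) q < eps.

Lemma rlim_unique (u : nat -> R) (l m : R) : rlim u l -> rlim u m -> l = m.
Proof.
  intros Hl Hm. destruct (Req_dec l m) as [|n]; auto. exfalso.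
  assert (H : 0 < Rabs (l - m)) by (apply Rabs_pos_lt; lra).
  destruct (Hl (Rabs (l - m) / 2) ltac:(lra)) as (N1 & H1). destruct (Hm (Rabs (l - m) / 2) ltac:(lra)) as (N2 & H2).
  specialize (H1 (Nat.max N1 N2) ltac:(lia)). specialize (H2 (Nat.max N1 N2) ltac:(lia)).
  set (v := u (Nat.max N1 N2)) in *. rewrite Rabs_minus_sym in H1.
  pose proof (Rabs_triang (l - v) (v - m)) as T. replace (l - v + (v - m)) with (l - m) in T by ring. lra.
Qed.

Lemma rlim_Un_cv (u : nat -> R) (l : R) : rlim u l <-> Un_cv u l.
Proof.
  split; intros H eps He; destruct (H eps He) as (N & HN); exists N; intros n Hn; apply HN; lia.
Qed.

Lemma sphere_compact (p : nat -> Cext) : exists phi q, strict_incr phi /\ slim (fun n => p (phi n)) q.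
Proof.
  destruct (bounded_subseq_R (fun n => sphX (p n)) 1) as (f1 & a & S1 & L1); [intros; apply sph_bound|].
  destruct (bounded_subseq_R (fun n => sphY (p (f1 n))) 1) as (f2 & b & S2 & L2); [intros; apply sph_bound|].
  destruct (bounded_subseq_R (fun n => sphZ (p (f1 (f2 n)))) 1) as (f3 & c & S3 & L3); [intros; apply sph_bound|].
  set (phi := fun n => f1 (f2 (f3 n))).
  assert (Hphi : strict_incr phi) by (apply (strict_incr_comp f1 (fun n => f2 (f3 n))); auto; apply strict_incr_comp; auto).
  assert (LX : rlim (fun n => sphX (p (phi n))) a).
  { apply (rlim_subseq (fun n => sphX (p (f1 n))) a (fun n => f2 (f3 n))); auto. apply strict_incr_comp; auto. }
  assert (LY : rlim (fun n => sphY (p (phi n))) b) by (apply (rlim_subseq (fun n => sphY (p (f1 (f2 n)))) b f3); auto).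
  assert (LZ : rlim (fun n => sphZ (p (phi n))) c) by exact L3.
  assert (E : a ^ 2 + b ^ 2 + c ^ 2 = 1).
  { apply rlim_unique with (fun n => sphX (p (phi n)) ^ 2 + sphY (p (phi n)) ^ 2 + sphZ (p (phi n)) ^ 2).
    - apply rlim_Un_cv. apply rlim_Un_cv in LX, LY, LZ. simpl.
      repeat apply CV_plus; repeat apply CV_mult; auto;
        intros eps He; exists 0%nat; intros; unfold R_dist; rewrite Rminus_diag, Rabs_R0; auto.
    - intros eps He. exists 0%nat. intros n _. rewrite sph_norm, Rminus_diag, Rabs_R0. auto. }
  destruct (sph_surj a b c E) as (q & <- & <- & <-).
  exists phi, q. split; auto. intros eps He.
  destruct (LX (eps / 3) ltac:(lra)) as (N1 & H1). destruct (LY (eps / 3) ltac:(lra)) as (N2 & H2).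
  destruct (LZ (eps / 3) ltac:(lra)) as (N3 & H3). exists (Nat.max N1 (Nat.max N2 N3)). intros n Hn.
  specialize (H1 n ltac:(lia)). specialize (H2 n ltac:(lia)). specialize (H3 n ltac:(lia)). unfold sdist. lra.
Qed.

Lemma diagonal_subsequence (p : nat -> nat -> Cext) :
  exists phi, strict_incr phi /\ forall k, exists q, slim (fun n => p k (phi n)) q.
Proof.
  destruct (dependent_choice (nat -> nat)
    (fun n f => strict_incr f /\ match n with O => True | S k => exists q, slim (fun m => p k (f m)) q end)
    (fun _ f f' => exists psi, strict_incr psi /\ forall m, f' m = f (psi m)) (fun n => n)) as (s & _ & Hs).
  - split; auto. intros n. lia.
  - intros n f [Hf _]. destruct (sphere_compact (fun m => p n (f m))) as (psi & q & Hpsi & Hq).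
    exists (fun m => f (psi m)). split; [split|].
    + apply strict_incr_comp; auto.
    + exists q. exact Hq.
    + exists psi. auto.
  - assert (Hsub : forall k j, exists th, strict_incr th /\ forall m, s (k + j)%nat m = s k (th m)).
    { intros k j. induction j as [|j (th & Hth & E)].
      - exists (fun m => m). rewrite Nat.add_0_r. split; auto. intros n. lia.
      - destruct (Hs (k + j)%nat) as [_ (psi & Hpsi & E2)]. exists (fun m => th (psi m)).
        split; [apply strict_incr_comp; auto|]. intros m. rewrite Nat.add_succ_r, E2, E. reflexivity. }
    exists (fun n => s n n). split.
    + intros n. destruct (Hs n) as [[Hn _] (psi & Hpsi & E)]. rewrite E.
      apply strict_incr_lt; auto. pose proof (strict_incr_ge psi (S n) Hpsi). lia.
    (* Stage 0 is the identity, so row [k] converges along stage [S k]; the diagonal is a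
       subsequence of that stage from the index [S k] on. *)
    + intros k. destruct (Hs (S k)) as [[_ (q & Hq)] _]. exists q. intros eps He.
      destruct (Hq eps He) as (N & HN). exists (Nat.max N (S k)). intros n Hn.
      destruct (Hsub (S k) (n - S k)%nat) as (th & Hth & E).
      replace (S k + (n - S k))%nat with n in E by lia. rewrite E. apply HN.
      pose proof (strict_incr_ge th n Hth). lia.
Qed.

(** Level [m] has mesh [1 / (m + 1)], and with indices up to [2 m^2] it reaches out to
    [m^2 / (m + 1)] in each direction: one parameter refines and enlarges the grid at once. *)
Definition grid (m a b : nat) : C :=
  ((INR a - INR m ^ 2) / (INR m + 1), (INR b - INR m ^ 2) / (INR m + 1)).

Definition grid_point (k : nat) : C :=
  let (c, m) := Cantor.of_nat k in let (a, b) := Cantor.of_nat c in grid m a b.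

Lemma nat_fun_bound (g : nat -> nat) (B : nat) : exists K, forall i, (i <= B)%nat -> (g i <= K)%nat.
Proof.
  induction B as [|B (K & HK)].
  - exists (g 0%nat). intros i Hi. replace i with 0%nat by lia. lia.
  - exists (Nat.max K (g (S B))). intros i Hi. destruct (Nat.eq_dec i (S B)) as [->|]; [lia|].
    specialize (HK i ltac:(lia)). lia.
Qed.

Lemma grid_dense (T eta : R) : 0 < eta ->
  exists K : nat, forall z, Cmod z <= T -> exists k, (k <= K)%nat /\ Cmod (grid_point k - z) < eta.
Proof.
  (* [Rabs T + 1] makes the grid cover the disc, and [4 / eta] makes the mesh smaller than
     [eta / 2]. *)
  intros He. destruct (nfloor_ex (Rabs T + 4 / eta + 1)) as (m0 & Hm0).
  { pose proof (Rabs_pos T). assert (0 < 4 / eta) by (apply Rdiv_lt_0_compat; lra). lra. }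
  set (m := S m0). assert (Hm : Rabs T + 4 / eta + 1 < INR m) by (unfold m; rewrite S_INR; lra).
  assert (H4 : 0 < 4 / eta) by (apply Rdiv_lt_0_compat; lra).
  pose proof (Rabs_pos T). pose proof (Rle_abs T).
  assert (Hx : forall x, Rabs x <= T -> exists a, (a <= 2 * m * m)%nat /\ Rabs ((INR a - INR m ^ 2) / (INR m + 1) - x) < eta / 2).
  { intros x Hx. apply Rabs_le_between in Hx.
    assert (Hfl : 0 <= x * (INR m + 1) + INR m ^ 2) by nra.
    destruct (nfloor_ex _ Hfl) as (a & Ha). exists a. split.
    - apply INR_le. rewrite !mult_INR. simpl (INR 2). nra.
    - replace ((INR a - INR m ^ 2) / (INR m + 1) - x) with ((INR a - (x * (INR m + 1) + INR m ^ 2)) / (INR m + 1)) by (field; lra).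
      unfold Rdiv. rewrite Rabs_mult, (Rabs_pos_eq (/ (INR m + 1))) by (left; apply Rinv_0_lt_compat; lra).
      apply Rle_lt_trans with (1 * / (INR m + 1)).
      + apply Rmult_le_compat_r; [left; apply Rinv_0_lt_compat; lra|]. apply Rabs_le; lra.
      + rewrite Rmult_1_l. rewrite <- (Rinv_inv (eta * / 2)). apply Rinv_lt_contravar.
        * apply Rmult_lt_0_compat; [apply Rinv_0_lt_compat; lra|lra].
        * rewrite Rinv_mult, Rinv_inv. unfold Rdiv in *. lra. }
  assert (HK : exists K, forall a b, (a <= 2 * m * m)%nat -> (b <= 2 * m * m)%nat -> (Cantor.to_nat (Cantor.to_nat (a, b), m) <= K)%nat).
  { assert (Hin : forall a, exists K, forall b, (b <= 2 * m * m)%nat -> (Cantor.to_nat (Cantor.to_nat (a, b), m) <= K)%nat).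
    { intros a. apply (nat_fun_bound (fun b => Cantor.to_nat (Cantor.to_nat (a, b), m))). }
    apply choice in Hin as (g & Hg). destruct (nat_fun_bound g (2 * m * m)) as (K & HK). exists K.
    intros a b Ha Hb. specialize (Hg a b Hb). specialize (HK a Ha). lia. }
  destruct HK as (K & HK). exists K. intros z Hz.
  destruct (Hx (Re z)) as (a & Ha & Ea); [eapply Rle_trans; [apply re_le_Cmod|auto]|].
  destruct (Hx (Im z)) as (b & Hb & Eb); [eapply Rle_trans; [apply im_le_Cmod|auto]|].
  exists (Cantor.to_nat (Cantor.to_nat (a, b), m)). split; auto.
  unfold grid_point. rewrite !Cantor.cancel_of_to.
  eapply Rle_lt_trans; [apply Cmod_le_Re_Im|]. unfold grid; simpl. simpl in Ea, Eb. unfold Rminus in *. unfold Re, Im in *. lra.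
Qed.

Definition locally_equilipschitz (Om : C -> Prop) (fs : nat -> C -> Cext) : Prop :=
  forall z0, Om z0 -> exists r L, 0 < r /\ 0 <= L /\ forall n z z',
    Cmod (z - z0) < r -> Cmod (z' - z0) < r -> chordal (fs n z) (fs n z') <= L * Cmod (z - z').

(** [g z] is chosen as a cluster value, at [z], of the subsequence that converges on the grid. Near
    a point of [Om] this subsequence is uniformly Cauchy, because finitely many grid points control
    it through the Lipschitz bound; so it converges uniformly to [g]. *)
Lemma arzela_ascoli (Om : C -> Prop) (fs : nat -> C -> Cext) : locally_equilipschitz Om fs ->
  exists phi g, strict_incr phi /\ forall z0, Om z0 -> exists r, 0 < r /\
    forall eps, 0 < eps -> exists N : nat, forall n, (N <= n)%nat ->
      forall z, Cmod (z - z0) < r -> sdist (fs (phi n) z) (g z) < eps.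
Proof.
  intros HL. destruct (diagonal_subsequence (fun k n => fs n (grid_point k))) as (phi & Hphi & Hlim).
  assert (Hg : forall z, exists x, exists psi, strict_incr psi /\ slim (fun n => fs (phi (psi n)) z) x).
  { intros z. destruct (sphere_compact (fun n => fs (phi n) z)) as (psi & q & H1 & H2). eauto. }
  apply choice in Hg as (g & Hg). exists phi, g. split; auto.
  intros z0 Hz0. destruct (HL z0 Hz0) as (r & L & Hr & HL0 & Hlip). exists (r / 2). split; [lra|].
  intros eps He.
  (* [r / 2] keeps the nearby grid point in the Lipschitz disc; 15 is 3, the factor between [sdist]
     and [chordal], times 5, for the share [eps / 5] of each error. *)
  set (eta := Rmin (r / 2) (eps / (15 * (L + 1)))).
  assert (Heta : 0 < eta) by (apply Rmin_glb_lt; [lra|apply Rdiv_lt_0_compat; lra]).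
  assert (Heta1 : eta <= r / 2) by apply Rmin_l.
  assert (Heta2 : 3 * (L * eta) <= eps / 5).
  { assert (E : eta <= eps / (15 * (L + 1))) by apply Rmin_r. apply Rle_div_r in E; lra. }
  destruct (grid_dense (Cmod z0 + r) eta Heta) as (K & HK).
  assert (HN : exists N : nat, forall k, (k <= K)%nat -> forall n n', (N <= n)%nat -> (N <= n')%nat ->
     sdist (fs (phi n) (grid_point k)) (fs (phi n') (grid_point k)) < eps / 5).
  { assert (Hk : forall k, exists N : nat, forall n n', (N <= n)%nat -> (N <= n')%nat ->
       sdist (fs (phi n) (grid_point k)) (fs (phi n') (grid_point k)) < eps / 5).
    { intros k. destruct (Hlim k) as (q & Hq). destruct (Hq (eps / 10) ltac:(lra)) as (N & HN). exists N.
      intros n n' Hn Hn'. pose proof (HN n Hn). pose proof (HN n' Hn') as H2. rewrite sdist_sym in H2.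
      pose proof (sdist_triangle (fs (phi n) (grid_point k)) q (fs (phi n') (grid_point k))). lra. }
    apply choice in Hk as (Nf & HNf). destruct (nat_fun_bound Nf K) as (N & HN). exists N.
    intros k Hk n n' Hn Hn'. specialize (HN k Hk). apply HNf; lia. }
  destruct HN as (N & HN). exists N. intros n Hn z Hz.
  destruct (HK z) as (k & Hk & Hkz).
  { pose proof (Cmod_le_add_sub z z0). lra. }
  assert (Hkin : Cmod (grid_point k - z0) < r) by (pose proof (Cmod_triangle_sub (grid_point k) z z0); lra).
  assert (Hclose : forall j, sdist (fs j z) (fs j (grid_point k)) <= eps / 5).
  { intros j. eapply Rle_trans; [apply sdist_le_chordal|]. pose proof (Hlip j z (grid_point k) ltac:(lra) Hkin) as Hc.
    rewrite Cmod_minus_sym in Hc. assert (L * Cmod (grid_point k - z) <= L * eta) by (apply Rmult_le_compat_l; lra). lra. }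
  destruct (Hg z) as (psi & Hpsi & Hx). destruct (Hx (eps / 5) ltac:(lra)) as (N2 & H2).
  set (j := Nat.max N N2). specialize (H2 j ltac:(lia)).
  assert (Hj : (N <= psi j)%nat) by (pose proof (strict_incr_ge psi j Hpsi); lia).
  pose proof (HN k Hk n (psi j) Hn Hj) as H3.
  pose proof (Hclose (phi n)) as C1. pose proof (Hclose (phi (psi j))) as C2. rewrite sdist_sym in C2.
  pose proof (sdist_triangle (fs (phi n) z) (fs (phi n) (grid_point k)) (g z)) as T1.
  pose proof (sdist_triangle (fs (phi n) (grid_point k)) (fs (phi (psi j)) (grid_point k)) (g z)) as T2.
  pose proof (sdist_triangle (fs (phi (psi j)) (grid_point k)) (fs (phi (psi j)) z) (g z)) as T3.
  cbv beta in H2. lra.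
Qed.

(** * Limits of meromorphic functions and normality *)

Lemma Cinv_involutive (x : C) : x <> 0%C -> (/ / x)%C = x.
Proof.
  intros H. transitivity (x * (/ x * / / x))%C; [|rewrite Cinv_r by (apply Cinv_neq0; auto); ring].
  rewrite Cmult_assoc, Cinv_r by auto. ring.
Qed.

(** Inversion exchanges the homogeneous coordinates, hence is an isometry of the sphere. It reduces
    a limit that is infinite at [z0] to one that is finite there. *)
Definition swap (x : Cext) : Cext :=
  match x with
  | Some w => if C_eq_dec w 0%C then None else Some (/ w)%C
  | None => Some (RtoC 0)
  end.

Lemma rep_swap (x : Cext) (N D : C) : rep x N D -> rep (swap x) D N.
Proof.
  destruct x as [w|]; simpl; intros [H1 H2].
  - destruct (C_eq_dec w 0%C) as [->|n]; simpl.
    + split; auto. rewrite H2. ring.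
    + subst N. split; [apply Cmult_neq_0; auto|]. field. auto.
  - split; auto. rewrite H1. ring.
Qed.

Lemma rep_exists (x : Cext) : exists N D, rep x N D.
Proof.
  destruct x as [w|].
  - exists (w : C), (RtoC 1). simpl. split; [apply C1_nz|]. symmetry. apply Cmult_1_r.
  - exists (RtoC 1), (RtoC 0). simpl. split; auto. apply C1_nz.
Qed.

Lemma chordal_swap (x y : Cext) : chordal (swap x) (swap y) = chordal x y.
Proof.
  destruct (rep_exists x) as (N & D & Hx). destruct (rep_exists y) as (N' & D' & Hy).
  rewrite (chordal_rep _ _ _ _ _ _ Hx Hy), (chordal_rep _ _ _ _ _ _ (rep_swap _ _ _ Hx) (rep_swap _ _ _ Hy)).
  rewrite (Rplus_comm (Cmod D ^ 2)), (Rplus_comm (Cmod D' ^ 2)).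
  replace (D * N' - D' * N)%C with (- (N * D' - N' * D))%C by ring. rewrite Cmod_opp. reflexivity.
Qed.

Lemma Hol_fin (f : C -> Cext) (z0 : C) (r d : R) (N D : C -> C) :
  local_rep f z0 r N D -> 0 < d -> (forall z, Cmod (z - z0) < d -> f z <> None) -> Hol (fin f) z0.
Proof.
  intros (Hr & HN & HD & Hrep) Hd Hn.
  assert (E : forall z, Cmod (z - z0) < r -> Cmod (z - z0) < d -> D z <> 0%C /\ (N z / D z)%C = fin f z).
  { intros z Hz Hz'. specialize (Hrep z Hz). rewrite (fin_Some f z) in Hrep by auto. simpl in Hrep.
    destruct Hrep as [H1 ->]. split; auto.
    transitivity (fin f z * (D z * / D z))%C; [unfold Cdiv; rewrite Cmult_assoc; reflexivity|].
    rewrite Cinv_r by auto. apply Cmult_1_r. }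
  assert (H0 : Cmod (z0 - z0) < r /\ Cmod (z0 - z0) < d) by (rewrite Cmod_refl; auto).
  apply Hol_ext_loc with (fun z => N z / D z)%C.
  - exists (Rmin r d). split; [apply Rmin_glb_lt; auto|]. intros w Hw. apply Rmin_Rgt_l in Hw as [H1 H2]. apply E; auto.
  - apply Hol_div; [apply HN|apply HD|apply E]; apply H0.
Qed.

Lemma sphZ_finite (x : Cext) (c : R) : 0 < c -> sphZ x <= 1 - c ->
  exists w, x = Some w /\ 1 + Cmod w ^ 2 <= 2 / c.
Proof.
  intros Hc H. destruct x as [w|]; simpl in H; [|lra]. exists w. split; auto.
  pose proof (sqrt_pos_of (Cmod w)) as P. apply Rle_div_r; auto.
  assert (E : (Cmod w ^ 2 - 1) / (1 + Cmod w ^ 2) * (1 + Cmod w ^ 2) = Cmod w ^ 2 - 1) by (field; lra).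
  simpl in *. nra.
Qed.

Lemma Cmod_le_chordal (w w' : C) (B : R) : 1 + Cmod w ^ 2 <= B -> 1 + Cmod w' ^ 2 <= B ->
  Cmod (w - w') <= B / 2 * chordal (Some w) (Some w').
Proof.
  intros H1 H2. unfold chordal. change (Cnorm (Csub w w')) with (Cmod (w - w')).
  change (Cnorm w) with (Cmod w). change (Cnorm w') with (Cmod w').
  pose proof (sqrt_pos_of (Cmod w)) as P. pose proof (sqrt_pos_of (Cmod w')) as P'.
  assert (HB : 0 < B) by lra.
  assert (Hs : 0 < sqrt ((1 + Cmod w ^ 2) * (1 + Cmod w' ^ 2))) by (apply sqrt_lt_R0, Rmult_lt_0_compat; auto).
  assert (Hs2 : sqrt ((1 + Cmod w ^ 2) * (1 + Cmod w' ^ 2)) <= B).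
  { rewrite <- (sqrt_square B) by lra. apply sqrt_le_1_alt. apply Rmult_le_compat; lra. }
  set (S := sqrt ((1 + Cmod w ^ 2) * (1 + Cmod w' ^ 2))) in *.
  replace (B / 2 * (2 * Cmod (w - w') / S)) with (Cmod (w - w') * (B / S)) by (field; lra).
  rewrite <- (Rmult_1_r (Cmod (w - w'))) at 1. apply Rmult_le_compat_l; [apply Cmod_ge_0|].
  apply Rle_div_r; lra.
Qed.

Definition local_limit (fs : nat -> C -> Cext) (g : C -> Cext) (z0 : C) (r : R) : Prop :=
  (forall n z, Cmod (z - z0) < r -> exists r P Q, local_rep (fs n) z r P Q) /\
  (forall eps, 0 < eps -> exists N : nat, forall n, (N <= n)%nat ->
     forall z, Cmod (z - z0) < r -> chordal (fs n z) (g z) < eps) /\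
  (exists L, 0 <= L /\ forall n z z', Cmod (z - z0) < r -> Cmod (z' - z0) < r ->
     chordal (fs n z) (fs n z') <= L * Cmod (z - z')).

Lemma local_limit_swap (fs : nat -> C -> Cext) (g : C -> Cext) (z0 : C) (r : R) :
  local_limit fs g z0 r -> local_limit (fun n z => swap (fs n z)) (fun z => swap (g z)) z0 r.
Proof.
  intros (H1 & H2 & L & HL & H3). split; [|split].
  - intros n z Hz. destruct (H1 n z Hz) as (r' & P & Q & Hr' & HP & HQ & Hrep).
    exists r', Q, P. repeat split; auto. intros w Hw. apply rep_swap; auto.
  - intros eps He. destruct (H2 eps He) as (N & HN). exists N. intros n Hn z Hz. rewrite chordal_swap. auto.
  - exists L. split; auto. intros. rewrite chordal_swap. auto.
Qed.

(** Near [z0] the common Lipschitz bound keeps all late members, and [g], away from the north pole.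
    There the chordal and the Euclidean distance are comparable, so that the members are holomorphic
    and converge uniformly. *)
Lemma local_limit_finite (fs : nat -> C -> Cext) (g : C -> Cext) (z0 : C) (r : R) : 0 < r ->
  local_limit fs g z0 r -> g z0 <> None ->
  exists d, 0 < d /\ d <= r /\ (forall z, Cmod (z - z0) < d -> g z <> None) /\ HolD (fin g) z0 d.
Proof.
  intros Hr (Hrep & Hconv & L & HL & Hlip) Hg0.
  assert (Hz0 : sphZ (g z0) < 1).
  { destruct (g z0) as [w|]; [|congruence]. simpl. pose proof (sqrt_pos_of (Cmod w)) as P.
    apply Rlt_div_l; simpl in *; lra. }
  set (c := (1 - sphZ (g z0)) / 2). assert (Hc : 0 < c) by (unfold c; lra).
  assert (HZ : forall x y, sphZ x <= sphZ y + 3 * chordal x y).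
  { intros x y. pose proof (sdist_le_chordal x y) as S. unfold sdist in S.
    pose proof (Rabs_pos (sphX x - sphX y)). pose proof (Rabs_pos (sphY x - sphY y)).
    pose proof (Rle_abs (sphZ x - sphZ y)). lra. }
  assert (Hsym : forall x y, chordal x y = chordal y x).
  { intros x y. pose proof (chordal_sq x y) as E1. pose proof (chordal_sq y x) as E2.
    pose proof (chordal_ge_0 x y). pose proof (chordal_ge_0 y x).
    assert (chordal x y ^ 2 = chordal y x ^ 2) by (rewrite E1, E2; ring). apply Rle_antisym; nra. }
  (* [sphZ (g z0)] is [1 - 2 c]. Late members exceed it by at most [6 e < c], and [g] exceeds a late
     member by at most [3 e < c / 2]. *)
  set (e := c / 16). assert (He : 0 < e) by (unfold e; lra).
  destruct (Hconv e He) as (N & HN).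
  set (d := Rmin r (e / (L + 1))).
  assert (Hd : 0 < d) by (apply Rmin_glb_lt; auto; apply Rdiv_lt_0_compat; lra).
  assert (Hdr : d <= r) by apply Rmin_l.
  assert (Hr0 : Cmod (z0 - z0) < r) by (rewrite Cmod_refl; auto).
  assert (HZn : forall n z, (N <= n)%nat -> Cmod (z - z0) < d -> sphZ (fs n z) <= 1 - c).
  { intros n z Hn Hz. pose proof (Hlip n z z0 ltac:(lra) Hr0) as H1.
    assert (L * Cmod (z - z0) <= e).
    { assert (Cmod (z - z0) <= e / (L + 1)) by (left; eapply Rlt_le_trans; [exact Hz|apply Rmin_r]).
      apply Rle_div_r in H; [|lra]. pose proof (Cmod_ge_0 (z - z0)). lra. }
    pose proof (HN n Hn z0 Hr0). pose proof (HZ (fs n z) (fs n z0)). pose proof (HZ (fs n z0) (g z0)).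
    unfold e, c in *. lra. }
  assert (HZg : forall z, Cmod (z - z0) < d -> sphZ (g z) <= 1 - c / 2).
  { intros z Hz. pose proof (HZn N z (Nat.le_refl _) Hz). pose proof (HN N (Nat.le_refl _) z ltac:(lra)) as H1.
    rewrite Hsym in H1. pose proof (HZ (g z) (fs N z)). unfold e in *. lra. }
  assert (HgS : forall z, Cmod (z - z0) < d -> g z <> None).
  { intros z Hz E. specialize (HZg z Hz). rewrite E in HZg. simpl in HZg. lra. }
  exists d. split; auto. split; auto. split; auto.
  apply (uconv_Hol (fun n => fin (fs n)) (fin g) z0 d N).
  - intros n Hn z Hz. destruct (Hrep n z ltac:(lra)) as (r' & P & Q & HPQ).
    apply (Hol_fin (fs n) z r' (d - Cmod (z - z0)) P Q HPQ); [lra|].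
    intros w Hw E. pose proof (Cmod_triangle_sub w z z0). specialize (HZn n w Hn ltac:(lra)).
    rewrite E in HZn. simpl in HZn. lra.
  - intros eps Heps. assert (Hb : 0 < 4 / c) by (apply Rdiv_lt_0_compat; lra).
    destruct (Hconv (eps / (4 / c)) ltac:(apply Rdiv_lt_0_compat; lra)) as (N2 & HN2).
    exists (Nat.max N N2). intros n Hn z Hz. specialize (HN2 n ltac:(lia) z ltac:(lra)).
    destruct (sphZ_finite (fs n z) c Hc) as (w & Ew & Bw); [apply HZn; auto; lia|].
    destruct (sphZ_finite (g z) (c / 2)) as (w' & Ew' & Bw'); [lra|apply HZg; auto|].
    unfold fin. rewrite Ew, Ew' in *.
    replace (2 / (c / 2)) with (4 / c) in Bw' by (field; lra).
    assert (Bw2 : 1 + Cmod w ^ 2 <= 4 / c).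
    { eapply Rle_trans; [exact Bw|]. unfold Rdiv. apply Rmult_le_compat_r; [left; apply Rinv_0_lt_compat; lra|lra]. }
    pose proof (Cmod_le_chordal w w' (4 / c) Bw2 Bw') as K.
    pose proof (chordal_ge_0 (Some w) (Some w')) as C0. set (X := chordal (Some w) (Some w')) in *. set (Bc := 4 / c) in *.
    apply Rlt_div_r in HN2; [|lra]. change (Cmod (w - w') <= Bc / 2 * X) in K. nra.
Qed.

Definition meromorphic_at (g : C -> Cext) (z0 : C) (r : R) : Prop :=
  (forall z, 0 < Cmod (z - z0) < r -> g z <> None /\ Cdifferentiable (fin g) z) /\
  ((g z0 <> None /\ Cdifferentiable (fin g) z0) \/
   (g z0 = None /\ forall M, exists d, 0 < d /\ forall z, 0 < Cmod (z - z0) < d -> M < Cmod (fin g z))).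

(** If [g z0] is infinite, [1 / g] is holomorphic near [z0] with a zero there; either it vanishes
    identically, or the zero is isolated and [g] has a pole. *)
Lemma local_limit_dichotomy (fs : nat -> C -> Cext) (g : C -> Cext) (z0 : C) (r : R) : 0 < r ->
  local_limit fs g z0 r ->
  (exists d, 0 < d /\ forall z, Cmod (z - z0) < d -> g z = None) \/
  (exists d, 0 < d /\ d <= r /\ meromorphic_at g z0 d).
Proof.
  intros Hr H. destruct (g z0) as [w|] eqn:E.
  - right. destruct (local_limit_finite fs g z0 r Hr H) as (d & Hd & Hdr & H1 & H2); [congruence|].
    exists d. split; auto. split; auto. split.
    + intros z [_ Hz]. split; auto. apply Cdifferentiable_Hol, H2; auto.
    + left. split; [congruence|]. apply Cdifferentiable_Hol, H2. rewrite Cmod_refl; auto.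
  - destruct (local_limit_finite _ _ z0 r Hr (local_limit_swap _ _ _ _ H)) as (d & Hd & Hdr & H1 & H2).
    { rewrite E. simpl. congruence. }
    set (k := fun z => fin (fun z => swap (g z)) z : C).
    assert (Hk : forall z, Cmod (z - z0) < d -> (k z = 0%C -> g z = None) /\ (k z <> 0%C -> g z = Some (/ k z)%C)).
    { intros z Hz. specialize (H1 z Hz). unfold k, fin. destruct (g z) as [w|]; simpl in *; [|split; auto; intros n; exfalso; apply n; reflexivity].
      destruct (C_eq_dec w 0%C) as [->|n]; [congruence|]. split.
      - intros e. exfalso. apply (Cinv_neq0 w n e).
      - intros _. f_equal. symmetry. apply Cinv_involutive; auto. }
    destruct (isolated_zeros k z0 d H2) as [H0|(d2 & Hd2 & H0)].
    + left. exists d. split; auto. intros z Hz. apply Hk; auto.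
    + right. exists (Rmin d d2). split; [apply Rmin_glb_lt; auto|]. split; [eapply Rle_trans; [apply Rmin_l|auto]|].
      assert (Hg : forall z, 0 < Cmod (z - z0) < Rmin d d2 -> g z = Some (/ k z)%C /\ k z <> 0%C).
      { intros z [Hz1 Hz2]. apply Rmin_Rgt_l in Hz2 as [Hz2 Hz3].
        assert (k z <> 0%C) by (apply H0; auto). split; auto. apply Hk; auto. }
      split.
      * intros z Hz. destruct (Hg z Hz) as [Eg Hn]. split; [congruence|].
        apply Cdifferentiable_Hol. apply Hol_ext_loc with (fun z => / k z)%C.
        -- exists (Rmin (Cmod (z - z0)) (Rmin d d2 - Cmod (z - z0))). split; [apply Rmin_glb_lt; lra|].
           intros x Hx. apply Rmin_Rgt_l in Hx as [Hx1 Hx2].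
           pose proof (Cmod_triangle_sub x z z0). pose proof (Cmod_triangle_sub z x z0) as T.
           rewrite (Cmod_minus_sym z x) in T.
           unfold fin. rewrite (proj1 (Hg x ltac:(lra))). reflexivity.
        -- apply Hol_inv; auto. apply H2. destruct Hz as [_ Hz]. apply Rmin_Rgt_l in Hz. apply Hz.
      * right. split; auto. intros M.
        assert (Ck : Ccont k z0) by (apply Hol_cont, H2; rewrite Cmod_refl; auto).
        assert (Ek : k z0 = 0%C) by (unfold k, fin; rewrite E; reflexivity).
        assert (HM : 0 < Rabs M + 1) by (pose proof (Rabs_pos M); lra).
        destruct (Ck (/ (Rabs M + 1)) ltac:(apply Rinv_0_lt_compat; auto)) as (d3 & Hd3 & H3).
        exists (Rmin (Rmin d d2) d3). split; [apply Rmin_glb_lt; [apply Rmin_glb_lt|]; auto|].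
        intros z [Hz1 Hz2]. apply Rmin_Rgt_l in Hz2 as [Hz2 Hz3].
        destruct (Hg z (conj Hz1 Hz2)) as [Eg Hn]. specialize (H3 z Hz3). rewrite Ek in H3.
        replace (k z - 0)%C with (k z) in H3 by ring.
        unfold fin. rewrite Eg. rewrite Cmod_inv by auto. apply Cmod_gt_0 in Hn.
        apply Rle_lt_trans with (Rabs M + 1); [pose proof (Rle_abs M); lra|].
        rewrite <- (Rinv_inv (Rabs M + 1)). apply Rinv_lt_contravar; auto.
        apply Rmult_lt_0_compat; auto. apply Rinv_0_lt_compat; auto.
Qed.

(** * Connectedness and the identity theorem *)

Definition near_punctured (z0 : C) (P : C -> Prop) : Prop :=
  exists d, 0 < d /\ forall z, 0 < Cmod (z - z0) < d -> P z.

Lemma near_punctured_and (z0 : C) (P Q : C -> Prop) :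
  near_punctured z0 P -> near_punctured z0 Q -> near_punctured z0 (fun z => P z /\ Q z).
Proof.
  intros (d & Hd & H1) (d' & Hd' & H2). exists (Rmin d d'). split; [apply Rmin_glb_lt; auto|].
  intros z [Hz Hz']. apply Rmin_Rgt_l in Hz' as [? ?]. auto.
Qed.

Lemma near_punctured_of_near (z0 : C) (P : C -> Prop) :
  (exists d, 0 < d /\ forall z, Cmod (z - z0) < d -> P z) -> near_punctured z0 P.
Proof. intros (d & Hd & H). exists d. split; auto. intros z [_ Hz]. auto. Qed.

Lemma near_punctured_point (z0 : C) (P : C -> Prop) : near_punctured z0 P -> exists z, P z.
Proof.
  intros (d & Hd & H). exists (z0 + RtoC (d / 2))%C. apply H.
  replace (z0 + RtoC (d / 2) - z0)%C with (RtoC (d / 2)) by ring. rewrite Cmod_R, Rabs_pos_eq; lra.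
Qed.

(** The centres of each kind form an open set, and no point is of both kinds since a punctured disc
    is not empty; connectedness leaves one kind. It is applied to coincidence of two functions and
    to the value infinity of a limit. *)
Lemma domain_dichotomy (Om : C -> Prop) (P : C -> Prop) : Defs.domain Om ->
  (forall z0, Om z0 -> (exists d, 0 < d /\ forall z, Cmod (z - z0) < d -> P z) \/
     near_punctured z0 (fun z => ~ P z)) ->
  (forall z, Om z -> P z) \/ (forall z0, Om z0 -> near_punctured z0 (fun z => ~ P z)).
Proof.
  intros (_ & _ & Hconn) H.
  destruct (Hconn (fun z0 => exists d, 0 < d /\ forall z, Cmod (z - z0) < d -> P z)
    (fun z0 => near_punctured z0 (fun z => ~ P z))) as [K|K]; auto.
  - intros z0 (d & Hd & H1). exists (d / 2). split; [lra|]. intros w Hw. change (Cmod (w - z0) < d / 2) in Hw.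
    exists (d / 2). split; [lra|]. intros z Hz. apply H1. pose proof (Cmod_triangle_sub z w z0). lra.
  - intros z0 (d & Hd & H1). exists d. split; auto. intros w Hw. change (Cmod (w - z0) < d) in Hw.
    destruct (C_eq_dec w z0) as [->|n]; [exists d; auto|]. apply Cmod_sub_pos in n.
    exists (Rmin (Cmod (w - z0)) (d - Cmod (w - z0))). split; [apply Rmin_glb_lt; lra|].
    intros z [Hz1 Hz2]. apply Rmin_Rgt_l in Hz2 as [Hz2 Hz3]. apply H1.
    pose proof (Cmod_triangle_sub z w z0). pose proof (Cmod_triangle_sub w z z0) as T. rewrite (Cmod_minus_sym w z) in T. lra.
  - intros z0 _ H1 H2.
    destruct (near_punctured_point _ _ (near_punctured_and _ _ _ (near_punctured_of_near _ _ H1) H2)). tauto.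
  - right. intros z0 Hz0. destruct (H z0 Hz0) as [A|A]; auto. exfalso. exact (K z0 Hz0 A).
  - left. intros z0 Hz0. destruct (H z0 Hz0) as [(d & Hd & A)|A]; [|exfalso; exact (K z0 Hz0 A)].
    apply A. rewrite Cmod_refl; auto.
Qed.

Lemma local_rep_shrink (f : C -> Cext) (z0 : C) (r s : R) (N D : C -> C) :
  0 < s -> s <= r -> local_rep f z0 r N D -> local_rep f z0 s N D.
Proof.
  intros Hs Hsr (Hr & HN & HD & H). split; auto. split; [|split].
  - intros z Hz. apply HN; lra.
  - intros z Hz. apply HD; lra.
  - intros z Hz. apply H; lra.
Qed.

(** [f] and [g] coincide exactly where the determinant of their local coordinates vanishes. This
    determinant is holomorphic at poles too, so its zeros are isolated or fill a disc. *)
Lemma meromorphic_identity (Om : C -> Prop) (f g : C -> Cext) : Defs.domain Om ->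
  meromorphic_on Om f -> meromorphic_on Om g ->
  (forall z, Om z -> f z = g z) \/
  (forall z0, Om z0 -> near_punctured z0 (fun z => f z <> g z)).
Proof.
  intros HOm Hf Hg. apply (domain_dichotomy Om (fun z => f z = g z) HOm). intros z0 Hz0.
  destruct (meromorphic_local_rep Om f z0 Hf Hz0) as (r1 & P & Q & Hr1 & HP & HQ & R1).
  destruct (meromorphic_local_rep Om g z0 Hg Hz0) as (r2 & N & D & Hr2 & HN & HD & R2).
  assert (Hm : 0 < Rmin r1 r2) by (apply Rmin_glb_lt; auto).
  assert (Hin : forall z, Cmod (z - z0) < Rmin r1 r2 -> Cmod (z - z0) < r1 /\ Cmod (z - z0) < r2).
  { intros z Hz. apply Rmin_Rgt_l in Hz. tauto. }
  destruct (isolated_zeros (fun z => P z * D z - Q z * N z)%C z0 (Rmin r1 r2)) as [H|(d & Hd & H)].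
  - intros z Hz. apply Hin in Hz as [Z1 Z2].
    apply Hol_minus; apply Hol_mult; first [apply HP; lra|apply HQ; lra|apply HN; lra|apply HD; lra].
  - left. exists (Rmin r1 r2). split; auto. intros z Hz. destruct (Hin z Hz) as [Z1 Z2].
    apply (rep_eq_iff _ _ _ _ _ _ (R1 z Z1) (R2 z Z2)). auto.
  - right. exists (Rmin d (Rmin r1 r2)). split; [apply Rmin_glb_lt; auto|]. intros z [Hz1 Hz2] E.
    apply Rmin_Rgt_l in Hz2 as [Hz2 Hz3]. destruct (Hin z Hz3) as [Z1 Z2].
    apply (H z (conj Hz1 Hz2)). apply (rep_eq_iff _ _ _ _ _ _ (R1 z Z1) (R2 z Z2)). auto.
Qed.

Lemma normal_of_equilipschitz (Om : C -> Prop) (fs : nat -> C -> Cext) : Defs.domain Om ->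
  (forall n, meromorphic_on Om (fs n)) -> locally_equilipschitz Om fs ->
  exists phi : nat -> nat, (forall n, (phi n < phi (S n))%nat) /\
    exists g : C -> Cext, (meromorphic_on Om g \/ (forall z, Om z -> g z = None)) /\
      loc_unif_conv Om (fun n => fs (phi n)) g.
Proof.
  intros HOm Hmer HL. destruct (arzela_ascoli Om fs HL) as (phi & g & Hphi & Hconv).
  exists phi. split; [exact Hphi|]. exists g. split.
  - pose proof HOm as (Hopen & _ & _).
    assert (Hloc : forall z0, Om z0 ->
      (exists d, 0 < d /\ forall z, Cmod (z - z0) < d -> g z = None) \/
      (exists d, 0 < d /\ (forall z, Cmod (z - z0) < d -> Om z) /\ meromorphic_at g z0 d)).
    { intros z0 Hz0. destruct (HL z0 Hz0) as (r1 & L & Hr1 & HL0 & Hlip).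
      destruct (Hconv z0 Hz0) as (r2 & Hr2 & Hc). destruct (Hopen z0 Hz0) as (r3 & Hr3 & Ho).
      set (r := Rmin r1 (Rmin r2 r3)).
      assert (Hr : 0 < r) by (unfold r; repeat apply Rmin_glb_lt; auto).
      assert (Hin : forall z, Cmod (z - z0) < r -> Cmod (z - z0) < r1 /\ Cmod (z - z0) < r2 /\ Om z).
      { intros z Hz. unfold r in Hz. apply Rmin_Rgt_l in Hz as [Z1 Hz]. apply Rmin_Rgt_l in Hz as [Z2 Z3]. auto. }
      assert (Hll : local_limit (fun n => fs (phi n)) g z0 r).
      { split; [|split].
        - intros n z Hz. apply (meromorphic_local_rep Om); [apply Hmer|apply Hin; auto].
        - intros eps He. destruct (Hc eps He) as (N & HN). exists N. intros n Hn z Hz.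
          eapply Rle_lt_trans; [apply chordal_le_sdist|]. apply HN; auto. apply Hin; auto.
        - exists L. split; auto. intros n z z' Hz Hz'. apply Hlip; apply Hin; auto. }
      destruct (local_limit_dichotomy _ g z0 r Hr Hll) as [A|(d & Hd & Hdr & A)]; auto.
      right. exists d. split; auto. split; auto. intros z Hz. apply Hin. lra. }
    destruct (domain_dichotomy Om (fun z => g z = None) HOm) as [A|A]; auto.
    { intros z0 Hz0. destruct (Hloc z0 Hz0) as [B|(d & Hd & _ & B & _)]; auto.
      right. exists d. split; auto. intros z Hz. apply B; auto. }
    left. intros z0 Hz0. destruct (Hloc z0 Hz0) as [(d & Hd & B)|(d & Hd & Ho & B)].
    + exfalso. destruct (near_punctured_point z0 (fun z => g z = None /\ g z <> None)); [|tauto].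
      apply near_punctured_and; auto. apply near_punctured_of_near. exists d. auto.
    + exists d. split; auto.
  - intros z0 Hz0. destruct (Hconv z0 Hz0) as (r & Hr & Hc). exists r. split; auto.
    intros eps He. destruct (Hc eps He) as (N & HN). exists N. intros n Hn z _ Hz.
    eapply Rle_lt_trans; [apply chordal_le_sdist|]. apply HN; auto.
Qed.

(** * Equi-Lipschitz bounds for the family *)

Lemma local_rep_bounded (f : C -> Cext) (z0 : C) (r : R) (N D : C -> C) : local_rep f z0 r N D ->
  exists s K, 0 < s /\ s <= r /\ 0 < K /\ forall z, Cmod (z - z0) < s -> Cmod (N z) <= K /\ Cmod (D z) <= K.
Proof.
  intros (Hr & HN & HD & _).
  destruct (Ccont_bound N z0) as (d1 & Hd1 & B1); [apply Hol_cont, HN; rewrite Cmod_refl; auto|].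
  destruct (Ccont_bound D z0) as (d2 & Hd2 & B2); [apply Hol_cont, HD; rewrite Cmod_refl; auto|].
  pose proof (Cmod_ge_0 (N z0)). pose proof (Cmod_ge_0 (D z0)).
  exists (Rmin r (Rmin d1 d2)), (Cmod (N z0) + Cmod (D z0) + 1).
  split; [repeat apply Rmin_glb_lt; auto|]. split; [apply Rmin_l|]. split; [lra|].
  intros z Hz. apply Rmin_Rgt_l in Hz as [_ Hz]. apply Rmin_Rgt_l in Hz as [Z1 Z2].
  specialize (B1 z Z1). specialize (B2 z Z2). lra.
Qed.

Lemma omitting_pair_equilipschitz (Om : C -> Prop) (a b c : C -> Cext) (z0 : C) (d : R) :
  meromorphic_on Om a -> meromorphic_on Om b -> meromorphic_on Om c ->
  0 < d -> (forall z, Cmod (z - z0) < d -> Om z) ->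
  (forall z, 0 < Cmod (z - z0) < d -> a z <> b z /\ a z <> c z /\ b z <> c z) ->
  exists s L, 0 < s /\ 0 <= L /\ forall f, meromorphic_on Om f ->
    (forall z, 0 < Cmod (z - z0) < d -> f z <> a z /\ f z <> b z /\ f z <> c z) ->
    f z0 <> a z0 -> f z0 <> b z0 ->
    forall z z', Cmod (z - z0) < s -> Cmod (z' - z0) < s -> chordal (f z) (f z') <= L * Cmod (z - z').
Proof.
  intros Ma Mb Mc Hd HOm Hdis.
  assert (Hz0 : Om z0) by (apply HOm; rewrite Cmod_refl; auto).
  destruct (meromorphic_local_rep Om a z0 Ma Hz0) as (r1 & Na & Da & La).
  destruct (meromorphic_local_rep Om b z0 Mb Hz0) as (r2 & Nb & Db & Lb).
  destruct (meromorphic_local_rep Om c z0 Mc Hz0) as (r3 & Nc & Dc & Lc).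
  destruct (local_rep_bounded _ _ _ _ _ La) as (s1 & K1 & Hs1 & Hsr1 & HK1 & B1).
  destruct (local_rep_bounded _ _ _ _ _ Lb) as (s2 & K2 & Hs2 & Hsr2 & HK2 & B2).
  set (R0 := Rmin (Rmin d r3) (Rmin s1 s2)).
  assert (Hle : R0 <= d /\ R0 <= r3 /\ R0 <= s1 /\ R0 <= s2).
  { unfold R0. pose proof (Rmin_l (Rmin d r3) (Rmin s1 s2)). pose proof (Rmin_r (Rmin d r3) (Rmin s1 s2)).
    pose proof (Rmin_l d r3). pose proof (Rmin_r d r3). pose proof (Rmin_l s1 s2). pose proof (Rmin_r s1 s2). lra. }
  assert (HR : 0 < R0) by (destruct Lc; unfold R0; repeat apply Rmin_glb_lt; auto).
  destruct (omitting_family_lipschitz a b c Na Da Nb Db Nc Dc z0 R0 (K1 + K2)) as (s & L & Hs & HL & H).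
  - lra.
  - apply (local_rep_shrink a z0 r1); auto; lra.
  - apply (local_rep_shrink b z0 r2); auto; lra.
  - apply (local_rep_shrink c z0 r3); auto; lra.
  - intros z Hz. pose proof (B1 z ltac:(lra)). pose proof (B2 z ltac:(lra)). lra.
  - intros z Hz. destruct (Hdis z ltac:(lra)) as (? & ? & ?). auto.
  - exists s, L. split; auto. split; auto. intros f Mf Hom Ha Hb. apply H.
    + intros z Hz. apply (meromorphic_local_rep Om); auto. apply HOm; lra.
    + intros z Hz. destruct (C_eq_dec z z0) as [->|n]; auto. apply Cmod_sub_pos in n.
      destruct (Hom z ltac:(lra)) as (? & ? & _). auto.
    + intros z Hz. apply Hom. lra.
Qed.

(** Which pair is omitted at [z0] depends on [f]. Taking the least of the three radii and the sum of
    the three constants makes the bound independent of that choice. *)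
Lemma omitting_family_equilipschitz (Om : C -> Prop) (p1 p2 p3 : C -> Cext) (z0 : C) (d : R) :
  meromorphic_on Om p1 -> meromorphic_on Om p2 -> meromorphic_on Om p3 ->
  0 < d -> (forall z, Cmod (z - z0) < d -> Om z) ->
  (forall z, 0 < Cmod (z - z0) < d -> p1 z <> p2 z /\ p1 z <> p3 z /\ p2 z <> p3 z) ->
  exists s L, 0 < s /\ 0 <= L /\ forall f, meromorphic_on Om f ->
    (forall z, 0 < Cmod (z - z0) < d -> ~ in_set3 (f z) (p1 z) (p2 z) (p3 z)) ->
    (p1 z0 = p2 z0 -> f z0 <> p1 z0) -> (p1 z0 = p3 z0 -> f z0 <> p1 z0) -> (p2 z0 = p3 z0 -> f z0 <> p2 z0) ->
    forall z z', Cmod (z - z0) < s -> Cmod (z' - z0) < s -> chordal (f z) (f z') <= L * Cmod (z - z').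
Proof.
  intros M1 M2 M3 Hd HOm Hdis.
  destruct (omitting_pair_equilipschitz Om p1 p2 p3 z0 d) as (t3 & C3 & Ht3 & HC3 & H12); auto.
  destruct (omitting_pair_equilipschitz Om p1 p3 p2 z0 d) as (t2 & C2 & Ht2 & HC2 & H13); auto.
  { intros z Hz. destruct (Hdis z Hz) as (? & ? & ?). auto. }
  destruct (omitting_pair_equilipschitz Om p2 p3 p1 z0 d) as (t1 & C1 & Ht1 & HC1 & H23); auto.
  { intros z Hz. destruct (Hdis z Hz) as (? & ? & ?). auto. }
  exists (Rmin t1 (Rmin t2 t3)), (C1 + C2 + C3). split; [repeat apply Rmin_glb_lt; auto|]. split; [lra|].
  intros f Mf Hom E12 E13 E23 z z' Hz Hz'.
  apply Rmin_Rgt_l in Hz as [Z1 Hz]. apply Rmin_Rgt_l in Hz as [Z2 Z3].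
  apply Rmin_Rgt_l in Hz' as [Z1' Hz']. apply Rmin_Rgt_l in Hz' as [Z2' Z3'].
  unfold in_set3 in Hom.
  assert (Hmono : forall c, 0 <= c <= C1 + C2 + C3 -> c * Cmod (z - z') <= (C1 + C2 + C3) * Cmod (z - z')).
  { intros c Hc. apply Rmult_le_compat_r; [apply Cmod_ge_0|lra]. }
  (* Otherwise [f] would equal two of the three functions at [z0]; these would coincide there, and
     hypothesis (ii) excludes their common value. *)
  assert (Hpair : (f z0 <> p1 z0 /\ f z0 <> p2 z0) \/ (f z0 <> p1 z0 /\ f z0 <> p3 z0) \/ (f z0 <> p2 z0 /\ f z0 <> p3 z0)).
  { destruct (classic (f z0 = p1 z0)) as [e1|n1], (classic (f z0 = p2 z0)) as [e2|n2], (classic (f z0 = p3 z0)) as [e3|n3]; try tauto.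
    - exfalso. apply E12; congruence.
    - exfalso. apply E12; congruence.
    - exfalso. apply E13; congruence.
    - exfalso. apply E23; congruence. }
  destruct Hpair as [[P1 P2]|[[P1 P2]|[P1 P2]]].
  - eapply Rle_trans; [apply (H12 f)|apply (Hmono C3); lra]; auto. intros x Hx. specialize (Hom x Hx). tauto.
  - eapply Rle_trans; [apply (H13 f)|apply (Hmono C2); lra]; auto. intros x Hx. specialize (Hom x Hx). tauto.
  - eapply Rle_trans; [apply (H23 f)|apply (Hmono C1); lra]; auto. intros x Hx. specialize (Hom x Hx). tauto.
Qed.

Lemma finite_family_equilipschitz (Om : C -> Prop) (fs : nat -> C -> Cext) (p1 p2 p3 : C -> Cext) : Defs.domain Om ->
  meromorphic_on Om p1 -> meromorphic_on Om p2 -> meromorphic_on Om p3 ->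
  (forall n, (forall z, Om z -> fs n z = p1 z) \/ (forall z, Om z -> fs n z = p2 z) \/ (forall z, Om z -> fs n z = p3 z)) ->
  locally_equilipschitz Om fs.
Proof.
  intros (Hopen & _) M1 M2 M3 H z0 Hz0. destruct (Hopen z0 Hz0) as (d & Hd & HOm).
  assert (K : forall p, meromorphic_on Om p -> exists s L, 0 < s /\ 0 <= L /\
    forall z z', Cmod (z - z0) < s -> Cmod (z' - z0) < s -> chordal (p z) (p z') <= L * Cmod (z - z')).
  { intros p Hp. destruct (meromorphic_local_rep Om p z0 Hp Hz0) as (r & N & D & HR).
    apply (meromorphic_lipschitz p z0 r N D HR). }
  destruct (K p1 M1) as (s1 & L1 & Hs1 & HL1 & B1). destruct (K p2 M2) as (s2 & L2 & Hs2 & HL2 & B2).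
  destruct (K p3 M3) as (s3 & L3 & Hs3 & HL3 & B3).
  exists (Rmin d (Rmin s1 (Rmin s2 s3))), (L1 + L2 + L3).
  split; [repeat apply Rmin_glb_lt; auto|]. split; [lra|]. intros n z z' Hz Hz'.
  apply Rmin_Rgt_l in Hz as [Z0 Hz]. apply Rmin_Rgt_l in Hz as [Z1 Hz]. apply Rmin_Rgt_l in Hz as [Z2 Z3].
  apply Rmin_Rgt_l in Hz' as [Z0' Hz']. apply Rmin_Rgt_l in Hz' as [Z1' Hz']. apply Rmin_Rgt_l in Hz' as [Z2' Z3'].
  pose proof (Cmod_ge_0 (z - z')) as T0.
  assert (Oz : Om z) by (apply HOm; auto). assert (Oz' : Om z') by (apply HOm; auto).
  destruct (H n) as [E|[E|E]]; rewrite !E by auto; (eapply Rle_trans; [first [apply B1|apply B2|apply B3]; auto|]);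
    apply Rmult_le_compat_r; lra.
Qed.

(* Coquelicot defines another [domain]. *)
Import Defs.

Theorem theorem4 (Om : Cx -> Prop) (F : (Cx -> Cext) -> Prop) (p1 p2 p3 : Cx -> Cext) :
  domain Om ->
  (forall f, F f -> meromorphic_on Om f) ->
  meromorphic_on Om p1 -> meromorphic_on Om p2 -> meromorphic_on Om p3 ->
  not_ident_eq Om p1 p2 -> not_ident_eq Om p1 p3 -> not_ident_eq Om p2 p3 ->
  (forall f g, F f -> F g -> share_set Om f g p1 p2 p3) ->
  (forall f z0, F f -> Om z0 ->
     (p1 z0 = p2 z0 -> f z0 <> p1 z0) /\
     (p1 z0 = p3 z0 -> f z0 <> p1 z0) /\
     (p2 z0 = p3 z0 -> f z0 <> p2 z0)) ->
  normal_family Om F.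
Proof.
  intros HOm HF M1 M2 M3 N12 N13 N23 Hshare Hval fs Hfs.
  apply normal_of_equilipschitz; auto.
  pose proof HOm as (Hopen & _ & _).
  assert (Hid : forall f, F f ->
    (forall z, Om z -> f z = p1 z) \/ (forall z, Om z -> f z = p2 z) \/ (forall z, Om z -> f z = p3 z) \/
    (forall z0, Om z0 -> near_punctured z0 (fun z => ~ in_set3 (f z) (p1 z) (p2 z) (p3 z)))).
  { intros f Ff. pose proof (HF f Ff) as Mf.
    destruct (meromorphic_identity Om f p1 HOm Mf M1) as [A|A1]; auto.
    destruct (meromorphic_identity Om f p2 HOm Mf M2) as [A|A2]; auto.
    destruct (meromorphic_identity Om f p3 HOm Mf M3) as [A|A3]; auto.
    right; right; right. intros z0 Hz0.
    destruct (near_punctured_and _ _ _ (A1 z0 Hz0) (near_punctured_and _ _ _ (A2 z0 Hz0) (A3 z0 Hz0))) as (d & Hd & B).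
    exists d. split; auto. intros z Hz. specialize (B z Hz). unfold in_set3. tauto. }
  (* By sharing, the member [fs 0] decides for the whole sequence which of the two cases occurs. *)
  destruct (classic (forall z, Om z -> in_set3 (fs 0%nat z) (p1 z) (p2 z) (p3 z))) as [Hall|Hnall].
  - apply (finite_family_equilipschitz Om fs p1 p2 p3); auto. intros n.
    destruct (Hid (fs n) (Hfs n)) as [A|[A|[A|A]]]; auto. exfalso.
    pose proof HOm as (_ & (z0 & Hz0) & _).
    destruct (near_punctured_point _ _ (near_punctured_and _ _ _ (A z0 Hz0) (near_punctured_of_near _ _ (Hopen z0 Hz0)))) as (w & Hw & Ow).
    apply Hw, (Hshare (fs 0%nat) (fs n) (Hfs 0%nat) (Hfs n) w Ow), Hall, Ow.
  - assert (H0 : forall z0, Om z0 -> near_punctured z0 (fun z => ~ in_set3 (fs 0%nat z) (p1 z) (p2 z) (p3 z))).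
    { destruct (Hid (fs 0%nat) (Hfs 0%nat)) as [A|[A|[A|A]]]; auto; exfalso; apply Hnall; intros z Hz; unfold in_set3; auto. }
    assert (Hneq : forall p q, meromorphic_on Om p -> meromorphic_on Om q -> not_ident_eq Om p q ->
      forall z0, Om z0 -> near_punctured z0 (fun z => p z <> q z)).
    { intros p q Mp Mq Hn. destruct (meromorphic_identity Om p q HOm Mp Mq); auto. contradiction. }
    intros z0 Hz0. destruct (Hopen z0 Hz0) as (d1 & Hd1 & HO).
    destruct (near_punctured_and _ _ _ (H0 z0 Hz0) (near_punctured_and _ _ _ (Hneq p1 p2 M1 M2 N12 z0 Hz0)
      (near_punctured_and _ _ _ (Hneq p1 p3 M1 M3 N13 z0 Hz0) (Hneq p2 p3 M2 M3 N23 z0 Hz0)))) as (d2 & Hd2 & HP).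
    set (d := Rmin d1 d2). assert (Hd : 0 < d) by (apply Rmin_glb_lt; auto).
    assert (HOd : forall z, Cmod (z - z0) < d -> Om z).
    { intros z Hz. apply Rmin_Rgt_l in Hz as [Hz _]. apply HO; auto. }
    assert (HPd : forall z, 0 < Cmod (z - z0) < d -> 0 < Cmod (z - z0) < d2).
    { intros z [Hz Hz']. apply Rmin_Rgt_l in Hz' as [_ Hz']. auto. }
    destruct (omitting_family_equilipschitz Om p1 p2 p3 z0 d M1 M2 M3 Hd HOd) as (s & L & Hs & HL & HLip).
    { intros z Hz. apply HP; auto. }
    exists s, L. split; auto. split; auto. intros n. apply HLip; auto.
    (* The punctured disc was obtained from [fs 0] and [p1], [p2], [p3] alone. Sharing carries the
       omission over to [fs n] on the same disc, so the radius does not depend on [n]. *)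
    + intros z Hz Hs3. apply (proj1 (HP z (HPd z Hz))).
      apply (Hshare (fs 0%nat) (fs n) (Hfs 0%nat) (Hfs n) z (HOd z (proj2 Hz))). exact Hs3.
    + apply (Hval (fs n) z0); auto.
    + apply (Hval (fs n) z0); auto.
    + apply (Hval (fs n) z0); auto.
Qed.
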